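(* Let $E=(E^0,E^1,r,s)$ be a row-finite directed graph and let $J\subseteq C^*(E)$ be a gauge-invariant ideal. Then (1) $J^\perp = I\big(E^0\setminus \overline{H}(J)\big)$; (2) $J^{\perp\perp} = I\big(\{w\in E^0 : T(w)\subseteq \overline{H}(J)\}\big)$; (3) $J$ is regular if and only if $H(J)=\{w\in E^0 : T(w)\subseteq \overline{H}(J)\}$.
   Context: A directed graph $E=(E^0,E^1,r,s)$ has vertex set $E^0$, edge set $E^1$, and range and source maps $r,s:E^1\to E^0$; it is row-finite if $r^{-1}(v)$ is finite for every $v\in E^0$. A path of length $N\geq 1$ is a sequence of edges $\alpha=\alpha_1\alpha_2\cdots\alpha_N$ with $s(\alpha_i)=r(\alpha_{i+1})$; put $r(\alpha)=r(\alpha_1)$ and $s(\alpha)=s(\alpha_N)$. $E^*$ is the set of all vertices and all finite paths, with $r(v)=s(v)=v$ for a vertex $v$. $C^*(E)$ is the universal $C^*$-algebra generated by a Cuntz-Krieger $E$-family $\{s_e,p_v: e\in E^1, v\in E^0\}$: the $p_v$ are mutually orthogonal projections, the $s_e$ are partial isometries, $s_e^*s_e=p_{s(e)}$ for all $e\in E^1$, and $p_v=\sum_{r(e)=v}s_es_e^*$ whenever $r^{-1}(v)\neq\emptyset$ (the convention of Raeburn's monograph). For a path $\alpha=\alpha_1\cdots\alpha_N$, $s_\alpha=s_{\alpha_1}\cdots s_{\alpha_N}$, and $s_v=p_v$ for a vertex $v$. The gauge action $\gamma$ of $\mathbb{T}$ on $C^*(E)$ is determined by $\gamma_z(s_e)=zs_e$,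 $\gamma_z(p_v)=p_v$. Ideals are closed and two-sided; an ideal $J$ is gauge-invariant if $\gamma_z(J)=J$ for all $z\in\mathbb{T}$. For a subset $X$ of a $C^*$-algebra $A$, $X^\perp=\{a\in A: ax=xa=0\text{ for all }x\in X\}$, and $X^{\perp\perp}=(X^\perp)^\perp$. An ideal $J$ of $A$ is regular if $J=J^{\perp\perp}$. For an ideal $J$ of $C^*(E)$, $H(J)=\{v\in E^0: p_v\in J\}$ and $\overline{H}(J)=\{r(\alpha):\alpha\in E^*\text{ and } s(\alpha)\in H(J)\}$. For $w\in E^0$, $T(w)=\{s(\alpha):\alpha\in E^*,\ r(\alpha)=w\}$. For $H\subseteq E^0$, $I(H)$ is the ideal of $C^*(E)$ generated by $\{p_v: v\in H\}$; when $H$ is hereditary (i.e. $\mu\in E^*$ and $r(\mu)\in H$ imply $s(\mu)\in H$), $I(H)=\overline{\operatorname{span}}\{s_\alpha s_\beta^*:\alpha,\beta\in E^*,\ s(\alpha)=s(\beta)\in H\}$. *)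

(* Defs.v *)
From HB Require Import structures.
From mathcomp Require Import all_boot all_order all_algebra.
From mathcomp Require Import complex.
From mathcomp Require Import all_classical all_reals all_analysis.

Set Implicit Arguments.
Unset Strict Implicit.
Unset Printing Implicit Defensive.

Import Order.TTheory GRing.Theory Num.Theory.
Import numFieldNormedType.Exports.

Local Open Scope classical_set_scope.
Local Open Scope ring_scope.

(* C*-algebras need not be unital, so the product cannot come from the ring
   structures of the library.  As for any normed module over R[i], norms take
   their values in R[i] (they are real and nonnegative there). *)
HB.mixin Record isCStarAlgebra (R : realType) A
    of CompleteNormedModule R[i] A := {
  cmul : A -> A -> A;
  cstar : A -> A;
  cmulA : associative cmul;
  cmulDl : left_distributive cmul +%R;
  cmulDr : right_distributive cmul +%R;
  cmulZl : forall (a : R[i]) (x y : A), cmul (a *: x) y = a *: cmul x y;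
  cmulZr : forall (a : R[i]) (x y : A), cmul x (a *: y) = a *: cmul x y;
  cstarK : involutive cstar;
  cstarD : forall x y : A, cstar (x + y) = cstar x + cstar y;
  cstarZ : forall (a : R[i]) (x : A), cstar (a *: x) = a^* *: cstar x;
  cstarM : forall x y : A, cstar (cmul x y) = cmul (cstar y) (cstar x);
  norm_cmul : forall x y : A, `|cmul x y| <= `|x| * `|y|;
  norm_cstar : forall x : A, `|cmul (cstar x) x| = `|x| ^+ 2
}.

#[short(type="cstarAlgType")]
HB.structure Definition CStarAlgebra (R : realType) :=
  {A of isCStarAlgebra R A & CompleteNormedModule R[i] A}.

Section CStar.
Context {R : realType}.
Implicit Types A B : cstarAlgType R.

Definition is_projection A (p : A) := cstar p = p /\ cmul p p = p.

Definition is_partial_isometry A (x : A) := cmul (cmul x (cstar x)) x = x.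

Definition is_star_hom A B (phi : A -> B) :=
  [/\ linear phi,
      forall x y, phi (cmul x y) = cmul (phi x) (phi y) &
      forall x, phi (cstar x) = cstar (phi x)].

Definition is_subspace A (M : set A) :=
  [/\ M 0,
      forall x y, M x -> M y -> M (x + y) &
      forall (a : R[i]) x, M x -> M (a *: x)].

Definition is_cstar_subalgebra A (M : set A) :=
  [/\ is_subspace M,
      forall x y, M x -> M y -> M (cmul x y),
      forall x, M x -> M (cstar x) &
      closed M].

Definition is_ideal A (J : set A) :=
  [/\ is_subspace J,
      forall a x, J x -> J (cmul a x),
      forall a x, J x -> J (cmul x a) &
      closed J].

Definition ideal_generated_by A (X : set A) : set A := smallest (@is_ideal A) X.

Definition annihilator A (X : set A) : set A :=
  [set a | forall x, X x -> cmul a x = 0 /\ cmul x a = 0].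

Definition is_regular A (J : set A) := J = annihilator (annihilator J).

End CStar.

(* [choiceType] is only there for boolean equality of vertices and for sums
   over sets of edges; classically every type carries such a structure. *)
Record digraph := Digraph {
  vertex : choiceType;
  edge : choiceType;
  rng : edge -> vertex;
  src : edge -> vertex
}.

Section Graph.
Variable E : digraph.

Definition edges_into (v : vertex E) : set (edge E) := [set e | rng e = v].

Definition row_finite := forall v : vertex E, finite_set (edges_into v).

(* Paths are composed as in the monograph of Raeburn: in e1 e2 ... eN the
   source of each edge is the range of the next one. *)
Definition composable : rel (edge E) := fun e f => src e == rng f.

(* E^* : the vertices, and the paths [e :: l] of length at least 1. *)
Inductive fpath :=
  | VertexPath of vertex E
  | EdgePath (e : edge E) (l : seq (edge E)) of path composable e l.

Definition path_rng (a : fpath) : vertex E :=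
  match a with VertexPath v => v | EdgePath e _ _ => rng e end.

Definition path_src (a : fpath) : vertex E :=
  match a with VertexPath v => v | EdgePath e l _ => src (last e l) end.

(* T(w) *)
Definition tree (w : vertex E) : set (vertex E) :=
  [set path_src a | a in [set a | path_rng a = w]].

End Graph.

Section GraphAlgebra.
Context {R : realType} {E : digraph}.
Implicit Types A B : cstarAlgType R.

(* Meant for row-finite E: the big sum over an infinite set would be junk. *)
Definition is_CK_family A (s : edge E -> A) (p : vertex E -> A) :=
  [/\ forall v, is_projection (p v),
      forall v w, v <> w -> cmul (p v) (p w) = 0,
      forall e, is_partial_isometry (s e),
      forall e, cmul (cstar (s e)) (s e) = p (src e) &
      forall v, edges_into v !=set0 ->
        p v = \sum_(e \in edges_into v) cmul (s e) (cstar (s e))].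

(* (A, s, p) is C^*(E), determined up to isomorphism: A is generated by a
   Cuntz-Krieger E-family through which all other ones factor.  The morphism
   [phi] is unique since s and p generate A. *)
Definition is_graph_algebra A (s : edge E -> A) (p : vertex E -> A) :=
  [/\ is_CK_family s p,
      smallest (@is_cstar_subalgebra R A) (range s `|` range p) = setT &
      forall B (t : edge E -> B) (q : vertex E -> B), is_CK_family t q ->
        exists phi : A -> B,
          [/\ is_star_hom phi,
              forall e, phi (s e) = t e &
              forall v, phi (p v) = q v]].

(* In C^*(E) these formulas determine [gamma z] for z on the unit circle, so
   that the laws of an action follow; other values of z are irrelevant. *)
Definition is_gauge_action A (s : edge E -> A) (p : vertex E -> A)
    (gamma : R[i] -> A -> A) :=
  forall z : R[i], `|z| = 1 ->
    [/\ is_star_hom (gamma z),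
        forall e, gamma z (s e) = z *: s e &
        forall v, gamma z (p v) = p v].

Definition gauge_invariant A (gamma : R[i] -> A -> A) (J : set A) :=
  forall z : R[i], `|z| = 1 -> gamma z @` J = J.

Section VertexSets.
Context {A : cstarAlgType R}.
Variable p : vertex E -> A.

(* H(J) *)
Definition ideal_vertices (J : set A) : set (vertex E) := [set v | J (p v)].

(* \overline{H}(J) *)
Definition ideal_vertices_bar (J : set A) : set (vertex E) :=
  [set path_rng a | a in [set a | ideal_vertices J (path_src a)]].

(* I(H) *)
Definition vertex_ideal (H : set (vertex E)) : set A :=
  ideal_generated_by (p @` H).

End VertexSets.

End GraphAlgebra.

(* Main.v *)
(* A closed ideal K stable under the gauge action is generated by the vertex
   projections it contains.  By Fejer summation over roots of unity it is enough
   to approximate homogeneous finite sums b = sum c s_a s_b^*.  Such a b, close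
   to K, maps the inner product spaces spanned by the s_a with s(a) = w
   to one another; as |b x|^2 p_w is close to K while p_w is at
   distance 1 from K when w is not in H(K), the part of b supported on those w
   is small, and the rest of b is in I(H(K)).

   With J = I(H(J)), p_v is in the annihilator of J exactly when no path with
   range v has its source in H(J); here p_w <> 0 is needed, which follows from a
   representation on l^2(E^0 x nat).  Since the annihilator is again gauge
   invariant, this gives (1), and (2) and (3) follow by applying (1) twice. *)

From HB Require Import structures.
Require Import Defs.
From mathcomp Require Import all_boot all_order all_algebra.
From mathcomp Require Import complex.
From mathcomp Require Import all_classical all_reals all_analysis.
From mathcomp Require Import ring lra zify.

Set Implicit Arguments.
Unset Strict Implicit.
Unset Printing Implicit Defensive.

Import Order.TTheory GRing.Theory Num.Theory.
Import numFieldNormedType.Exports.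

Local Open Scope classical_set_scope.
Local Open Scope ring_scope.

(** Quotients, spectra and functional calculus are avoided. Distance to K replaces the quotient
    norm, and the one analytic tool is a square root of 1 - h for |h| < 1, found by iteration. It
    yields two facts not among the axioms: star homomorphisms, in particular each [gamma z], are
    contractive; and the range projections of the edges into one vertex are orthogonal, because
    projections whose sum is a projection must be.

    The gauge action comes without continuity in z, so it is not integrated over the circle; finite
    averages suffice because a finite sum involves finitely many degrees. The projection onto one
    degree is contractive, but a sum of many such projections need not be, whence the nonnegative
    Fejer weights.

    Ideals are not defined as stable under the star, so b and b^*, or left and right products, are
    treated separately.

    As the algebra is given by its universal property, p_w <> 0 has to be read off from a family in
    a concrete C*-algebra. Infinite multiplicity at every vertex lets each space be the sum of those
    at the sources of its incoming edges, cycles included. *)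

Local Notation "x ** y" := (cmul x y) (at level 40, left associativity).

(** * Real-valued norms *)

Section Modulus.
Context {R : realType}.

(* The norms of the library take values in R[i]; working with real numbers
   gives access to a total order. *)
Definition nm {V : normedZmodType R[i]} (x : V) : R := complex.Re `|x|.

Lemma nmE {V : normedZmodType R[i]} (x : V) : `|x| = (nm x)%:C%C.
Proof. by rewrite /nm RRe_real ?ger0_real. Qed.

Lemma nm_ge0 {V : normedZmodType R[i]} (x : V) : 0 <= nm x.
Proof. by rewrite -ler0c -nmE. Qed.

Lemma nmD {V : normedZmodType R[i]} (x y : V) : nm (x + y) <= nm x + nm y.
Proof. by have := ler_normD x y; rewrite !nmE -rmorphD/= lecR. Qed.

Lemma nmN {V : normedZmodType R[i]} (x : V) : nm (- x) = nm x.
Proof. by rewrite /nm normrN. Qed.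

Lemma nmB {V : normedZmodType R[i]} (x y : V) : nm (x - y) = nm (y - x).
Proof. by rewrite /nm distrC. Qed.

Lemma nm0 {V : normedZmodType R[i]} : nm (0 : V) = 0.
Proof. by rewrite /nm normr0. Qed.

Lemma nm_eq0 {V : normedZmodType R[i]} (x : V) : nm x = 0 -> x = 0.
Proof. by move=> h; apply/normr0_eq0; rewrite nmE h. Qed.

Lemma nm_triangle {V : normedZmodType R[i]} (x y z : V) :
  nm (x - z) <= nm (x - y) + nm (y - z).
Proof. by rewrite -[in leLHS](subrK y x) -addrA nmD. Qed.

Lemma nm_sum {V : normedZmodType R[i]} I (r : seq I) (P : pred I) (F : I -> V) :
  nm (\sum_(i <- r | P i) F i) <= \sum_(i <- r | P i) nm (F i).
Proof.
apply: (big_ind2 (fun x y => nm x <= y)) => [|x a y b xa yb|//].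
  by rewrite nm0.
by apply: le_trans (nmD _ _) _; rewrite lerD.
Qed.

Lemma nmZ {V : normedModType R[i]} (c : R[i]) (x : V) : nm (c *: x) = nm c * nm x.
Proof. by apply/complexI; rewrite -nmE normrZ !nmE rmorphM. Qed.

Lemma nmM (c d : R[i]) : nm (c * d) = nm c * nm d.
Proof. by apply/complexI; rewrite -nmE normrM !nmE rmorphM. Qed.

Lemma nm_real (r : R) : nm r%:C%C = `|r|.
Proof. by rewrite /nm normc_def/= expr0n addr0 sqrtr_sqr. Qed.

Lemma nm_conj (c : R[i]) : nm c^* = nm c.
Proof. by rewrite /nm norm_conjC. Qed.

Lemma nm1 : nm (1 : R[i]) = 1.
Proof. by rewrite /nm normr1. Qed.

Lemma nmi : nm ('i : R[i]) = 1.
Proof. by rewrite /nm normCi. Qed.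

Lemma nmX (c : R[i]) n : nm (c ^+ n) = nm c ^+ n.
Proof. by elim: n => [|n IH]; rewrite ?nm1// !exprS nmM IH. Qed.

Lemma ball_nmP {V : normedModType R[i]} (x y : V) (e : R) :
  ball x e%:C%C y <-> nm (x - y) < e.
Proof. by rewrite -ball_normE /ball_/= nmE ltcR. Qed.

Lemma nbhs_nm {V : normedModType R[i]} (x : V) (e : R) (A : set V) :
  nbhs x A -> exists2 d : R, 0 < d & forall y, nm (x - y) < d -> A y.
Proof.
move=> /nbhs_ballP [e' e'0 sub]; exists (complex.Re e').
  by move: e'0; rewrite /= ltcE => /andP[].
move=> y xy; apply: sub; rewrite -ball_normE /ball_/= nmE ltcE/=.
by move: e'0; rewrite /= ltcE => /andP[/eqP -> _]; rewrite /= eqxx.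
Qed.

Lemma closed_nm {V : normedModType R[i]} (M : set V) (x : V) :
  closed M -> (forall e : R, 0 < e -> exists2 y, M y & nm (x - y) <= e) -> M x.
Proof.
move=> clM h; apply: clM => A /(nbhs_nm 0) [d d0 sub].
have [|y My xy] := h (d / 2); first by rewrite divr_gt0.
by exists y; split=> //; apply: sub; apply: le_lt_trans xy _; lra.
Qed.

Lemma cvg_nm {V : completeNormedModType R[i]} (u : nat -> V) :
  (forall e : R, 0 < e -> exists N, forall m n, (N <= m)%N -> (N <= n)%N ->
    nm (u m - u n) <= e) ->
  exists l : V, forall e : R, 0 < e -> exists N, forall n, (N <= n)%N ->
    nm (l - u n) <= e.
Proof.
move=> h.
have : cauchy (u @ \oo).
  apply/cauchy_ballP => e e0.
  have e'0 : 0 < complex.Re e by move: e0; rewrite ltcE => /andP[].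
  have eE : e = (complex.Re e)%:C%C by rewrite RRe_real ?gtr0_real.
  have [|N hN] := h (complex.Re e / 2); first by rewrite divr_gt0.
  exists (u @` [set n | (N <= n)%N], u @` [set n | (N <= n)%N]).
    by split; exists N => // n /= Nn; exists n.
  move=> [_ _] [[m Nm <-] [n Nn <-]] /=.
  rewrite -ball_normE /ball_/= nmE eE ltcR.
  apply: le_lt_trans (hN _ _ Nm Nn) _; rewrite ltr_pdivrMr//; lra.
move=> /cauchy_cvg /cvg_ex [l ul]; exists l => e e0.
have /cvgrPdist_le /(_ e%:C%C) := ul.
rewrite ltcR => /(_ e0) [N _ hN]; exists N => n Nn.
by have := hN n Nn; rewrite nmE lecR.
Qed.

End Modulus.

(** * Elementary consequences of the C*-axioms *)

Section CStarBasics.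
Context {R : realType} {A : cstarAlgType R}.
Implicit Types x y z a b : A.

Lemma cmul0l x : 0 ** x = 0.
Proof. by rewrite -(scale0r (0 : A)) cmulZl !scale0r. Qed.

Lemma cmul0r x : x ** 0 = 0.
Proof. by rewrite -(scale0r (0 : A)) cmulZr !scale0r. Qed.

Lemma cmulNl x y : (- x) ** y = - (x ** y).
Proof. by rewrite -scaleN1r cmulZl scaleN1r. Qed.

Lemma cmulNr x y : x ** (- y) = - (x ** y).
Proof. by rewrite -scaleN1r cmulZr scaleN1r. Qed.

Lemma cmulBl x y z : (x - y) ** z = x ** z - y ** z.
Proof. by rewrite cmulDl cmulNl. Qed.

Lemma cmulBr x y z : x ** (y - z) = x ** y - x ** z.
Proof. by rewrite cmulDr cmulNr. Qed.

Lemma cmul_suml I (r : seq I) (P : pred I) (F : I -> A) y :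
  (\sum_(i <- r | P i) F i) ** y = \sum_(i <- r | P i) F i ** y.
Proof. by rewrite (big_morph (fun x => x ** y) (fun a b => cmulDl a b y) (cmul0l y)). Qed.

Lemma cmul_sumr I (r : seq I) (P : pred I) (F : I -> A) y :
  y ** (\sum_(i <- r | P i) F i) = \sum_(i <- r | P i) y ** F i.
Proof. by rewrite (big_morph (fun x => y ** x) (fun a b => cmulDr y a b) (cmul0r y)). Qed.

Lemma cstar0 : cstar (0 : A) = 0.
Proof. by rewrite -(scale0r (0 : A)) cstarZ conjC0 !scale0r. Qed.

Lemma cstarN x : cstar (- x) = - cstar x.
Proof. by rewrite -scaleN1r cstarZ rmorphN1 scaleN1r. Qed.

Lemma cstarB x y : cstar (x - y) = cstar x - cstar y.
Proof. by rewrite cstarD cstarN. Qed.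

Lemma cstar_sum I (r : seq I) (P : pred I) (F : I -> A) :
  cstar (\sum_(i <- r | P i) F i) = \sum_(i <- r | P i) cstar (F i).
Proof. by rewrite (big_morph (@cstar R A) (@cstarD R A) cstar0). Qed.

Lemma nm_cmul x y : nm (x ** y) <= nm x * nm y.
Proof. by have := norm_cmul x y; rewrite !nmE -rmorphM/= lecR. Qed.

Lemma nm_cstarM x : nm (cstar x ** x) = nm x ^+ 2.
Proof. by apply/complexI; rewrite -nmE norm_cstar nmE rmorphXn. Qed.

(** The C*-identity and submultiplicativity give |y|^2 <= |y^*| |y|; this is applied to x and to its
    adjoint. *)
Lemma nm_cstar x : nm (cstar x) = nm x.
Proof.
have le y : nm y <= nm (cstar y).
  have [->|y0] := eqVneq (nm y) 0; first exact: nm_ge0.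
  have y0' : 0 < nm y by rewrite lt_def y0 nm_ge0.
  rewrite -(ler_pM2r y0') -expr2 -nm_cstarM; exact: nm_cmul.
by apply/eqP; rewrite eq_le le andbT -{2}(cstarK x) le.
Qed.

Lemma cstar_mul_eq0 x : cstar x ** x = 0 -> x = 0.
Proof.
move=> h; apply: nm_eq0; apply/eqP; rewrite -sqrf_eq0 -nm_cstarM h.
by rewrite nm0.
Qed.

Lemma nm_projection (q : A) : is_projection q -> nm q <= 1.
Proof.
move=> [qs qq]; have := nm_cstarM q; rewrite qs qq => h.
have := nm_ge0 q; nra.
Qed.

Lemma nm_projection_neq0 (q : A) : is_projection q -> q != 0 -> nm q = 1.
Proof.
move=> [qs qq] q0; have := nm_cstarM q; rewrite qs qq => h.
have : nm q != 0 by apply: contra q0 => /eqP /nm_eq0 ->.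
move=> /mulIf; apply; by rewrite mul1r -expr2.
Qed.

End CStarBasics.

(** * Square roots and positivity in C*-algebras *)

Section SquareRoot.
Context {R : realType}.

Lemma expr_small (r e : R) : 0 <= r -> r < 1 -> 0 < e -> exists N, r ^+ N <= e.
Proof.
move=> r0 r1 e0; have /cvgr0Pnorm_le /(_ e e0) : r ^+ n @[n --> \oo] --> (0 : R).
  by apply: cvg_expr; rewrite ger0_norm.
move=> [N _ hN]; exists N; have := hN N (leqnn _).
by rewrite ger0_norm// exprn_ge0.
Qed.

Lemma geometric_cauchy {V : completeNormedModType R[i]} (u : nat -> V) (r : R) :
  0 <= r -> r < 1 -> (forall n, nm (u n.+1 - u n) <= r ^+ n) ->
  exists l : V, forall e : R, 0 < e -> exists N, forall n, (N <= n)%N ->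
    nm (l - u n) <= e.
Proof.
move=> r0 r1 hu; apply: cvg_nm => e e0.
have r1' : 0 < 1 - r by rewrite subr_gt0.
have [|N hN] := @expr_small r (e * (1 - r)) r0 r1; first by rewrite mulr_gt0.
have tail m k : (1 - r) * nm (u (m + k)%N - u m) <= r ^+ m - r ^+ (m + k).
  elim: k => [|k IH]; first by rewrite addn0 !subrr nm0 mulr0.
  have := ler_wpM2l (ltW r1') (nm_triangle (u (m + k.+1)%N) (u (m + k)%N) (u m)).
  have := ler_wpM2l (ltW r1') (hu (m + k)%N).
  rewrite addnS exprS; move: IH; nra.
have main m n : (N <= m)%N -> (m <= n)%N -> nm (u n - u m) <= e.
  move=> Nm mn; rewrite -(ler_pM2l r1') mulrC [leRHS]mulrC mulrC.
  rewrite -(subnKC mn); apply: le_trans (tail _ _) _.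
  apply: le_trans (_ : r ^+ N <= _) => //.
  have : r ^+ m <= r ^+ N by apply: ler_wiXn2l => //; exact: ltW.
  have : 0 <= r ^+ (m + (n - m)) by rewrite exprn_ge0.
  lra.
exists N => m n Nm Nn; have [mn|/ltnW nm_] := leqP m n; last exact: main.
by rewrite nmB; exact: main.
Qed.

Lemma nm_closed {V : normedModType R[i]} (M : set V) :
  (forall x, (forall e : R, 0 < e -> exists2 y, M y & nm (x - y) <= e) -> M x) ->
  closed M.
Proof.
move=> h x clx; apply: h => e e0.
have [|y [My]] := clx (ball x e%:C%C).
  by apply: nbhsx_ballx; rewrite ltcR.
by rewrite -ball_normE /ball_/= nmE ltcR => /ltW; exists y.
Qed.

Lemma small_eq0 (x : R) : 0 <= x -> (forall e, 0 < e -> x <= e) -> x = 0.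
Proof.
move=> x0 h; apply/eqP; rewrite eq_le x0 andbT; apply/ler_addgt0Pl => e e0; rewrite addr0; exact: h.
Qed.

Lemma closed_eq0 {V W : normedModType R[i]} (f : V -> W) (c : R) :
  (forall x y, nm (f x - f y) <= c * nm (x - y)) -> closed [set x | f x = 0].
Proof.
move=> lip; apply: nm_closed => x h /=; apply/nm_eq0/small_eq0; first exact: nm_ge0.
move=> e e0; have c0 : 0 <= `|c| by [].
have [|y /= fy xy] := h (e / (`|c| + 1)); first by rewrite divr_gt0// ltr_wpDl.
have := lip x y; rewrite fy subr0 => /le_trans; apply.
move: xy; rewrite ler_pdivlMr ?ltr_wpDl// => xy.
have := ler_wpM2r (nm_ge0 (x - y)) (ler_norm c); have := nm_ge0 (x - y); nra.
Qed.

Context {A : cstarAlgType R}.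
Implicit Types x y z h a b : A.

Lemma closed_eq (f g : A -> A) (c : R) : linear f -> linear g ->
  (forall x, nm (f x) <= c * nm x) -> (forall x, nm (g x) <= c * nm x) ->
  closed [set x | f x = g x].
Proof.
move=> fl gl fc gc.
have -> : [set x | f x = g x] = [set x | f x - g x = 0].
  by apply/seteqP; split=> x /= => [->|/eqP]; rewrite ?subrr// subr_eq0 => /eqP.
apply: (@closed_eq0 _ _ _ (c + c)) => x y.
have fB : f x - f y = f (x - y).
  by rewrite -[x in f x](subrK y) -{1}[x - y]scale1r fl scale1r addrK.
have gB : g x - g y = g (x - y).
  by rewrite -[x in g x](subrK y) -{1}[x - y]scale1r gl scale1r addrK.
rewrite opprB [X in nm (_ + X)]addrC addrACA [X in nm (_ + X)]addrC -(opprB (g x)) fB gB.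
by rewrite mulrDl; apply: le_trans (nmD _ _) _; rewrite nmN lerD.
Qed.

(** The y of [sqrt_one_sub] lies in every C*-subalgebra containing h, so it inherits from h the
    commutation with [a]. Membership in a corner is transferred in the same way by
    [corner_subalgebra]. *)
Lemma commutant_subalgebra a : cstar a = a ->
  is_cstar_subalgebra [set x | a ** x = x ** a].
Proof.
move=> as_; split.
- split=> /=; first by rewrite cmul0l cmul0r.
  + by move=> x y xa ya; rewrite cmulDl cmulDr xa ya.
  + by move=> c x xa; rewrite cmulZl cmulZr xa.
- by move=> x y /= xa ya; rewrite cmulA xa -cmulA ya cmulA.
- by move=> x /= xa; rewrite -{1}as_ -cstarM -xa cstarM as_.
- apply: (@closed_eq _ _ (nm a)).
  + by move=> c x y; rewrite cmulDr cmulZr.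
  + by move=> c x y; rewrite cmulDl cmulZl.
  + by move=> x; exact: nm_cmul.
  + by move=> x; rewrite mulrC; exact: nm_cmul.
Qed.

Lemma corner_subalgebra a : cstar a = a ->
  is_cstar_subalgebra [set x | a ** x = x /\ x ** a = x].
Proof.
move=> as_; split.
- split=> /=; first by rewrite cmul0l cmul0r.
  + by move=> x y [xa xa'] [ya ya']; rewrite cmulDl cmulDr xa ya xa' ya'.
  + by move=> c x [xa xa']; rewrite cmulZl cmulZr xa xa'.
- by move=> x y /= [xa xa'] [ya ya']; rewrite cmulA xa -cmulA ya'.
- by move=> x /= [xa xa']; split; rewrite -{1}as_ -cstarM ?xa ?xa'.
- have -> : [set x | a ** x = x /\ x ** a = x] =
    [set x | a ** x = x] `&` [set x | x ** a = x] by [].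
  apply: closedI; apply: (@closed_eq _ _ (nm a + 1)).
  + by move=> c x y; rewrite cmulDr cmulZr.
  + by move=> c x y.
  + by move=> x; have := nm_cmul a x; have := nm_ge0 x; nra.
  + by move=> x; have := nm_ge0 x; have := nm_ge0 a; nra.
  + by move=> c x y; rewrite cmulDl cmulZl.
  + by move=> c x y.
  + by move=> x; have := nm_cmul x a; have := nm_ge0 x; nra.
  + by move=> x; have := nm_ge0 x; have := nm_ge0 a; nra.
Qed.

Lemma nm_half x : nm (2^-1 *: x) = nm x / 2.
Proof.
rewrite nmZ mulrC; congr (_ * _).
have -> : (2^-1 : R[i]) = (2^-1 : R)%:C%C by rewrite fmorphV rmorph_nat.
by rewrite nm_real ger0_norm.
Qed.

(* In the unitization 1 - y is a square root of 1 - h; the fixed points of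
   y |-> (h + y^2)/2 are the solutions of 2y - y^2 = h. *)
Lemma sqrt_one_sub h : cstar h = h -> nm h < 1 ->
  exists y, [/\ cstar y = y, y + y - y ** y = h &
    forall M : set A, is_cstar_subalgebra M -> M h -> M y].
Proof.
move=> hs h1.
pose u := fix u n := if n is n'.+1 then 2^-1 *: (h + u n' ** u n') else 0 : A.
have uS n : u n.+1 = 2^-1 *: (h + u n ** u n) by [].
have nu n : nm (u n) <= nm h.
  elim: n => [|n IH]; first by rewrite nm0 nm_ge0.
  rewrite uS nm_half; have := nmD h (u n ** u n); have := nm_cmul (u n) (u n).
  have := nm_ge0 (u n); nra.
have du n : nm (u n.+1 - u n) <= nm h ^+ n.
  elim: n => [|n IH].
    rewrite uS subr0 cmul0l addr0 nm_half expr0; have := nm_ge0 h; lra.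
  rewrite uS {2}uS -scalerBr nm_half opprD addrACA subrr add0r.
  (* All iterates have norm at most |h|, so this splitting, once halved, gives a contraction of
     ratio |h|. *)
  have -> : u n.+1 ** u n.+1 - u n ** u n =
      u n.+1 ** (u n.+1 - u n) + (u n.+1 - u n) ** u n.
    by rewrite cmulBr cmulBl addrA subrK.
  have := nmD (u n.+1 ** (u n.+1 - u n)) ((u n.+1 - u n) ** u n).
  have := nm_cmul (u n.+1) (u n.+1 - u n); have := nm_cmul (u n.+1 - u n) (u n).
  rewrite exprS; have := nu n; have := nu n.+1; have := nm_ge0 (u n.+1 - u n).
  have := nm_ge0 h; nra.
have [y hy] := geometric_cauchy (nm_ge0 h) h1 du.
exists y; split.
- apply/eqP; rewrite -subr_eq0; apply/eqP/nm_eq0/small_eq0; first exact: nm_ge0.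
  move=> e e0; have [|N /(_ N (leqnn _)) hN] := hy (e / 2); first by rewrite divr_gt0.
  have us : cstar (u N) = u N.
    elim: (N) => [|n IH]; first exact: cstar0.
    rewrite uS cstarZ cstarD cstarM IH hs; congr (_ *: _).
    by rewrite fmorphV rmorph_nat.
  apply: le_trans (nm_triangle _ (u N) _) _.
  rewrite -{1}us -cstarB nm_cstar [X in _ + X]nmB; lra.
- apply/eqP; rewrite -subr_eq0; apply/eqP/nm_eq0/small_eq0; first exact: nm_ge0.
  move=> e e0.
  (* The residual consists of two copies of y - u (N+1) and of the products of y - u N with y and
     with u N. As |u N| <= |h|, the factors add up to 2 + |y| + |h|. *)
  have K0 : 0 < 2 + nm y + nm h by have := nm_ge0 y; have := nm_ge0 h; lra.
  have [|N hN] := hy (e / (2 + nm y + nm h)); first by rewrite divr_gt0.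
  have hE : h = u N.+1 + u N.+1 - u N ** u N.
    by rewrite uS -scalerDl -mulr2n -[_ *+ 2]mulr_natr mulVf ?pnatr_eq0// scale1r addrK.
  rewrite [X in _ - X]hE.
  have -> : y + y - y ** y - (u N.+1 + u N.+1 - u N ** u N) =
      (y - u N.+1) + (y - u N.+1) - (y ** (y - u N) + (y - u N) ** u N).
    have -> : y ** (y - u N) + (y - u N) ** u N = y ** y - u N ** u N.
      by rewrite cmulBr cmulBl addrA subrK.
    rewrite [(y - u N.+1) + (y - _)]addrACA -(opprD (u N.+1)) !opprB -!addrA; congr (_ + (_ + _)).
    by rewrite addrC -addrA [RHS]addrCA.
  have := hN N (leqnn _); have := hN N.+1 (leqnSn _).
  have := divfK (lt0r_neq0 K0) e; set d := e / _ => dK h2 h3.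
  apply: le_trans (nmD _ _) _; rewrite nmN.
  have := nmD (y - u N.+1) (y - u N.+1).
  have := nmD (y ** (y - u N)) ((y - u N) ** u N).
  have := nm_cmul y (y - u N); have := nm_cmul (y - u N) (u N).
  have := ler_wpM2l (nm_ge0 y) h3; have := ler_wpM2r (nm_ge0 (u N)) h3.
  have d0 : 0 <= d by rewrite divr_ge0 ?ltW.
  have := ler_wpM2l d0 (nu N); lra.
- move=> M [[M0 MD MZ] MM _ Mcl] Mh.
  have Mu n : M (u n).
    by elim: n => [//|n IH]; rewrite uS; apply: MZ; apply: MD => //; apply: MM.
  apply: (closed_nm Mcl) => e /hy [N /(_ N (leqnn _)) hN]; exists (u N) => //.
Qed.

End SquareRoot.

(** * Contractivity of star homomorphisms *)

Section StarHom.
Context {R : realType}.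

(* In the unitization, 1 - y + 'i a is unitary. *)
Lemma unitary_isometry (A : cstarAlgType R) (a y : A) :
  cstar a = a -> cstar y = y -> a ** y = y ** a -> y + y - y ** y = a ** a ->
  forall w, nm (w + ('i *: a - y) ** w) = nm w.
Proof.
move=> sa sy ay ya w; set u := 'i *: a - y.
have su : cstar u = - ('i *: a) - y.
  by rewrite cstarB cstarZ sa sy conjCi scaleNr.
have uu : cstar u ** u = a ** a + y ** y.
  rewrite su /u cmulBr !cmulBl !cmulNl !cmulZl !cmulZr scalerA -expr2 sqrCi scaleN1r opprK.
  by rewrite ay opprD !opprK addrA subrK.
have unit : cstar u + u + cstar u ** u = 0.
  by rewrite uu su /u -ya subrK [X in X + _]addrACA addNr add0r -opprD addNr.
clearbody u; have E : cstar (w + u ** w) ** (w + u ** w) = cstar w ** w.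
  transitivity (cstar w ** w + cstar w ** ((cstar u + u + cstar u ** u) ** w)).
    by rewrite cstarD cstarM cmulDr !cmulDl !cmulDr !cmulA -!addrA.
  by rewrite unit cmul0l cmul0r addr0.
apply/eqP; rewrite -(@eqrXn2 _ 2)//; try exact: nm_ge0.
by rewrite -!nm_cstarM E.
Qed.

Context {A B : cstarAlgType R} (phi : A -> B).
Hypothesis hom : is_star_hom phi.

Lemma star_homZ c x : phi (c *: x) = c *: phi x.
Proof.
have [lin _ _] := hom.
have p0 : phi 0 = 0 by apply: (addIr (phi 0)); rewrite -{1}[phi 0]scale1r -lin scale1r !add0r.
by rewrite -[c *: x]addr0 lin p0 addr0.
Qed.

Lemma star_homD x y : phi (x + y) = phi x + phi y.
Proof. by have [lin _ _] := hom; rewrite -{1}[x]scale1r lin scale1r. Qed.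

Lemma star_hom0 : phi 0 = 0.
Proof. by rewrite -(scale0r (0 : A)) star_homZ scale0r. Qed.

Lemma star_homB x y : phi (x - y) = phi x - phi y.
Proof. by rewrite star_homD -scaleN1r star_homZ scaleN1r. Qed.

Lemma star_hom_sum I (r : seq I) (P : pred I) (F : I -> A) :
  phi (\sum_(i <- r | P i) F i) = \sum_(i <- r | P i) phi (F i).
Proof. exact: (big_morph phi star_homD star_hom0). Qed.

(** With y = 1 - sqrt(1 - a^2) computed in A, left multiplications by 1 - phi y + 'i phi a and by 1
    - phi y - 'i phi a are isometric on B. Their difference is 2 'i phi a, so left multiplication by
    phi a is contractive. *)
Let star_hom_sa_le1 a : cstar a = a -> nm a < 1 -> nm (phi a) <= 1.
Proof.
have [_ phiM phiS] := hom.
move=> sa a1; have [||y [sy ya memy]] := @sqrt_one_sub _ _ (a ** a).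
- by rewrite cstarM sa.
- by rewrite -{1}sa nm_cstarM expr_lt1 ?nm_ge0.
have ay : a ** y = y ** a.
  by apply: (memy _ (commutant_subalgebra sa)) => /=; rewrite cmulA.
have sb : cstar (phi a) = phi a by rewrite -phiS sa.
have sy' : cstar (phi y) = phi y by rewrite -phiS sy.
have by_ : phi a ** phi y = phi y ** phi a by rewrite -!phiM ay.
have yb : phi y + phi y - phi y ** phi y = phi a ** phi a.
  by rewrite -!phiM -ya star_homB star_homD.
have le w : nm (phi a ** w) <= nm w.
  have h1 := unitary_isometry sb sy' by_ yb w.
  have h2 : nm (w + ('i *: (- phi a) - phi y) ** w) = nm w.
    apply: unitary_isometry => //; first by rewrite cstarN sb.
      by rewrite cmulNl cmulNr by_.
    by rewrite cmulNl cmulNr opprK.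
  have := nmD (w + ('i *: phi a - phi y) ** w) (- (w + ('i *: (- phi a) - phi y) ** w)).
  rewrite nmN h1 h2 opprD addrACA subrr add0r -cmulBl opprB scalerN opprK addrA subrK.
  rewrite -scalerDr cmulZl cmulDl nmZ nmi mul1r -mulr2n -scaler_nat nmZ.
  have -> : (2%:R : R[i]) = (2%:R : R)%:C%C by rewrite rmorph_nat.
  by rewrite nm_real ger0_norm// => h; have := nm_ge0 w; lra.
(* At w = phi a the C*-identity turns the bound into |phi a|^2 <= |phi a|. *)
have := le (phi a); rewrite -{1}sb nm_cstarM.
have := nm_ge0 (phi a); nra.
Qed.

(** A self-adjoint element is scaled to norm below 1, with a slack e that tends to zero; passing to
    x^* x reduces the general case to this one. *)
Lemma star_hom_nm x : nm (phi x) <= nm x.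
Proof.
have [_ phiM phiS] := hom.
have sale a : cstar a = a -> nm (phi a) <= nm a.
  move=> sa; apply/ler_addgt0Pr => e e0.
  have t0 : 0 < nm a + e by rewrite ltr_wpDl ?nm_ge0.
  have nt y : nm ((nm a + e)^-1%:C%C *: y) = nm y / (nm a + e).
    by rewrite nmZ nm_real ger0_norm 1?mulrC// invr_ge0 ltW.
  have := @star_hom_sa_le1 ((nm a + e)^-1%:C%C *: a).
  rewrite star_homZ !nt ler_pdivrMr// mul1r; apply.
    by rewrite cstarZ sa; congr (_ *: _); rewrite -[LHS]/(conjc _) conjc_real.
  by rewrite ltr_pdivrMr// mul1r ltrDl.
rewrite -(@ler_pXn2r _ 2) ?nnegrE ?nm_ge0// -!nm_cstarM -phiS -phiM.
by apply: sale; rewrite cstarM cstarK.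
Qed.

End StarHom.

(** * Positivity in a corner eAe, expressed through norms *)

Section Corner.
Context {R : realType} {A : cstarAlgType R}.
Implicit Types e f h q : A.

(** Since q^2 = q, the square (w - q w)^* (w - q w) equals w^* (w - q w), whence |w - q w|^2 <= |w|
    |w - q w|. *)
Lemma nm_sub_projection q (w : A) : is_projection q -> nm (w - q ** w) <= nm w.
Proof.
move=> [qs qq]; have := nm_cstarM (w - q ** w).
rewrite cstarB cstarM qs cmulBl -(cmulA (cstar w)) [q ** (w - _)]cmulBr (cmulA q).
rewrite qq subrr cmul0r subr0 => h.
have := nm_cmul (cstar w) (w - q ** w); rewrite h nm_cstar.
have := nm_ge0 w; have := nm_ge0 (w - q ** w); nra.
Qed.

(** In terms of order, e + f^2 <= e gives f^2 <= 0. By norms: for s < 1 let r be the square root of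
    e - s^2 (e + f^2) and x = r + 'i s f. Then x^* x = (1 - s^2) e, and s f is the imaginary part of
    x, so s^2 |f|^2 <= 1 - s^2; now s tends to 1. *)
Lemma corner_square_eq0 e f : is_projection e -> cstar f = f ->
  e ** f = f -> f ** e = f -> nm (e + f ** f) <= 1 -> f = 0.
Proof.
move=> ep sf ef fe ef1; have [se ee] := ep.
have main (s : R) : 0 < s -> s < 1 -> s ^+ 2 * nm f ^+ 2 <= 1 - s ^+ 2.
  move=> s0 s1; pose c : R[i] := s%:C%C.
  have cc : c^* = c by rewrite -[LHS]/(conjc _) conjc_real.
  have nc : nm c = s by rewrite nm_real gtr0_norm.
  have nc2 : nm (1 - c * c) = 1 - s ^+ 2.
    rewrite /c -rmorphM -(rmorph1 (real_complex R)) -rmorphB nm_real ger0_norm//.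
    by rewrite subr_ge0; nra.
  have [||y [sy yh memy]] := @sqrt_one_sub _ _ ((c * c) *: (e + f ** f)).
  - have cc2 : (c * c)^* = c * c by rewrite /c -rmorphM/= -[LHS]/(conjc _) conjc_real.
    by rewrite cstarZ cc2 cstarD cstarM se sf.
  - rewrite nmZ nmM nc; have := nm_ge0 (e + f ** f); nra.
  have [ey ye] : e ** y = y /\ y ** e = y.
    apply: (memy _ (corner_subalgebra se)) => /=.
    by rewrite cmulZr cmulZl cmulDl cmulDr cmulA ef -cmulA fe ee.
  have fy : f ** y = y ** f.
    apply: (memy _ (commutant_subalgebra sf)) => /=.
    by rewrite cmulZr cmulZl cmulDl cmulDr cmulA ef fe.
  pose r := e - y; pose x := r + ('i * c) *: f.
  have sr : cstar r = r by rewrite cstarB se sy.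
  have rf : r ** f = f ** r by rewrite cmulBl cmulBr ef fe fy.
  have rr : r ** r = e - (c * c) *: (e + f ** f).
    by rewrite cmulBl !cmulBr ee ey ye -yh -[LHS]addrA -opprD addrA.
  clearbody r; have sx : cstar x = r - ('i * c) *: f.
    have -> : - (('i * c) *: f) = ('i * c)^* *: f.
      by rewrite -scaleNr -mulNr -conjCi -{1}cc -[in RHS]/(conjc _) rmorphM.
    by rewrite cstarD cstarZ sr sf.
  have xx : cstar x ** x = (1 - c * c) *: e.
    rewrite sx /x cmulBl !cmulDr !cmulZl !cmulZr rf opprD addrA addrK.
    rewrite scalerA mulrACA -expr2 sqrCi mulN1r scaleNr opprK rr scalerDr opprD.
    by rewrite addrA subrK scalerBl scale1r.
  have nx : nm x ^+ 2 <= 1 - s ^+ 2.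
    rewrite -nm_cstarM xx nmZ nc2; have := nm_projection ep.
    have : 0 <= 1 - s ^+ 2 by rewrite expr2; nra.
    have := nm_ge0 e; nra.
  have sfx : s * nm f <= nm x.
    have : nm ((2 * ('i * c)) *: f) <= nm x + nm x.
      rewrite -{2}(nm_cstar x) -(nmN (cstar x)) sx opprB.
      apply: le_trans (nmD _ _).
      by rewrite /x addrC addrA subrK -scalerDl mulr_natl mulr2n.
    rewrite nmZ !nmM nmi mul1r nc.
    have -> : (2 : R[i]) = (2 : R)%:C%C by rewrite rmorph_nat.
    by rewrite nm_real ger0_norm// => h; lra.
  rewrite -exprMn; apply: le_trans nx.
  by rewrite ler_pXn2r ?nnegrE ?nm_ge0// mulr_ge0 ?nm_ge0// ltW.
apply/nm_eq0/eqP; rewrite -sqrf_eq0; apply/eqP; set F := nm f ^+ 2.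
have F0 : 0 <= F by rewrite exprn_ge0 ?nm_ge0.
apply/eqP; rewrite eq_le F0 andbT leNgt; apply/negP => Fpos.
(* For s = 1 - d the bound gives F <= 2 d (1 + F), and d is chosen so that the right-hand side is F
   / 2. *)
pose d := F / (4 * (1 + F)).
have k0 : 0 < 4 * (1 + F) by nra.
have dE : d * (4 * (1 + F)) = F by rewrite divfK// gt_eqF.
have d0 : 0 < d by rewrite divr_gt0.
have d1 : d < 1 by rewrite ltr_pdivrMr//; lra.
have := main (1 - d); rewrite -/F subr_gt0 => /(_ d1).
have -> : 1 - d < 1 by lra.
move=> /(_ isT); nra.
Qed.

(** For a self-adjoint h in the corner, |e - h| <= 1 means 0 <= h <= 2 e. In this norm form, sums of
    positive elements are controlled by the triangle inequality alone. *)
Lemma corner_sum (I : eqType) (r : seq I) (h : I -> A) e : is_projection e ->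
  (forall i, i \in r -> nm (e - h i) <= 1) ->
  nm ((size r)%:R *: e - \sum_(i <- r) h i) <= (size r)%:R.
Proof.
move=> ep; elim: r => [|i r IH] hr; first by rewrite big_nil scale0r subrr nm0.
rewrite big_cons /= -natr1 scalerDl scale1r opprD [- h i - _]addrC addrACA.
apply: le_trans (nmD _ _) _; rewrite -natr1; apply: lerD.
  by apply: IH => j jr; apply: hr; rewrite inE jr orbT.
by apply: hr; rewrite mem_head.
Qed.

(* Both h k and its opposite, the sum of the other h i, lie in the positive
   cone of the corner; corner_square_eq0 says that this cone is pointed. *)
Lemma corner_sum_eq0 (I : eqType) (r : seq I) (h : I -> A) e :
  is_projection e ->
  (forall i, i \in r ->
    [/\ cstar (h i) = h i, e ** h i = h i, h i ** e = h i & nm (e - h i) <= 1]) ->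
  \sum_(i <- r) h i = 0 -> forall k, k \in r -> h k = 0.
Proof.
move=> ep hr h0 k kr; have [sh eh he nh] := hr _ kr.
pose N := size r; have N0 : (0 < N)%N by rewrite /N; case: (r) kr.
have NR0 : 0 < (N%:R : R) by rewrite ltr0n.
have N1 : 1 <= (N%:R : R) by rewrite ler1n.
pose t : R := N%:R^-1; have t0 : 0 < t by rewrite invr_gt0.
have t1 : t <= 1 by rewrite invf_le1.
have tN : t * N%:R = 1 by rewrite mulVf ?gt_eqF.
pose c : R[i] := t%:C%C.
have cN : c * N%:R = 1 by rewrite /c -(rmorph_nat (real_complex R)) -rmorphM tN.
have nmt x : nm (c *: x) = t * nm x by rewrite nmZ nm_real gtr0_norm.
have cc : c^* = c by rewrite /c -[LHS]/(conjc _) conjc_real.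
have le1 : nm (e + c *: h k) <= 1.
  have rk : \sum_(i <- rem k r) h i = - h k.
    by apply/eqP; rewrite -addr_eq0 addrC; move: h0; rewrite (big_rem k)//= => ->.
  have := @corner_sum _ (rem k r) h e ep.
  rewrite rk opprK size_rem// -/N => rem_le.
  (* The other N - 1 summands add up to - h k, so [corner_sum] bounds (N - 1) e + h k by N - 1; one
     more e and the factor 1/N give 1. *)
  have -> : e + c *: h k = c *: (e + ((N.-1)%:R *: e + h k)).
    have Ne : e + (N.-1)%:R *: e = N%:R *: e.
      by rewrite -{1}[e]scale1r -scalerDl addrC natr1 prednK.
    by rewrite addrA Ne scalerDr scalerA cN scale1r.
  rewrite nmt -tN ler_pM2l//.
  apply: le_trans (nmD _ _) _; rewrite -[in leRHS](prednK N0) -natr1 addrC.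
  apply: lerD; last exact: nm_projection.
  by apply: rem_le => i /mem_rem /hr [].
have le2 : nm (e - c *: h k) <= 1.
  have -> : e - c *: h k = (1 - c) *: e + c *: (e - h k).
    by rewrite scalerBr addrA scalerBl scale1r subrK.
  have n1c : nm (1 - c) = 1 - t.
    rewrite /c -(rmorph1 (real_complex R)) -rmorphB nm_real ger0_norm//.
    by rewrite subr_ge0.
  apply: le_trans (nmD _ _) _; rewrite nmZ n1c nmt.
  have := nm_projection ep; have := nm_ge0 e; nra.
suff f0 : c *: h k = 0.
  by have := congr1 (fun x => N%:R *: x) f0; rewrite scalerA mulrC cN scale1r scaler0.
set f := c *: h k; have [se ee] := ep.
have ef : e ** f = f by rewrite cmulZr eh.
have fe : f ** e = f by rewrite cmulZl he.
have sf : cstar f = f by rewrite cstarZ cc sh.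
rewrite -/f in le1 le2; clearbody f; apply: (corner_square_eq0 ep sf ef fe).
(* Both e + f and e - f have norm at most 1, and e + f^2 is the mean of their squares. *)
have -> : e + f ** f = 2^-1 *: ((e + f) ** (e + f) + (e - f) ** (e - f)).
  have -> : (e + f) ** (e + f) + (e - f) ** (e - f) = (e + f ** f) + (e + f ** f).
    rewrite !cmulDl !cmulDr !cmulNl !cmulNr !opprK ee ef fe.
    by rewrite addrACA [X in X + _]addrACA [X in _ + X]addrACA !subrr add0r addr0 addrACA.
  by rewrite -mulr2n -(scaler_nat 2 (e + _)) scalerA mulVf ?pnatr_eq0// scale1r.
rewrite nm_half; have := nmD ((e + f) ** (e + f)) ((e - f) ** (e - f)).
have := nm_cmul (e + f) (e + f); have := nm_cmul (e - f) (e - f).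
have := nm_ge0 (e + f); have := nm_ge0 (e - f); nra.
Qed.

(** Compressing the sum P by q_i gives 0 = (q_i - q_i P q_i) + sum over k <> i of q_i q_k q_i, all
    summands being positive. Hence every q_i q_k q_i is zero, and with it q_k q_i, by the
    C*-identity. *)
Lemma projections_orthogonal (I : eqType) (r : seq I) (q : I -> A) :
  uniq r -> (forall i, is_projection (q i)) ->
  is_projection (\sum_(i <- r) q i) ->
  forall i j, i \in r -> j \in r -> i != j -> q i ** q j = 0.
Proof.
move=> ur qp; set P := \sum_(i <- r) q i => -[sP PP] j i jr ir ji.
have [si ii] := qp i.
(* The index [None] carries the defect q_i (1 - P) q_i, so that all the positive summands form one
   family. *)
pose h o := if o is Some k then q i ** q k ** q i else q i - q i ** P ** q i.
have ij0 : h (Some j) = 0.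
  apply: (@corner_sum_eq0 _ (None :: [seq Some k | k <- rem i r]) h (q i)).
  - exact: qp.
  - move=> [k|] _ /=.
      have [sk kk] := qp k; split.
      + by rewrite !cstarM si sk cmulA.
      + by rewrite !cmulA ii.
      + by rewrite -!cmulA ii.
      + rewrite -{1}ii -cmulA -cmulBr; apply: le_trans (nm_cmul _ _) _.
        have := nm_projection (qp i); have := nm_sub_projection (q i) (qp k).
        have := nm_ge0 (q i); have := nm_ge0 (q i - q k ** q i); nra.
    split.
    + by rewrite cstarB !cstarM si sP cmulA.
    + by rewrite cmulBr !cmulA ii.
    + by rewrite cmulBl -!cmulA ii.
    + rewrite opprB addrC subrK; apply: le_trans (nm_cmul _ _) _.
      have := nm_projection (qp i); have := nm_cmul (q i) P.
      have := nm_projection (conj sP PP : is_projection P).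
      have := nm_ge0 (q i); have := nm_ge0 P; have := nm_ge0 (q i ** P); nra.
  - rewrite big_cons big_map /= {1}/P cmul_sumr cmul_suml (big_rem i)//=.
    by rewrite !ii opprD addrA subrr add0r addNr.
  - by rewrite inE/= map_f// mem_rem_uniq// inE ji.
have [sj jj] := qp j.
apply: cstar_mul_eq0; rewrite cstarM si sj cmulA -(cmulA (q i)) jj; exact: ij0.
Qed.

End Corner.

(** * Cuntz-Krieger families *)

Section Paths.
Variable E : digraph.
Implicit Types (v w : vertex E) (l : seq (edge E)).

(* A path is encoded by its range and its list of edges, so that vertices are
   the paths with an empty list of edges. *)
Fixpoint wf v l : bool :=
  if l is e :: l' then (rng e == v) && wf (src e) l' else true.

Fixpoint tgt v l : vertex E := if l is e :: l' then tgt (src e) l' else v.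

Lemma wf_cat v l l' : wf v (l ++ l') = wf v l && wf (tgt v l) l'.
Proof. by elim: l v => [|e l IH] v //=; rewrite IH andbA. Qed.

Lemma tgt_cat v l l' : tgt v (l ++ l') = tgt (tgt v l) l'.
Proof. by elim: l v => [|e l IH] v /=. Qed.

Lemma wf_rcons v l e : wf v (rcons l e) = wf v l && (rng e == tgt v l).
Proof. by rewrite -cats1 wf_cat /= andbT. Qed.

Lemma tgt_rcons v l e : tgt v (rcons l e) = src e.
Proof. by rewrite -cats1 tgt_cat. Qed.

Lemma treeP w v : tree w v <-> exists2 l, wf w l & tgt w l = v.
Proof.
have pathE e l : path (@composable E) e l = wf (src e) l.
  elim: l e => [//|f l IH] e /=; by rewrite IH /composable eq_sym.
have lastE e l : src (last e l) = tgt (src e) l by elim: l e => /=.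
split=> [[[u|e l el] /= <- <-]|[[|e l] /= wl <-]].
- by exists [::].
- by exists (e :: l); rewrite /= ?eqxx -?pathE ?lastE.
- by exists (VertexPath w).
- move/andP: wl => [/eqP rw wl]; rewrite -pathE in wl.
  by exists (EdgePath wl) => /=; rewrite ?lastE.
Qed.

(** Paths are prolonged at their source end, by an edge into that vertex. At the vertices defined
    here no prolongation exists and the summation relation is not imposed. *)
Definition is_source v := ~ (edges_into v !=set0).

(** The paths of length n, together with the shorter ones stuck at a source. None is a proper prefix
    of another, so the elements s_a of distinct ones have orthogonal ranges. *)
Definition maximal n v l :=
  [/\ wf v l, (size l <= n)%N & (size l < n)%N -> is_source (tgt v l)].

Lemma maximal_prefix n v l l' :
  maximal n v l -> maximal n v l' -> prefix l l' -> l = l'.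
Proof.
move=> [_ _ ml] [wl' nl' _] /prefixP [[|e m] l'E]; first by rewrite l'E cats0.
move: wl' nl'; rewrite l'E wf_cat size_cat /= addnS => /andP[_ /andP[/eqP re _]] n_.
by case: ml; [apply: leq_trans n_; rewrite ltnS leq_addr|exists e].
Qed.

End Paths.

Section CKFamily.
Context {R : realType} {E : digraph} {A : cstarAlgType R}.
Variables (s : edge E -> A) (p : vertex E -> A).
Hypothesis rowfin : row_finite E.
Hypothesis CK : is_CK_family s p.
Implicit Types (v w : vertex E) (l : seq (edge E)).

Lemma p_proj v : is_projection (p v). Proof. by case: CK => h _ _ _ _; exact: h. Qed.
Lemma p_star v : cstar (p v) = p v. Proof. by case: (p_proj v). Qed.
Lemma p_idem v : p v ** p v = p v. Proof. by case: (p_proj v). Qed.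
Lemma p_orth v w : v != w -> p v ** p w = 0.
Proof. by move=> /eqP vw; case: CK => _ orth _ _ _; exact: orth. Qed.
Lemma s_star_s e : cstar (s e) ** s e = p (src e). Proof. by case: CK => _ _ _ h _; exact: h. Qed.
Lemma s_p e : s e ** p (src e) = s e.
Proof. by rewrite -s_star_s cmulA; case: CK => _ _ h _ _; exact: h. Qed.
Lemma p_s_star e : p (src e) ** cstar (s e) = cstar (s e).
Proof. by rewrite -p_star -cstarM s_p. Qed.

Lemma range_projection e : is_projection (s e ** cstar (s e)).
Proof.
split; first by rewrite cstarM cstarK.
by rewrite cmulA -(cmulA (s e)) s_star_s s_p.
Qed.

Definition inedges v : seq (edge E) := finmap.enum_fset (fset_set (edges_into v)).

Lemma mem_inedges v e : (e \in inedges v) = (rng e == v).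
Proof.
by rewrite /inedges in_fset_set; [apply/idP/eqP; rewrite inE|exact: rowfin].
Qed.

Lemma inedges_uniq v : uniq (inedges v). Proof. exact: finmap.fset_uniq. Qed.

Lemma p_sum v : ~ is_source v ->
  p v = \sum_(e <- inedges v) s e ** cstar (s e).
Proof.
move=> /contrapT h; case: CK => _ _ _ _ /(_ v h) ->.
by rewrite fsbig_finite; [|exact: rowfin].
Qed.

Lemma not_source (e : edge E) : ~ is_source (rng e).
Proof. by apply; exists e. Qed.

(** The Cuntz-Krieger relations only say that these projections add up to [p (rng e)]; orthogonality
    is extracted from that sum. *)
Lemma range_projection_orth e f : e != f -> rng e = rng f ->
  s e ** cstar (s e) ** (s f ** cstar (s f)) = 0.
Proof.
move=> ef re; apply: (@projections_orthogonal _ _ _ (inedges (rng e))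
    (fun e => s e ** cstar (s e))) => //.
- exact: inedges_uniq.
- by move=> i; exact: range_projection.
- by rewrite -p_sum; [exact: p_proj|exact: not_source].
- by rewrite mem_inedges.
- by rewrite mem_inedges re.
Qed.

Lemma p_s e : p (rng e) ** s e = s e.
Proof.
rewrite p_sum; last exact: not_source.
rewrite cmul_suml (big_rem e) ?mem_inedges//= big_seq big1.
  by rewrite addr0 -cmulA s_star_s s_p.
move=> f; rewrite mem_rem_uniq ?inedges_uniq// inE mem_inedges => /andP[fe /eqP rf].
rewrite -[s e]s_p -s_star_s !cmulA.
by have := range_projection_orth fe rf; rewrite !cmulA => ->; rewrite cmul0l.
Qed.

Lemma star_s_neq e f : e != f -> cstar (s e) ** s f = 0.
Proof.
move=> ef; have [rr|rr] := eqVneq (rng e) (rng f).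
  have /(congr1 (fun x => cstar (s e) ** x ** s f)) := range_projection_orth ef rr.
  by rewrite cmul0r cmul0l !cmulA s_star_s p_s_star -!cmulA s_star_s s_p.
rewrite -[s f]p_s -[s e]p_s cstarM p_star -(cmulA (cstar _)) (cmulA (p _)).
by rewrite p_orth// cmul0l cmul0r.
Qed.

(** The innermost factor is the projection at the end of the path, which the last edge absorbs;
    vertices and longer paths thus share one recursion. *)
Fixpoint spath v l : A := if l is e :: l' then s e ** spath (src e) l' else p v.

Lemma spath_p v l : spath v l ** p (tgt v l) = spath v l.
Proof. by elim: l v => [|e l IH] v /=; rewrite ?p_idem// -cmulA IH. Qed.

Lemma p_spath v l : wf v l -> p v ** spath v l = spath v l.
Proof.
by case: l => [|e l] /= => [_|/andP[/eqP <- _]]; rewrite ?p_idem// cmulA p_s.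
Qed.

Lemma spath_rcons v l e : tgt v l = rng e -> spath v (rcons l e) = spath v l ** s e.
Proof.
elim: l v => [|f l IH] v /= h; first by rewrite s_p h p_s.
by rewrite IH// cmulA.
Qed.

Lemma spath_star v l : wf v l -> cstar (spath v l) ** spath v l = p (tgt v l).
Proof.
elim: l v => [|e l IH] v /= => [_|/andP[_ wl]]; first by rewrite p_star p_idem.
by rewrite cstarM -cmulA (cmulA (cstar (s e))) s_star_s p_spath ?IH.
Qed.

(** Common initial edges cancel through s_e^* s_e = p. As neither path extends the other, they
    diverge somewhere, and there two distinct edges or two distinct vertices give zero. *)
Lemma spath_star_neq v l v' l' : wf v l -> wf v' l' ->
  (v = v' -> ~~ prefix l l' /\ ~~ prefix l' l) ->
  cstar (spath v l) ** spath v' l' = 0.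
Proof.
have base u m u' m' : wf u m -> wf u' m' -> u != u' ->
    cstar (spath u m) ** spath u' m' = 0.
  move=> w w' uu'; rewrite -(p_spath w) -(p_spath w') cstarM p_star.
  by rewrite -(cmulA (cstar _)) (cmulA (p _)) p_orth// cmul0l cmul0r.
elim: l v v' l' => [|e l IH] v v' l' wl wl' h;
  have [vv'|] := eqVneq v v'; try exact: base.
- by case: (h vv'); rewrite prefix0s.
- case: l' wl' h => [|e' l'] wl' h; first by case: (h vv') => _; rewrite prefix0s.
  move: wl wl' => /= /andP[_ wl] /andP[_ wl'].
  rewrite cstarM -cmulA (cmulA (cstar (s e))).
  have [ee'|ee'] := eqVneq e e'; last by rewrite star_s_neq// cmul0l cmul0r.
  rewrite -ee' s_star_s p_spath; last by rewrite ee'.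
  apply: IH => //; first by rewrite ee'.
  by move=> _; have := h vv'; rewrite /= -ee' eqxx.
Qed.

Lemma nm_spath v l : nm (spath v l) <= 1.
Proof.
have ns e : nm (s e) <= 1.
  have := nm_projection (p_proj (src e)); rewrite -s_star_s nm_cstarM.
  by have := nm_ge0 (s e); nra.
elim: l v => [|e l IH] v /=; first exact: nm_projection (p_proj v).
have := nm_cmul (s e) (spath (src e) l); have := IH (src e); have := ns e.
have := nm_ge0 (s e); have := nm_ge0 (spath (src e) l); nra.
Qed.

Lemma spath_star_maximal n v l v' l' : maximal n v l -> maximal n v' l' ->
  cstar (spath v l) ** spath v' l' = if (v, l) == (v', l') then p (tgt v l) else 0.
Proof.
move=> ml ml'; have [[<- <-]|ne] := eqVneq (v, l) (v', l').
  by case: ml => w _ _; rewrite spath_star.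
have [[w _ _] [w' _ _]] := (ml, ml'); apply: spath_star_neq => // vv'.
split; apply: contra ne => pr; rewrite vv' in ml *.
  by rewrite (maximal_prefix ml ml' pr).
by rewrite (maximal_prefix ml' ml pr).
Qed.

End CKFamily.

(** * Distance to a closed ideal, and growth of powers *)

Section General.
Context {R : realType} {A : cstarAlgType R}.
Implicit Types (x y z q g : A) (K : set A).

Lemma subspace_sum K I (r : seq I) (P : pred I) (F : I -> A) : is_subspace K ->
  (forall i, P i -> K (F i)) -> K (\sum_(i <- r | P i) F i).
Proof. by move=> [K0 KD _] KF; elim/big_rec: _ => // i x /KF; exact: KD. Qed.

Lemma subspace_sum_in K (I : eqType) (r : seq I) (F : I -> A) : is_subspace K ->
  (forall i, i \in r -> K (F i)) -> K (\sum_(i <- r) F i).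
Proof. by move=> sK KF; rewrite big_seq; exact: subspace_sum. Qed.

(* The corner element q z q is invertible in the corner qAq. *)
Lemma projection_near_ideal K q z : is_ideal K -> is_projection q -> K z ->
  nm (q - z) < 1 -> K q.
Proof.
move=> [Ksub Kl Kr Kcl] qp Kz nqz; have [sq qq] := qp.
have [_ KD KZ] := Ksub.
pose x := q - q ** z ** q.
have qx : x ** q = x by rewrite cmulBl qq -cmulA qq.
have nx : nm x <= nm (q - z).
  have -> : x = q ** (q - z) ** q by rewrite cmulBr cmulBl !qq.
  have := nm_cmul (q ** (q - z)) q; have := nm_cmul q (q - z).
  have := nm_projection qp; have := nm_ge0 q; have := nm_ge0 (q - z).
  have := nm_ge0 (q ** (q - z)); nra.
(* [u n] is the n-th power of x in the corner, q being the zeroth one. It tends to 0, while q - x^n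
   stays in K because q - x does: a geometric series in disguise. *)
pose u := fix u n := if n is n'.+1 then x ** u n' else q.
have nu n : nm (u n) <= nm (q - z) ^+ n.
  elim: n => [|n IH]; first exact: nm_projection.
  rewrite exprS; apply: le_trans (nm_cmul _ _) _.
  by apply: ler_pM => //; exact: nm_ge0.
have Ku n : K (q - u n).
  elim: n => [|n IH]; first by rewrite subrr; case: Ksub.
  have -> : q - u n.+1 = (q - x) + x ** (q - u n).
    by rewrite cmulBr qx addrA subrK.
  apply: KD; last exact: Kl.
  by rewrite /x opprB addrC subrK; apply: Kr; apply: Kl.
apply: (closed_nm Kcl) => e e0.
have [N hN] := expr_small (nm_ge0 (q - z)) nqz e0; exists (q - u N) => //.
by rewrite opprB addrC subrK; exact: le_trans (nu N) hN.
Qed.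

(** In A/K the image of q is a nonzero projection, hence of norm 1; this is the same lower bound
    without forming the quotient. *)
Lemma dist_projection_ideal K q z (c : R[i]) : is_ideal K -> is_projection q ->
  ~ K q -> K z -> nm c <= nm (c *: q - z).
Proof.
move=> iK qp Kq Kz; rewrite leNgt; apply/negP => lt; apply: Kq.
have c0 : 0 < nm c by apply: le_lt_trans (nm_ge0 _) lt.
have cn0 : c != 0 by apply: contraTneq c0 => ->; rewrite nm0 ltxx.
apply: (@projection_near_ideal _ _ (c^-1 *: z) iK qp).
  by case: iK => -[_ _ KZ] _ _ _; exact: KZ.
rewrite -(ltr_pM2l c0) mulr1 -nmZ scalerBr scalerA divff// scale1r; exact: lt.
Qed.

(** A spectral radius argument: for self-adjoint g the C*-identity gives |g^(2^m)| = |g|^(2^m), so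
    the growth rate of the powers is the norm and C disappears in the limit. *)
Lemma nm_sa_of_powers g (C q : R) : cstar g = g -> 0 < q ->
  (forall k, nm (iter k (cmul g) g) <= C * q ^+ k) -> nm g <= q.
Proof.
move=> sg q0 hC.
have iterD m n : iter m (cmul g) g ** iter n (cmul g) g = iter (m + n).+1 (cmul g) g.
  by elim: m => [|m IH] //=; rewrite -cmulA IH.
(* [iter k (cmul g) g] is g^(k+1), so the power 2^m sits at index 2^m - 1. *)
pose e m := (2 ^ m).-1.
have eS m : e m.+1 = (e m + e m).+1.
  by rewrite /e expnS; have := expn_gt0 2 m; case: (2 ^ m)%N => // k _; lia.
have sq m : cstar (iter (e m) (cmul g) g) = iter (e m) (cmul g) g /\
    nm (iter (e m) (cmul g) g) = nm g ^+ (e m).+1.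
  elim: m => [|m [IH1 IH2]]; first by rewrite /= expr1.
  rewrite eS -iterD cstarM IH1; split=> //.
  by rewrite -{1}IH1 nm_cstarM IH2 -exprM; congr (_ ^+ _); lia.
rewrite leNgt; apply/negP => gq.
have g0 : 0 < nm g by apply: lt_trans gq.
have r1 : q / nm g < 1 by rewrite ltr_pdivrMr// mul1r.
have r0 : 0 <= q / nm g by rewrite divr_ge0// ltW.
have Cp : 0 < `|C| + 1 by rewrite ltr_wpDl.
have Cp2 : 0 < 2 * (`|C| + 1) by rewrite mulr_gt0.
have [N hN] := expr_small r0 r1 (divr_gt0 g0 Cp2).
have Ne : (N <= e N)%N by rewrite /e -ltnS prednK ?expn_gt0// ltn_expl.
have : (q / nm g) ^+ e N <= nm g / (2 * (`|C| + 1)).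
  by apply: le_trans hN; apply: ler_wiXn2l => //; exact: ltW.
rewrite expr_div_n ler_pdivrMr ?exprn_gt0// mulrAC ler_pdivlMr; last by rewrite mulr_gt0.
have := hC (e N); have [_ ->] := sq N; rewrite exprS.
have := ler_norm C; have : 0 < q ^+ e N by rewrite exprn_gt0.
have : 0 < nm g * nm g ^+ e N by rewrite mulr_gt0// exprn_gt0.
nra.
Qed.

End General.

(** * Finite combinations of the monomials s_a s_b^* and their density *)

Definition gpath (E : digraph) := (vertex E * seq (edge E))%type.
Definition term (R : realType) (E : digraph) := (R[i] * (gpath E * gpath E))%type.

Section Span.
Context {R : realType} {E : digraph} {A : cstarAlgType R}.
Variables (s : edge E -> A) (p : vertex E -> A).
Hypothesis rowfin : row_finite E.
Hypothesis CK : is_CK_family s p.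

Local Notation spath := (spath s p).

Implicit Types (v w : vertex E) (l : seq (edge E)) (a b : gpath E) (c : R[i]).

Definition sp a : A := spath a.1 a.2.
Definition gtgt a := tgt a.1 a.2.
Definition gwf a := wf a.1 a.2.

Implicit Types (t : term R E) (r : seq (term R E)).

Definition monomial a b : A := sp a ** cstar (sp b).
Definition ok a b := [&& gwf a, gwf b & gtgt a == gtgt b].
Definition valid r := all (fun t => ok t.2.1 t.2.2) r.
(** Lists of terms are carried along because path lengths are data of the list, not of its value in
    A. *)
Definition comb r : A := \sum_(t <- r) t.1 *: monomial t.2.1 t.2.2.

Definition flip r : seq (term R E) := [seq (t.1^*, (t.2.2, t.2.1)) | t <- r].
Definition scale c r : seq (term R E) := [seq (c * t.1, t.2) | t <- r].

Lemma comb_cat r1 r2 : comb (r1 ++ r2) = comb r1 + comb r2.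
Proof. exact: big_cat. Qed.

Lemma comb_scale c r : comb (scale c r) = c *: comb r.
Proof.
by rewrite /comb big_map scaler_sumr; apply: eq_bigr => t _; rewrite scalerA.
Qed.

Lemma comb_flip r : comb (flip r) = cstar (comb r).
Proof.
rewrite /comb big_map cstar_sum; apply: eq_bigr => t _.
by rewrite cstarZ cstarM cstarK.
Qed.

Lemma valid_cat r1 r2 : valid (r1 ++ r2) = valid r1 && valid r2.
Proof. exact: all_cat. Qed.

Lemma valid_scale c r : valid (scale c r) = valid r.
Proof. exact: all_map. Qed.

Lemma valid_flip r : valid (flip r) = valid r.
Proof.
rewrite /valid all_map; apply: eq_all => t /=.
by rewrite /ok andbCA eq_sym.
Qed.

Lemma nm_sp a : nm (sp a) <= 1. Proof. exact: nm_spath CK _ _. Qed.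

Lemma nm_monomial a b : nm (monomial a b) <= 1.
Proof.
have := nm_cmul (sp a) (cstar (sp b)); rewrite nm_cstar.
have := nm_sp a; have := nm_sp b; have := nm_ge0 (sp a); have := nm_ge0 (sp b); nra.
Qed.

Lemma generator_comb x r : (forall a b, ok a b ->
    exists2 r', valid r' & x ** monomial a b = comb r') -> valid r ->
  exists2 r', valid r' & x ** comb r = comb r'.
Proof.
move=> h; elim: r => [|t r IH]; first by exists [::]; rewrite // /comb big_nil cmul0r.
move=> /andP[ot /IH [r1 v1 e1]]; have [r2 v2 e2] := h _ _ ot.
exists (scale t.1 r2 ++ r1); first by rewrite valid_cat valid_scale v2.
by rewrite comb_cat comb_scale -e1 -e2 /comb big_cons cmulDr cmulZr.
Qed.

Lemma comb1 a b : comb [:: (1, (a, b))] = monomial a b.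
Proof. by rewrite /comb big_seq1 scale1r. Qed.

Lemma s_comb e r : valid r -> exists2 r', valid r' & s e ** comb r = comb r'.
Proof.
apply: generator_comb => -[v l] b okab; have /and3P[wa wb tab] := okab.
have [ve|ve] := eqVneq (src e) v.
  exists [:: (1, ((rng e, e :: l), b))]; last by rewrite comb1 /monomial /sp /= -ve cmulA.
  by rewrite /valid /= andbT; move: okab; rewrite /ok /gwf /gtgt /= eqxx ve => ->.
exists [::] => //; rewrite /comb big_nil /monomial /sp/= cmulA -(p_spath rowfin CK wa).
by rewrite -(s_p CK) !cmulA -(cmulA (s e)) (p_orth CK ve) !(cmul0l, cmul0r).
Qed.

Lemma p_comb w r : valid r -> exists2 r', valid r' & p w ** comb r = comb r'.
Proof.
apply: generator_comb => -[v l] b okab; have /and3P[wa wb tab] := okab.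
have [wv|wv] := eqVneq w v.
  exists [:: (1, ((v, l), b))]; first by rewrite /valid /= okab.
  by rewrite comb1 /monomial cmulA wv (p_spath rowfin CK wa).
exists [::] => //; rewrite /comb big_nil /monomial /sp/= cmulA -(p_spath rowfin CK wa).
by rewrite cmulA (p_orth CK wv) !cmul0l.
Qed.

(** Against a nonempty left path, s_e^* cancels the first edge or gives zero. Against the vertex
    [rng e] it moves into the right factor: s_e^* s_b^* is the adjoint of s_b s_e, so b becomes
    longer. *)
Lemma star_s_comb e r : valid r ->
  exists2 r', valid r' & cstar (s e) ** comb r = comb r'.
Proof.
apply: generator_comb => -[v l] [v' l'] okab; have /and3P[wa wb tab] := okab.
case: l wa tab okab => [|f l] wa tab okab.
  have /eqP tE : v == tgt v' l' := tab.
  have w' : wf v' l' := wb.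
  have [ve|ve] := eqVneq (rng e) v.
    exists [:: (1, ((src e, [::]), (v', rcons l' e)))].
      by rewrite /valid /= andbT /ok /gwf /gtgt /= tgt_rcons wf_rcons w' -tE ve !eqxx.
    rewrite comb1 /monomial /sp /= (spath_rcons rowfin CK)//; last by rewrite -tE.
    rewrite cstarM (cmulA (p _)) (p_s_star CK) -(p_s rowfin CK e) cstarM (p_star CK) ve.
    by rewrite -!cmulA; congr (_ ** _); rewrite !cmulA (p_idem CK).
  exists [::] => //; rewrite /comb big_nil /monomial /sp/= -(p_s rowfin CK e) cstarM.
  by rewrite (p_star CK) -cmulA (cmulA (p _)) (p_orth CK ve) !(cmul0l, cmul0r).
have [ef|ef] := eqVneq e f; last first.
  exists [::] => //; rewrite /comb big_nil /monomial /sp/= !cmulA.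
  by rewrite (star_s_neq rowfin CK ef) !cmul0l.
have wl : wf (src f) l by move: wa; rewrite /gwf /= => /andP[].
exists [:: (1, ((src e, l), (v', l')))].
  move: okab; rewrite /valid /= andbT /ok /gwf /gtgt /= ef.
  by move=> /and3P[/andP[_ ->] -> ->].
rewrite comb1 /monomial /sp /= !cmulA -ef (s_star_s CK) (p_spath rowfin CK)//.
by rewrite ef.
Qed.

Definition span_closure : set A :=
  [set x | forall e : R, 0 < e -> exists2 r, valid r & nm (x - comb r) <= e].

Lemma comb_span_closure r : valid r -> span_closure (comb r).
Proof. by move=> vr e e0; exists r => //; rewrite subrr nm0 ltW. Qed.

Lemma span_closure_subspace : is_subspace span_closure.
Proof.
split.
- by rewrite -[0](_ : comb [::] = 0); [exact: comb_span_closure|rewrite /comb big_nil].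
- move=> x y hx hy e e0; have e20 : 0 < e / 2 by rewrite divr_gt0.
  have [r1 v1 d1] := hx _ e20; have [r2 v2 d2] := hy _ e20.
  exists (r1 ++ r2); first by rewrite valid_cat v1.
  by rewrite comb_cat opprD addrACA; apply: le_trans (nmD _ _) _; lra.
- move=> c x hx e e0; have c0 : 0 < nm c + 1 by rewrite ltr_wpDl ?nm_ge0.
  have [r1 v1 d1] := hx _ (divr_gt0 e0 c0).
  exists (scale c r1); first by rewrite valid_scale.
  rewrite comb_scale -scalerBr nmZ; move: d1; rewrite ler_pdivlMr//.
  by have := nm_ge0 (x - comb r1); have := nm_ge0 c; nra.
Qed.

Lemma span_closure_closed : closed span_closure.
Proof.
apply: nm_closed => x h e e0; have e20 : 0 < e / 2 by rewrite divr_gt0.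
have [y hy xy] := h _ e20; have [r vr yr] := hy _ e20; exists r => //.
by apply: le_trans (nm_triangle _ y _) _; lra.
Qed.

Lemma span_closure_star x : span_closure x -> span_closure (cstar x).
Proof.
move=> h e /h [r vr d]; exists (flip r); first by rewrite valid_flip.
by rewrite comb_flip -cstarB nm_cstar.
Qed.

Lemma span_closure_mull x :
  (forall r, valid r -> exists2 r', valid r' & x ** comb r = comb r') ->
  forall y, span_closure y -> span_closure (x ** y).
Proof.
move=> h y hy e e0; have x0 : 0 < nm x + 1 by rewrite ltr_wpDl ?nm_ge0.
have [r vr yr] := hy _ (divr_gt0 e0 x0); have [r' vr' er'] := h _ vr.
exists r' => //; rewrite -er' -cmulBr; apply: le_trans (nm_cmul _ _) _.
move: yr; rewrite ler_pdivlMr//.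
by have := nm_ge0 (y - comb r); have := nm_ge0 x; nra.
Qed.

Hypothesis gen : smallest (@is_cstar_subalgebra R A) (range s `|` range p) = setT.

Lemma generated_induction (M : set A) : is_cstar_subalgebra M ->
  (forall e, M (s e)) -> (forall v, M (p v)) -> forall x, M x.
Proof.
move=> sM Ms Mp z; have : setT z by [].
by rewrite -gen; apply; split=> // _ [[e _ <-]|[v _ <-]].
Qed.

(** Products of two general monomials are never reduced. The x such that x and x^* both multiply the
    closed span into itself form a C*-subalgebra containing the generators, hence all of A; so the
    closed span is itself a C*-subalgebra. *)
Lemma span_dense x : span_closure x.
Proof.
have [N0 ND NZ] := span_closure_subspace.
pose L := [set x | forall y, span_closure y ->
  span_closure (x ** y) /\ span_closure (cstar x ** y)].
have LT : forall x, L x.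
  apply: generated_induction.
  - split.
    + split=> [y _|x1 x2 h1 h2 y hy|c x1 h1 y hy].
      * by rewrite cstar0 cmul0l.
      * have [? ?] := h1 _ hy; have [? ?] := h2 _ hy.
        by rewrite cstarD !cmulDl; split; exact: ND.
      * have [? ?] := h1 _ hy.
        by rewrite cstarZ !cmulZl; split; exact: NZ.
    + move=> x1 x2 h1 h2 y hy; rewrite cstarM -!cmulA; split.
        by have [/h1[]] := h2 _ hy.
      by have [_ /h2[]] := h1 _ hy.
    + by move=> x1 h1 y hy; rewrite cstarK; have [? ?] := h1 _ hy.
    + apply: nm_closed => x1 h y hy.
      have y0 : 0 < nm y + 1 by rewrite ltr_wpDl ?nm_ge0.
      split; apply: (closed_nm span_closure_closed) => e e0;
        have [x2 /(_ y hy) [h1 h2] d] := h _ (divr_gt0 e0 y0);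
        [exists (x2 ** y) => //|exists (cstar x2 ** y) => //];
        rewrite -cmulBl; (apply: le_trans (nm_cmul _ _) _);
        rewrite -?cstarB ?nm_cstar; move: d; rewrite ler_pdivlMr//;
        have := nm_ge0 (x1 - x2); have := nm_ge0 y; nra.
  - move=> e y hy; split; apply: span_closure_mull => //.
      by move=> r; exact: s_comb.
    by move=> r; exact: star_s_comb.
  - move=> v y hy; rewrite (p_star CK); split; apply: span_closure_mull => //;
    by move=> r; exact: p_comb.
move: x; apply: generated_induction.
- split; [exact: span_closure_subspace| |exact: span_closure_star|exact: span_closure_closed].
  by move=> x y _ hy; have [] := LT x y hy.
- move=> e; have -> : s e = comb [:: (1, ((rng e, [:: e]), (src e, [::])))].
    by rewrite comb1 /monomial /sp /= (p_star CK) -cmulA (p_idem CK) (s_p CK).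
  by apply: comb_span_closure; rewrite /valid /= /ok /gwf /gtgt /= !eqxx.
- move=> v; have -> : p v = comb [:: (1, ((v, [::]), (v, [::])))].
    by rewrite comb1 /monomial /sp /= (p_star CK) (p_idem CK).
  by apply: comb_span_closure; rewrite /valid /= /ok /gwf /gtgt /= eqxx.
Qed.

End Span.

(** * Homogeneous elements close to an ideal *)

Section Block.
Context {R : realType} {E : digraph} {A : cstarAlgType R}.
Variables (s : edge E -> A) (p : vertex E -> A).
Hypothesis rowfin : row_finite E.
Hypothesis CK : is_CK_family s p.

Local Notation sp := (sp s p).
Local Notation monomial := (monomial s p).
Local Notation comb := (comb s p).
Implicit Types (v w : vertex E) (l : seq (edge E)) (a b : gpath E) (c : R[i]).
Implicit Types (r : seq (term R E)) (K : set A).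

Definition gmaximal n a := maximal n a.1 a.2.

Lemma sp_p a : sp a ** p (gtgt a) = sp a.
Proof. exact: (spath_p CK). Qed.

Lemma sp_star_maximal n a b : gmaximal n a -> gmaximal n b ->
  cstar (sp a) ** sp b = if a == b then p (gtgt a) else 0.
Proof. by case: a b => [v l] [w m]; exact: (spath_star_maximal rowfin CK). Qed.

Definition maximal_terms n' n r :=
  forall t, t \in r -> [/\ gmaximal n' t.2.1, gmaximal n t.2.2 & gtgt t.2.1 = gtgt t.2.2].

(* An inner product space, with x^* y in C p_w as inner product. *)
Definition vectors n w : set A := [set d | exists2 r : seq (R[i] * gpath E),
  (forall t, t \in r -> gmaximal n t.2 /\ gtgt t.2 = w) &
  d = \sum_(t <- r) t.1 *: sp t.2].

Lemma vectors_subspace n w : is_subspace (vectors n w).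
Proof.
split.
- by exists [::] => //; rewrite big_nil.
- move=> _ _ [r1 h1 ->] [r2 h2 ->]; exists (r1 ++ r2); last by rewrite big_cat.
  by move=> t; rewrite mem_cat => /orP[/h1|/h2].
- move=> c _ [r1 h1 ->]; exists [seq (c * t.1, t.2) | t <- r1].
    by move=> _ /mapP[t /h1 ? ->].
  by rewrite big_map scaler_sumr; apply: eq_bigr => t _; rewrite scalerA.
Qed.

Lemma sp_vectors n a : gmaximal n a -> vectors n (gtgt a) (sp a).
Proof.
move=> ma; exists [:: (1, a)]; last by rewrite big_seq1 scale1r.
by move=> t; rewrite inE => /eqP ->.
Qed.

Lemma vectors_inner n w x y : vectors n w x -> vectors n w y ->
  exists c, cstar x ** y = c *: p w.
Proof.
move=> [r1 h1 ->] [r2 h2 ->].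
pose S := [set x | exists c, x = c *: p w]; have sub : is_subspace S.
  split; first by exists 0; rewrite scale0r.
  - by move=> _ _ [c ->] [d ->]; exists (c + d); rewrite scalerDl.
  - by move=> d _ [c ->]; exists (d * c); rewrite scalerA.
suff : S (cstar (\sum_(t <- r1) t.1 *: sp t.2) ** \sum_(t <- r2) t.1 *: sp t.2) by [].
rewrite cstar_sum cmul_suml; apply: (subspace_sum_in sub) => t /h1 [mt tw].
rewrite cmul_sumr; apply: (subspace_sum_in sub) => u /h2 [mu uw].
rewrite cstarZ cmulZl cmulZr (sp_star_maximal mt mu) tw scalerA.
by case: ifP => _; [eexists|exists 0; rewrite scaler0 scale0r].
Qed.

(** A term s_a s_b^* sends s_b to s_a and any other maximal path of level n to 0: on these spaces
    [comb r] is a rectangular matrix that preserves the end vertex. *)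
Lemma comb_vectors n' n w r x : maximal_terms n' n r -> vectors n w x ->
  vectors n' w (comb r ** x).
Proof.
move=> hr [r1 h1 ->]; have sub := vectors_subspace n' w; have [_ _ Z] := sub.
rewrite cmul_suml; apply: (subspace_sum_in sub) => t /hr [mt1 mt2 tE].
rewrite cmul_sumr; apply: (subspace_sum_in sub) => u /h1 [mu uw].
rewrite cmulZl cmulZr; apply: (Z); apply: (Z).
rewrite -cmulA (sp_star_maximal mt2 mu); case: eqP => [tu|_].
  by rewrite -tE sp_p -uw -tu -tE; exact: sp_vectors.
by rewrite cmul0r; case: sub.
Qed.

Lemma comb_vectors_eq0 n' n w r x : maximal_terms n' n r ->
  (forall t, t \in r -> gtgt t.2.2 <> w) -> vectors n w x -> comb r ** x = 0.
Proof.
move=> hr nw [r1 h1 ->].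
rewrite cmul_suml big1_seq// => t /= tr; have [mt1 mt2 _] := hr _ tr.
rewrite cmul_sumr big1_seq// => u /h1 [mu uw].
rewrite cmulZl cmulZr -cmulA (sp_star_maximal mt2 mu); case: eqP => [tu|_].
  by case: (nw _ tr); rewrite tu.
by rewrite cmul0r !scaler0.
Qed.

Lemma maximal_terms_flip n' n r : maximal_terms n' n r -> maximal_terms n n' (flip r).
Proof. by move=> h _ /mapP[t /h [? ? ?] ->]. Qed.

Lemma vertex_ideal_is_ideal (H : set (vertex E)) : is_ideal (vertex_ideal p H).
Proof.
split; first split.
- by move=> J [[[J0 _ _] _ _ _] _].
- by move=> x y hx hy J JH; case: (JH) => -[[_ JD _] _ _ _] _; apply: JD; [exact: hx|exact: hy].
- by move=> c x hx J JH; case: (JH) => -[[_ _ JZ] _ _ _] _; apply: JZ; exact: hx.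
- by move=> a x hx J JH; case: (JH) => -[_ Jl _ _] _; apply: Jl; exact: hx.
- by move=> a x hx J JH; case: (JH) => -[_ _ Jr _] _; apply: Jr; exact: hx.
- apply: nm_closed => x h J JH; case: (JH) => -[_ _ _ Jcl] _.
  by apply: (closed_nm Jcl) => e /h [y hy xy]; exists y => //; exact: hy.
Qed.

Lemma vertex_ideal_p (H : set (vertex E)) v : H v -> vertex_ideal p H (p v).
Proof. by move=> Hv J [_]; apply; exists v. Qed.

Lemma vertex_ideal_sub (H : set (vertex E)) K : is_ideal K ->
  (forall v, H v -> K (p v)) -> vertex_ideal p H `<=` K.
Proof. by move=> iK hK x; apply; split=> // _ [v Hv <-]; exact: hK. Qed.

(* The part b' of b supported on the vertices outside H(K) satisfies
   |b'| <= d: it is enough to bound the action of b' and of its adjoint on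
   the vectors over a single vertex w, and there |b' x|^2 p_w is close to K. *)
Lemma block_distance K n' n r z (d : R) : is_ideal K -> K z -> 0 < d ->
  maximal_terms n' n r -> nm (comb r - z) <= d ->
  exists2 y, vertex_ideal p (ideal_vertices p K) y & nm (comb r - y) <= d.
Proof.
move=> iK Kz d0 hr bz; have [Ksub Kl Kr _] := iK.
pose H := fun t : term R E => `[<K (p (gtgt t.2.1))>].
pose r1 := [seq t <- r | H t]; pose r2 := [seq t <- r | ~~ H t].
have rE : comb r = comb r1 + comb r2 by rewrite /comb (bigID H) /= !big_filter.
exists (comb r1).
  have [Isub Il Ir _] := vertex_ideal_is_ideal (ideal_vertices p K).
  have [_ _ IZ] := Isub; rewrite /comb big_filter; apply: subspace_sum Isub _ => t /asboolP Kt.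
  apply: IZ; rewrite /monomial -sp_p; apply: Ir; apply: Il.
  exact: vertex_ideal_p.
rewrite rE addrC addKr; set b := comb r2.
have h1 : maximal_terms n' n r1 by move=> t; rewrite mem_filter => /andP[_ /hr].
have h2 : maximal_terms n' n r2 by move=> t; rewrite mem_filter => /andP[_ /hr].
(* Over a vertex outside H(K) the terms of [r1] act as zero, so b may be replaced there by [comb r],
   the element known to be close to K. *)
have bE w x : ~ K (p w) -> vectors n w x -> b ** x = comb r ** x.
  move=> Kw vx; rewrite rE cmulDl (comb_vectors_eq0 h1 _ vx) ?add0r// => t.
  rewrite mem_filter => /andP[/asboolP Kt /hr [_ _ tE]] tw.
  by apply: Kw; rewrite -tw -tE.
have bsE w x : ~ K (p w) -> vectors n' w x -> cstar b ** x = cstar (comb r) ** x.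
  move=> Kw vx; rewrite rE cstarD cmulDl -comb_flip.
  rewrite (comb_vectors_eq0 (maximal_terms_flip h1) _ vx) ?add0r// => _ /mapP[t + ->].
  rewrite mem_filter => /andP[/asboolP Kt _] tw.
  by apply: Kw; rewrite -tw.
have pw1 w : ~ K (p w) -> nm (p w) = 1.
  move=> Kw; apply: nm_projection_neq0; first exact: p_proj CK w.
  by apply/eqP => pw0; apply: Kw; rewrite pw0; case: Ksub.
(* Here x^* x = c p_w with |c| = |x|^2, and its distance to K is at least |c|; one factor |x| then
   cancels. *)
have inner_bound m w (x y u : A) : ~ K (p w) -> vectors m w x ->
    K u -> nm (cstar x ** x - u) <= nm x * (d * nm y) -> nm x <= d * nm y.
  move=> Kw vx Ku le; have [c cE] := vectors_inner vx vx.
  have := dist_projection_ideal c iK (p_proj CK w) Kw Ku.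
  have := nm_cstarM x; rewrite cE nmZ (pw1 w Kw) mulr1 => -> le2.
  move: le; rewrite cE => /(le_trans le2).
  have [->|x0] := eqVneq (nm x) 0; first by move=> _; rewrite mulr_ge0 ?nm_ge0 ?ltW.
  by rewrite expr2 ler_pM2l// lt_def x0 nm_ge0.
have triple (x y z' : A) : nm (x ** z' ** y) <= nm x * (nm z' * nm y).
  rewrite -cmulA; apply: le_trans (nm_cmul _ _) _.
  by apply: ler_wpM2l; [exact: nm_ge0|exact: nm_cmul].
have bound w x : ~ K (p w) -> vectors n w x -> nm (b ** x) <= d * nm x.
  move=> Kw vx; rewrite (bE w)//; have vbx := comb_vectors hr vx.
  apply: (inner_bound n' w _ x (cstar (comb r ** x) ** z ** x) Kw vbx) => //.
    by apply: Kr; apply: Kl.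
  rewrite -cmulA -cmulBr -cmulBl cmulA -[nm (comb r ** x) in leRHS]nm_cstar.
  apply: le_trans (triple _ _ _) _.
  by apply: ler_wpM2l; rewrite ?nm_ge0//; apply: ler_wpM2r; rewrite ?nm_ge0.
(* K is not known to contain z^*, so b^* is not compared with it. With y = b^* x, the element x^* b
   y is a multiple of p_w whose adjoint is y^* y, and it is close to x^* z y, which lies in K. *)
have sbound w x : ~ K (p w) -> vectors n' w x -> nm (cstar b ** x) <= d * nm x.
  move=> Kw vx; rewrite (bsE w)//.
  have vbx : vectors n w (cstar (comb r) ** x).
    by rewrite -comb_flip; exact: comb_vectors (maximal_terms_flip hr) vx.
  have [c cE] := vectors_inner vbx vbx.
  set y := cstar (comb r) ** x in vbx cE *.
  have yy : cstar (cstar x ** comb r ** y) = cstar y ** y.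
    by rewrite cstarM (cstarM (cstar x)) cstarK.
  have yy' : cstar x ** comb r ** y = (c^*) *: p w.
    by rewrite -[LHS]cstarK yy cE cstarZ (p_star CK).
  have Ku : K (cstar x ** z ** y) by apply: Kr; apply: Kl.
  have := dist_projection_ideal (c^*) iK (p_proj CK w) Kw Ku.
  have nc : nm c = nm y ^+ 2 by rewrite -nm_cstarM cE nmZ (pw1 w Kw) mulr1.
  rewrite nm_conj nc -yy' -cmulBl -cmulBr => le1.
  have := le_trans le1 (triple _ _ _); rewrite nm_cstar => le2.
  have y0 := nm_ge0 y; have x0 := nm_ge0 x.
  have := ler_wpM2r (mulr_ge0 x0 y0) bz.
  have [->|yn0] := eqVneq (nm y) 0; first by rewrite mulr_ge0// ltW.
  move=> le3; have yp : 0 < nm y by rewrite lt_def yn0.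
  rewrite -(ler_pM2r yp); move: le2; rewrite expr2; nra.
pose g := cstar b ** b.
have sg : cstar g = g by rewrite /g cstarM cstarK.
have vg w x : vectors n w x -> vectors n w (g ** x).
  move=> vx; rewrite /g -cmulA -comb_flip.
  by apply: (comb_vectors (maximal_terms_flip h2)); apply: (comb_vectors h2).
have gbound w x : ~ K (p w) -> vectors n w x -> nm (g ** x) <= d ^+ 2 * nm x.
  move=> Kw vx; rewrite /g -cmulA; apply: le_trans (sbound w _ Kw _) _.
    exact: comb_vectors h2 vx.
  by rewrite expr2 -mulrA ler_pM2l//; exact: bound vx.
have itbound k w x : ~ K (p w) -> vectors n w x ->
    vectors n w (iter k (cmul g) x) /\ nm (iter k (cmul g) x) <= (d ^+ 2) ^+ k * nm x.
  move=> Kw vx; elim: k => [|k [IH1 IH2]]; first by rewrite mul1r.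
  split; first exact: vg.
  apply: le_trans (gbound _ _ Kw IH1) _.
  by rewrite [in leRHS]exprS -mulrA ler_pM2l// exprn_gt0.
(* The power g^(k+1) is g^k b^* b. Expanding only b^* into its terms leaves vectors g^k s_a of norm
   at most d^(2k); the remaining constant is crude but independent of k. *)
have gd : nm g <= d ^+ 2.
  apply: (@nm_sa_of_powers _ _ g ((\sum_(t <- r2) nm t.1) * nm b)) => //.
    by rewrite exprn_gt0.
  move=> k.
  have itM x y : iter k (cmul g) (x ** y) = iter k (cmul g) x ** y.
    by elim: k => [//|k IH]; rewrite !iterS IH cmulA.
  rewrite {2}/g itM; apply: le_trans (nm_cmul _ _) _.
  rewrite mulrAC; apply: ler_wpM2r; first exact: nm_ge0.
  have itZ c x : iter k (cmul g) (c *: x) = c *: iter k (cmul g) x.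
    by elim: k {itM} => [//|k IH]; rewrite !iterS IH cmulZr.
  have itS (r' : seq (term R E)) (F : _ -> A) :
      iter k (cmul g) (\sum_(t <- r') F t) = \sum_(t <- r') iter k (cmul g) (F t).
    by elim: k {itM itZ} => [//|k IH]; rewrite iterS IH cmul_sumr.
  rewrite -comb_flip /comb big_map itS mulr_suml.
  apply: le_trans (nm_sum _ _ _) _; rewrite !big_seq; apply: ler_sum => t tr /=.
  have := tr; rewrite mem_filter => /andP[/asboolP nK _].
  have [m1 m2 tE] := h2 _ tr.
  rewrite itZ nmZ nm_conj; apply: ler_wpM2l; first exact: nm_ge0.
  rewrite /monomial itM; apply: le_trans (nm_cmul _ _) _; rewrite nm_cstar.
  have [|_] := itbound k (gtgt t.2.2) (sp t.2.2) _ (sp_vectors m2).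
    by rewrite -tE.
  have := nm_sp CK t.2.2; have := nm_sp CK t.2.1.
  have := nm_ge0 (sp t.2.2); have := nm_ge0 (sp t.2.1).
  have : 0 <= (d ^+ 2) ^+ k by rewrite !exprn_ge0 ?ltW.
  have := nm_ge0 (iter k (cmul g) (sp t.2.2)); nra.
move: gd; rewrite /g nm_cstarM ler_pXn2r// nnegrE ?nm_ge0// ltW//.
Qed.

(** Inserting p_v = sum of s_e s_e^* between s_a and s_b^* prolongs both paths by the same edge.
    This keeps the difference of lengths and stops when a has length n', and then b has length n, or
    when the common end is a source. *)
Lemma expand_monomial n' n a b : ok a b ->
  (size a.2 + n = size b.2 + n')%N -> (size a.2 <= n')%N ->
  exists2 r, maximal_terms n' n r & monomial a b = comb r.
Proof.
have comb_map (I : eqType) (es : seq I) (F : I -> A) :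
    (forall i, i \in es -> exists2 r, maximal_terms n' n r & F i = comb r) ->
    exists2 r, maximal_terms n' n r & \sum_(i <- es) F i = comb r.
  elim: es => [_|i es IH h]; first by exists [::] => //; rewrite /comb !big_nil.
  have [r0 h0 e0] := h i (mem_head _ _).
  have [|r1 h1 e1] := IH; first by move=> j jes; apply: h; rewrite inE jes orbT.
  exists (r0 ++ r1); first by move=> t; rewrite mem_cat => /orP[/h0|/h1].
  by rewrite big_cons comb_cat e0 e1.
have [k] := ubnP (n' - size a.2)%N; elim: k a b => [//|k IH] [v l] [v' l'].
move=> lk okab szE szle; have /and3P[wa wb /eqP tE] := okab.
rewrite /gwf /gtgt /= in szE szle wa wb tE lk.
have done1 : ((size l < n')%N -> is_source (tgt v l)) ->
    exists2 r, maximal_terms n' n r & monomial (v, l) (v', l') = comb r.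
  move=> src1; exists [:: (1, ((v, l), (v', l')))]; last by rewrite comb1.
  move=> t; rewrite inE => /eqP -> /=; split=> //; split=> //=; first by lia.
  by move=> lt; rewrite -tE; apply: src1; lia.
have [szE'|] := eqVneq (size l) n'; first by apply: done1; rewrite szE' ltnn.
move=> szne; have szlt : (size l < n')%N by rewrite ltn_neqAle szne.
have [so|nso] := pselect (is_source (tgt v l)); first exact: done1.
have MS : monomial (v, l) (v', l') =
    \sum_(e <- inedges (tgt v l)) monomial (v, rcons l e) (v', rcons l' e).
  rewrite /monomial -[sp (v, l)]sp_p /gtgt /= (p_sum rowfin CK nso).
  rewrite cmul_sumr cmul_suml big_seq [RHS]big_seq; apply: eq_bigr => e.
  rewrite (mem_inedges rowfin) => /eqP re.
  by rewrite /sp /= !(spath_rcons rowfin CK) -?tE// cstarM !cmulA.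
rewrite MS; apply: comb_map => e; rewrite (mem_inedges rowfin) => /eqP re.
apply: IH => /=; rewrite ?size_rcons; try lia.
by rewrite /ok /gwf /gtgt /= !tgt_rcons !wf_rcons wa wb re -tE !eqxx.
Qed.

(** The degree l - j may have either sign, so both levels are raised: l + M and j + M differ by the
    degree, and M bounds the lengths of the left paths. *)
Lemma homogeneous_distance K r (j l : nat) z (d : R) : is_ideal K -> K z -> 0 < d ->
  valid r -> (forall t, t \in r -> size t.2.1.2 + j = size t.2.2.2 + l)%N ->
  nm (comb r - z) <= d ->
  exists2 y, vertex_ideal p (ideal_vertices p K) y & nm (comb r - y) <= d.
Proof.
move=> iK Kz d0 vr hr.
have [M hM] : exists M, forall t, t \in r -> (size t.2.1.2 <= M)%N.
  elim: (r) => [|t r' [M hM]]; first by exists 0%N.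
  exists (size t.2.1.2 + M)%N => u; rewrite inE => /orP[/eqP ->|/hM h].
    exact: leq_addr.
  exact: leq_trans h (leq_addl _ _).
have [r' h' ->] : exists2 r', maximal_terms (l + M) (j + M) r' & comb r = comb r'.
  elim: r vr hr hM => [|t r IH] /= => [_ _ _|/andP[ot vr] hr hM].
    by exists [::] => //; rewrite /comb big_nil.
  have [||r1 h1 e1] := IH vr.
  - by move=> u ur; apply: hr; rewrite inE ur orbT.
  - by move=> u ur; apply: hM; rewrite inE ur orbT.
  have [||r0 h0 e0] := @expand_monomial (l + M) (j + M) _ _ ot.
  - by rewrite !addnA (hr _ (mem_head _ _)).
  - exact: leq_trans (hM _ (mem_head _ _)) (leq_addl _ _).
  exists (scale t.1 r0 ++ r1).
    by move=> u; rewrite mem_cat => /orP[/mapP[u' /h0 [? ? ?] ->]|/h1].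
  by rewrite comb_cat comb_scale -e0 -e1 /comb big_cons.
exact: block_distance iK Kz d0 h'.
Qed.

End Block.

(** * Fejer summation *)

Section Roots.
Context {R : realType}.

(** Here z arises from -1 by N successive square roots. Its order divides 2^(N+1) but not 2^N,
    because z^(2^N) = -1, so z is primitive of order n = 2^(N+1). *)
Lemma unit_roots_orthogonal (N : nat) : exists n (z : R[i]),
  [/\ (N < n)%N, `|z| = 1 & forall a b, (a < n)%N -> (b < n)%N ->
    \sum_(m < n) (z ^+ a * z^* ^+ b) ^+ m = if a == b then n%:R else 0].
Proof.
have [z zN] : exists z : R[i], z ^+ (2 ^ N) = -1.
  elim: N => [|N [z zN]]; first by exists (-1); rewrite expr1.
  by exists (sqrtC z); rewrite expnS exprM sqrtCK.
pose n := (2 ^ N.+1)%N; have n0 : (0 < n)%N by rewrite expn_gt0.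
have zn : z ^+ n = 1 by rewrite /n expnS mulnC exprM zN sqrrN expr1n.
have z1 : `|z| = 1.
  by apply/eqP; rewrite -(@pexpr_eq1 _ _ n)// -normrX zn normr1.
have zz : z * z^* = 1 by rewrite -normCK z1 expr1n.
have prim : n.-primitive_root z.
  have [m mp mn] := prim_order_exists n0 zn.
  have /(@dvdn_pfactor 2 _ _ isT) [j jN mj] : (m %| 2 ^ N.+1)%N by [].
  have [jE|jne] := eqVneq j N.+1; first by rewrite /n -jE -mj.
  have : z ^+ (2 ^ N) = 1.
    have jN' : (j <= N)%N by rewrite -ltnS ltn_neqAle jne.
    by rewrite -(subnKC jN') expnD exprM -mj (prim_expr_order mp) expr1n.
  by move=> /eqP; rewrite zN eq_sym -subr_eq0 opprK (_ : 1 + 1 = 2%:R)// pnatr_eq0.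
exists n, z; split=> //; first by rewrite /n; apply: ltn_trans (ltnSn N) (ltn_expl _ _).
move=> a b an bn; have [<-|ab] := eqVneq a b.
  rewrite -exprMn zz expr1n; under eq_bigr do rewrite expr1n.
  by rewrite sumr_const card_ord.
pose q := z ^+ a * z^* ^+ b.
have qn : q ^+ n = 1.
  rewrite /q exprMn -!exprM mulnC exprM zn expr1n mul1r mulnC exprM.
  by rewrite -rmorphXn/= zn rmorph1 expr1n.
have key u v : (v < u)%N -> (u < n)%N -> z ^+ u * z^* ^+ v <> 1.
  move=> vu un; rewrite -(subnK (ltnW vu)) exprD -mulrA -exprMn zz expr1n mulr1.
  move=> /eqP; rewrite -(prim_order_dvd prim) gtnNdvd//; first by rewrite subn_gt0.
  by apply: leq_ltn_trans un; exact: leq_subr.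
have q1 : q != 1.
  apply/eqP => q1; case: (ltngtP a b) => [lt|lt|E]; last by rewrite E eqxx in ab.
    apply: (key b a lt bn); have := congr1 (fun x : R[i] => x^*) q1.
    rewrite /q /= rmorph1 rmorphM/= !rmorphXn/= conjCK mulrC => h.
    exact: h.
  exact: key lt an q1.
have := subrX1 q n; rewrite qn subrr => /esym/eqP; rewrite mulf_eq0.
by rewrite subr_eq0 (negbTE q1)/= => /eqP.
Qed.

(** The double sum is max(N - |a - b|, 0), the Fejer weight of the degree a - b before division by
    N; two cruder bounds suffice. *)
Lemma count_shifts (N a b : nat) :
  (N <= \sum_(j < N) \sum_(l < N) (j + a == l + b) + (a + b))%N /\
  (\sum_(j < N) \sum_(l < N) (j + a == l + b) <= N)%N.
Proof.
have inner x M : (\sum_(l < M) (x == l + b) = (b <= x) && (x < b + M) :> nat)%N.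
  elim: M => [|M IH]; first by rewrite big_ord0 addn0; case: leqP.
  rewrite big_ord_recr /= IH.
  have -> : (x < b + M.+1)%N = (x < b + M)%N || (x == M + b)%N by lia.
  have h1 : (x == M + b)%N -> (b <= x)%N by lia.
  have h2 : (x == M + b)%N -> (x < b + M)%N = false by lia.
  by case: (x == _)%N h1 h2 => [-> // -> //|_ _]; rewrite orbF addn0.
under eq_bigr do rewrite inner.
split; last first.
  rewrite -[X in (_ <= X)%N]card_ord -sum1_card; apply: leq_sum => i _; exact: leq_b1.
(* Among the j < K, at most b satisfy j + a < b, and those with j + a >= b + N all lie between N - a
   and K. *)
suff : forall K, (K <= N)%N -> (K <=
    \sum_(j < K) ((b <= j + a) && (j + a < b + N) : nat) + b + (K - (N - a)))%N.
  move=> /(_ N (leqnn _)) h; apply: leq_trans h _.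
  by rewrite -addnA leq_add2l; lia.
elim=> [//|K IH] KN; rewrite big_ord_recr /=.
move: (IH (ltnW KN)); set S := (\sum_(_ < K) _)%N => IHK.
case c: (_ && _) => /=; first by lia.
by move/negbT: c; rewrite negb_and -ltnNge -leqNgt => /orP[]; lia.
Qed.

End Roots.

(** * Averages over the gauge action *)

Section Gauge.
Context {R : realType} {E : digraph} {A : cstarAlgType R}.
Variables (s : edge E -> A) (p : vertex E -> A) (gamma : R[i] -> A -> A).
Hypothesis rowfin : row_finite E.
Hypothesis CK : is_CK_family s p.
Hypothesis gauge : is_gauge_action s p gamma.

Local Notation monomial := (monomial s p).
Local Notation comb := (comb s p).
Implicit Types (a b : gpath E) (c z : R[i]) (r : seq (term R E)) (K : set A).

Lemma gauge_monomial z a b : `|z| = 1 ->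
  gamma z (monomial a b) = (z ^+ size a.2 * z^* ^+ size b.2) *: monomial a b.
Proof.
move=> z1; have [hom gs gp] := gauge z1; have [_ gM gS] := hom.
have gsp (u : gpath E) : gamma z (sp s p u) = z ^+ size u.2 *: sp s p u.
  case: u => v l; rewrite /sp /=; elim: l v => [|e l IH] v /=.
    by rewrite gp scale1r.
  by rewrite gM gs IH cmulZl cmulZr scalerA -exprS.
rewrite /monomial gM gS !gsp cstarZ cmulZl cmulZr scalerA.
by congr (_ * _ *: _); rewrite -[LHS]/(conjc _) rmorphXn.
Qed.

(* The Fourier-type averages (1/n) sum_m w^j conj(w)^l gamma_w, w = z^m, over
   the n-th roots of unity keep exactly the terms of degree l - j. *)
Definition average n z (j l : nat) (x : A) : A :=
  n%:R^-1 *: \sum_(m < n) (z ^+ j * z^* ^+ l) ^+ m *: gamma (z ^+ m) x.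

(** Running both shifts over N values gives [gamma (z ^+ m)] the weight |sum_{j<N} z^(m j)|^2 / (N
    n), a discrete Fejer kernel. *)
Definition fejer (N n : nat) z (x : A) : A :=
  N%:R^-1 *: \sum_(j < N) \sum_(l < N) average n z j l x.

Lemma nmVn n : nm (n%:R^-1 : R[i]) = n%:R^-1.
Proof.
have -> : (n%:R^-1 : R[i]) = (n%:R^-1 : R)%:C%C by rewrite fmorphV rmorph_nat.
by rewrite nm_real ger0_norm// invr_ge0.
Qed.

Section Averages.
Variables (n : nat) (z : R[i]).
Hypothesis z1 : `|z| = 1.
Hypothesis n0 : (0 < n)%N.
Hypothesis orth : forall a b : nat, (a < n)%N -> (b < n)%N ->
    \sum_(m < n) (z ^+ a * z^* ^+ b) ^+ m = if a == b then n%:R else 0.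

Let zm m : `|z ^+ m| = 1. Proof. by rewrite normrX z1 expr1n. Qed.

Let hom m : is_star_hom (gamma (z ^+ m)). Proof. by case: (gauge (zm m)). Qed.

Lemma averageB j l x y : average n z j l (x - y) = average n z j l x - average n z j l y.
Proof.
rewrite /average -scalerBr -sumrB; congr (_ *: _); apply: eq_bigr => m _.
by rewrite -scalerBr (star_homB (hom m)).
Qed.

Lemma averageZ j l c x : average n z j l (c *: x) = c *: average n z j l x.
Proof.
rewrite /average [RHS]scalerA [c * _]mulrC -[RHS]scalerA; congr (_ *: _).
rewrite scaler_sumr; apply: eq_bigr => m _.
by rewrite (star_homZ (hom m)) !scalerA mulrC.
Qed.

Lemma average_sum j l I (r : seq I) (F : I -> A) :
  average n z j l (\sum_(i <- r) F i) = \sum_(i <- r) average n z j l (F i).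
Proof.
rewrite /average -scaler_sumr exchange_big /=; congr (_ *: _).
by apply: eq_bigr => m _; rewrite (star_hom_sum (hom m)) scaler_sumr.
Qed.

Lemma nm_average j l x : nm (average n z j l x) <= nm x.
Proof.
have nz : nm z = 1 by rewrite /nm z1.
rewrite nmZ nmVn -ler_pdivlMl ?invr_gt0 ?ltr0n// invrK.
apply: le_trans (nm_sum _ _ _) _.
have -> : n%:R * nm x = \sum_(m < n) nm x by rewrite sumr_const card_ord mulr_natl.
apply: ler_sum => m _; rewrite nmZ nmX nmM !nmX nm_conj nz !expr1n mulr1 expr1n mul1r.
exact: star_hom_nm (hom m) _.
Qed.

Lemma average_ideal K j l x : is_subspace K ->
  (forall w y, `|w| = 1 -> K y -> K (gamma w y)) -> K x -> K (average n z j l x).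
Proof.
move=> sK Kg Kx; have [_ _ KZ] := sK; apply: (KZ); apply: subspace_sum sK _ => m _.
by apply: KZ; apply: Kg.
Qed.

(** The length bounds rule out aliasing: the n-th roots of unity separate only exponents below n. *)
Lemma average_monomial j l a b : (j + size a.2 < n)%N -> (l + size b.2 < n)%N ->
  average n z j l (monomial a b) =
    if (j + size a.2 == l + size b.2)%N then monomial a b else 0.
Proof.
move=> jn ln; rewrite /average.
under eq_bigr => m _.
  rewrite (gauge_monomial _ _ (zm m)) scalerA.
  have -> : (z ^+ j * z^* ^+ l) ^+ m * ((z ^+ m) ^+ size a.2 * (z ^+ m)^* ^+ size b.2) =
      (z ^+ (j + size a.2) * z^* ^+ (l + size b.2)) ^+ m.
    have -> : (z ^+ m)^* = z^* ^+ m by rewrite -[LHS]/(conjc _) rmorphXn.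
    by rewrite !exprMn -!exprM !(mulnC _ m) !mulnDr !exprD mulrACA.
  over.
rewrite -scaler_suml orth// scalerA; case: eqP => _; last by rewrite mulr0 scale0r.
by rewrite mulVf ?scale1r// pnatr_eq0 -lt0n.
Qed.

Lemma average_comb j l r :
  (forall t, t \in r -> (j + size t.2.1.2 < n)%N /\ (l + size t.2.2.2 < n)%N) ->
  average n z j l (comb r) =
    comb [seq t <- r | (j + size t.2.1.2 == l + size t.2.2.2)%N].
Proof.
move=> hr; rewrite average_sum /comb big_filter [RHS]big_mkcond /=.
apply: eq_big_seq => t /hr [h1 h2]; rewrite averageZ average_monomial//.
by case: ifP => // _; rewrite scaler0.
Qed.

(** Bounding the N^2 averages one by one would only give N |x|. Regrouped by m, the weights are
    nonnegative with total 1, and each gauge automorphism is contractive. *)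
Lemma nm_fejer N x : (0 < N)%N -> (N <= n)%N -> nm (fejer N n z x) <= nm x.
Proof.
move=> N0 Nn.
pose S m : R[i] := \sum_(j < N) (z ^+ m) ^+ j.
have SS m : S m * (S m)^* = \sum_(j < N) \sum_(l < N) (z ^+ j * z^* ^+ l) ^+ m.
  have -> : (S m)^* = \sum_(j < N) (z^* ^+ m) ^+ j.
    rewrite -[LHS]/(conjc _) rmorph_sum; apply: eq_bigr => j _.
    by rewrite !rmorphXn.
  rewrite mulr_suml; apply: eq_bigr => j _; rewrite mulr_sumr; apply: eq_bigr => l _.
  by rewrite exprMn -!exprM !(mulnC _ m).
have FE : fejer N n z x = (N%:R^-1 * n%:R^-1) *: \sum_(m < n) (S m * (S m)^*) *: gamma (z ^+ m) x.
  rewrite /fejer -scalerA; congr (_ *: _); rewrite /average.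
  under eq_bigr do rewrite -scaler_sumr.
  rewrite -scaler_sumr; congr (_ *: _).
  under eq_bigr do rewrite exchange_big.
  rewrite exchange_big /=; apply: eq_bigr => m _.
  under eq_bigr do rewrite -scaler_suml.
  rewrite -scaler_suml; congr (_ *: _).
  by rewrite SS.
have tot : \sum_(m < n) S m * (S m)^* = (N * n)%:R.
  under eq_bigr do rewrite SS.
  rewrite exchange_big /=; under eq_bigr do rewrite exchange_big /=.
  transitivity (\sum_(j < N) (n%:R : R[i])).
    apply: eq_bigr => j _; have lt (i : 'I_N) : (i < n)%N by apply: leq_trans Nn.
    rewrite (bigD1 j)//= orth// eqxx big1 ?addr0// => l lj.
    by rewrite orth// ifN// eq_sym.
  by rewrite sumr_const card_ord mulnC natrM mulr_natr.
have tot' : \sum_(m < n) nm (S m * (S m)^*) = (N * n)%:R.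
  apply: complexI; rewrite rmorph_sum rmorph_nat -tot; apply: eq_bigr => m _.
  by rewrite /= -nmE -normCK normrX normr_id.
rewrite FE nmZ nmM !nmVn -invfM -natrM -ler_pdivlMl ?invr_gt0 ?ltr0n ?muln_gt0 ?N0// invrK.
apply: le_trans (nm_sum _ _ _) _; rewrite -tot' mulr_suml; apply: ler_sum => m _.
rewrite nmZ; apply: ler_wpM2l; first exact: nm_ge0.
exact: star_hom_nm (hom m) _.
Qed.

Lemma fejerB N x y : fejer N n z (x - y) = fejer N n z x - fejer N n z y.
Proof.
rewrite /fejer -scalerBr -sumrB; congr (_ *: _); apply: eq_bigr => j _.
by rewrite -sumrB; apply: eq_bigr => l _; rewrite averageB.
Qed.

(** Each term is multiplied by k/N with N - k at most |a| + |b|, so for a fixed list the error is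
    O(1/N). *)
Lemma fejer_comb N r : (0 < N)%N ->
  (forall t, t \in r -> (N + size t.2.1.2 < n)%N /\ (N + size t.2.2.2 < n)%N) ->
  nm (comb r - fejer N n z (comb r)) <=
    (\sum_(t <- r) nm t.1 * (size t.2.1.2 + size t.2.2.2)%:R) / N%:R.
Proof.
move=> N0 hr; have NR0 : 0 < (N%:R : R) by rewrite ltr0n.
pose k (t : term R E) := (\sum_(j < N) \sum_(l < N)
  ((j + size t.2.1.2 == l + size t.2.2.2) : nat))%N.
have -> : fejer N n z (comb r) =
    \sum_(t <- r) (N%:R^-1 * (k t)%:R * t.1) *: monomial t.2.1 t.2.2.
  rewrite /fejer; under eq_bigr do under eq_bigr do rewrite average_sum.
  under eq_bigr do rewrite exchange_big /=.
  rewrite exchange_big scaler_sumr /=; apply: eq_big_seq => t /hr [h1 h2].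
  rewrite -mulrA -scalerA; congr (_ *: _).
  rewrite /k natr_sum mulr_suml scaler_suml; apply: eq_bigr => j _.
  rewrite natr_sum mulr_suml scaler_suml; apply: eq_bigr => l _.
  rewrite averageZ average_monomial.
  - by case: eqP => _; rewrite ?mul1r// mul0r scale0r scaler0.
  - by apply: leq_ltn_trans h1; rewrite leq_add2r ltnW.
  - by apply: leq_ltn_trans h2; rewrite leq_add2r ltnW.
rewrite /comb -sumrB; apply: le_trans (nm_sum _ _ _) _.
rewrite mulr_suml; apply: ler_sum => t _.
have -> : t.1 *: monomial t.2.1 t.2.2 -
    (N%:R^-1 * (k t)%:R * t.1) *: monomial t.2.1 t.2.2 =
    ((N%:R^-1 * (N - k t)%:R) * t.1) *: monomial t.2.1 t.2.2.
  have [_ kN] := count_shifts N (size t.2.1.2) (size t.2.2.2).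
  rewrite -scalerBl -{1}[t.1]mul1r -mulrBl natrB// mulrBr mulVf//.
  by rewrite pnatr_eq0 -lt0n.
rewrite nmZ nmM nmM nmVn.
have -> : nm ((N - k t)%:R : R[i]) = (N - k t)%:R.
  have -> : ((N - k t)%:R : R[i]) = ((N - k t)%:R : R)%:C%C by rewrite rmorph_nat.
  by rewrite nm_real ger0_norm.
have := nm_monomial CK t.2.1 t.2.2; set M := nm (monomial _ _) => M1.
have M0 : 0 <= M by exact: nm_ge0.
have [kab _] := count_shifts N (size t.2.1.2) (size t.2.2.2).
have : ((N - k t)%:R : R) <= (size t.2.1.2 + size t.2.2.2)%:R.
  by rewrite ler_nat leq_subLR; exact: kab.
set q := (_ + _)%:R; set u := (N - k t)%:R => uq.
have u0 : 0 <= u by rewrite ler0n.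
rewrite -!mulrA [leRHS]mulrA [leRHS]mulrC; apply: ler_wpM2l; first by rewrite invr_ge0 ltW.
rewrite mulrA; have c0 := nm_ge0 t.1.
have : u * nm t.1 * M <= u * nm t.1 by rewrite ler_piMr// mulr_ge0.
have := ler_wpM2r c0 uq; lra.
Qed.

End Averages.

Hypothesis gen : smallest (@is_cstar_subalgebra R A) (range s `|` range p) = setT.

Lemma gauge_invariant_ideal K : is_ideal K ->
  (forall w x, `|w| = 1 -> K x -> K (gamma w x)) ->
  K = vertex_ideal p (ideal_vertices p K).
Proof.
move=> iK Kg; apply/seteqP; split; last first.
  by apply: vertex_ideal_sub => // v.
move=> x Kx; have [Ksub _ _ _] := iK.
have iI := vertex_ideal_is_ideal p (ideal_vertices p K).
have [Isub _ _ Icl] := iI; apply: (closed_nm Icl) => e e0.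
(* Five steps of size e/5 lead from x to [comb r0], to its Fejer mean, to the mean of x, to the mean
   of [comb r1], and to Y. *)
have e5 : 0 < e / 5 by rewrite divr_gt0.
have [r0 v0 d0] := span_dense rowfin CK gen x e5.
pose C : R := \sum_(t <- r0) nm t.1 * (size t.2.1.2 + size t.2.2.2)%:R.
have C0 : 0 <= C by apply: sumr_ge0 => t _; rewrite mulr_ge0// nm_ge0.
have [N NC] : exists N, C / (e / 5) <= N.+1%:R.
  exists (Num.bound (C / (e / 5))); apply: ltW.
  apply: lt_trans (archi_boundP _) _; last by rewrite ltr_nat.
  by rewrite divr_ge0// ltW.
move: NC; rewrite ler_pdivrMr// -ler_pdivrMl ?ltr0n// mulrC => NC.
have NR0 : 0 < (N.+1%:R : R) by rewrite ltr0n.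
have N1 : 1 <= (N.+1%:R : R) by rewrite ler1n.
(* N depends on r0, so a second, finer approximation follows: the (N+1)^2 homogeneous parts enter
   with weight 1/(N+1), and each may cost e/5/(N+1). *)
have eN : 0 < e / 5 / N.+1%:R by rewrite divr_gt0.
have [r1 v1 d1] := span_dense rowfin CK gen x eN.
have len (r : seq (term R E)) : exists M, forall t, t \in r ->
    (size t.2.1.2 <= M)%N /\ (size t.2.2.2 <= M)%N.
  elim: r => [|t r [M hM]]; first by exists 0%N.
  exists (M + (size t.2.1.2 + size t.2.2.2))%N => u.
  rewrite inE => /orP[/eqP ->|/hM [h1 h2]].
    by split; apply: leq_trans (leq_addl M _); rewrite ?leq_addr ?leq_addl.
  by split; [apply: leq_trans h1 _|apply: leq_trans h2 _]; exact: leq_addr.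
have [M0 hM0] := len r0; have [M1 hM1] := len r1.
have [n [z [ltn z1 orth]]] := @unit_roots_orthogonal R (N.+1 + (M0 + M1)).
have n0 : (0 < n)%N by apply: leq_ltn_trans ltn.
have Nn : (N.+1 <= n)%N by apply: leq_trans (ltnW ltn); exact: leq_addr.
have hr0 t : t \in r0 -> (N.+1 + size t.2.1.2 < n)%N /\ (N.+1 + size t.2.2.2 < n)%N.
  move=> /hM0 [h1 h2]; split; apply: leq_ltn_trans ltn; rewrite leq_add2l.
    exact: leq_trans h1 (leq_addr _ _).
  exact: leq_trans h2 (leq_addr _ _).
have hr1 t : t \in r1 -> (N.+1 + size t.2.1.2 < n)%N /\ (N.+1 + size t.2.2.2 < n)%N.
  move=> /hM1 [h1 h2]; split; apply: leq_ltn_trans ltn; rewrite leq_add2l.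
    exact: leq_trans h1 (leq_addl _ _).
  exact: leq_trans h2 (leq_addl _ _).
have near (jl : 'I_N.+1 * 'I_N.+1) : exists y,
    vertex_ideal p (ideal_vertices p K) y /\
    nm (average n z jl.1 jl.2 (comb r1) - y) <= e / 5 / N.+1%:R.
  case: jl => j l /=.
  have lt (i : 'I_N.+1) m : (N.+1 + m < n)%N -> (i + m < n)%N.
    by apply: leq_ltn_trans; rewrite leq_add2r ltnW.
  have -> : average n z j l (comb r1) =
      comb [seq t <- r1 | (j + size t.2.1.2 == l + size t.2.2.2)%N].
    by apply: average_comb => // t /hr1 [/lt h1 /lt h2].
  (* The nearby element of K is the same average of x, in K by gauge stability; averaging does not
     increase distances. *)
  have [|||||y Iy yd] := @homogeneous_distance _ _ _ s p rowfin CK K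
      [seq t <- r1 | (j + size t.2.1.2 == l + size t.2.2.2)%N] j l
      (average n z j l x) (e / 5 / N.+1%:R) iK; last by exists y.
  - exact: average_ideal.
  - exact: eN.
  - by apply/allP => t; rewrite mem_filter => /andP[_ tr]; exact: (allP v1).
  - by move=> t; rewrite mem_filter => /andP[/eqP h _]; rewrite addnC h addnC.
  - rewrite -(@average_comb n z)//; last by move=> t /hr1 [/lt h1 /lt h2].
    rewrite -averageB//; apply: le_trans (nm_average z1 n0 _ _ _) _.
    by rewrite nmB.
have [y hy] := choice near.
exists (N.+1%:R^-1 *: \sum_(j < N.+1) \sum_(l < N.+1) y (j, l)).
  have [_ _ IZ] := Isub; apply: IZ; apply: subspace_sum (Isub) _ => j _.
  by apply: subspace_sum (Isub) _ => l _; have [] := hy (j, l).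
set Y := _ *: _; pose sigma := fejer N.+1 n z.
have nsigma u : nm (sigma u) <= nm u by apply: nm_fejer => //.
have sigmaB u v : sigma u - sigma v = sigma (u - v) by rewrite /sigma fejerB.
have s0 : nm (comb r0 - sigma (comb r0)) <= e / 5.
  exact: le_trans (fejer_comb z1 n0 orth _ hr0) _.
have s1 : nm (sigma (comb r0) - sigma x) <= e / 5.
  by rewrite sigmaB; apply: le_trans (nsigma _) _; rewrite nmB.
have s2 : nm (sigma x - sigma (comb r1)) <= e / 5.
  rewrite sigmaB; apply: le_trans (nsigma _) _; apply: le_trans d1 _.
  by rewrite ler_pdivrMr// ler_peMr// ltW.
have s3 : nm (sigma (comb r1) - Y) <= e / 5.
  rewrite /sigma /fejer /Y -scalerBr -sumrB nmZ nmVn -ler_pdivlMl ?invr_gt0// invrK.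
  apply: le_trans (nm_sum _ _ _) _.
  have -> : N.+1%:R * (e / 5) = \sum_(j < N.+1) (e / 5).
    by rewrite sumr_const card_ord mulr_natl.
  apply: ler_sum => j _; rewrite -sumrB; apply: le_trans (nm_sum _ _ _) _.
  have -> : e / 5 = \sum_(l < N.+1) (e / 5 / N.+1%:R).
    by rewrite sumr_const card_ord -[RHS]mulr_natr divfK// gt_eqF.
  by apply: ler_sum => l _; have [] := hy (j, l).
have := nm_triangle x (comb r0) Y; have := nm_triangle (comb r0) (sigma (comb r0)) Y.
have := nm_triangle (sigma (comb r0)) (sigma x) Y.
have := nm_triangle (sigma x) (sigma (comb r1)) Y; lra.
Qed.

End Gauge.

(** * The C*-algebra of bounded operators on l^2 *)

Section UnorderedSums.
Context {R : realType} {X : choiceType}.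
Implicit Types (f g : X -> R[i]) (l : R[i]) (s : seq X).

(** Convergence along the net of finite subsets, listed without repetition: X may be uncountable,
    and reindexing requires no order on it. *)
Definition sums_to f l := forall e : R, 0 < e -> exists s0, forall s,
  uniq s -> {subset s0 <= s} -> nm (\sum_(x <- s) f x - l) <= e.

Lemma sums_to_unique f l l' : sums_to f l -> sums_to f l' -> l = l'.
Proof.
move=> h h'; apply/eqP; rewrite -subr_eq0; apply/eqP/nm_eq0/small_eq0.
  exact: nm_ge0.
move=> e e0; have e2 : 0 < e / 2 by rewrite divr_gt0.
have [s0 h0] := h _ e2; have [s1 h1] := h' _ e2.
have u : uniq (undup (s0 ++ s1)) by exact: undup_uniq.
have := h0 _ u; have := h1 _ u.
move=> H1 H0; apply: le_trans (nm_triangle _ (\sum_(x <- undup (s0 ++ s1)) f x) _) _.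
rewrite nmB (_ : e = e / 2 + e / 2); last by rewrite -splitr.
by apply: lerD; [apply: H0|apply: H1] => x xs; rewrite mem_undup mem_cat xs ?orbT.
Qed.

Lemma sums_toD f g l m : sums_to f l -> sums_to g m ->
  sums_to (fun x => f x + g x) (l + m).
Proof.
move=> h h' e e0; have e2 : 0 < e / 2 by rewrite divr_gt0.
have [s0 h0] := h _ e2; have [s1 h1] := h' _ e2.
exists (s0 ++ s1) => s us ss; rewrite big_split /= opprD addrACA.
apply: le_trans (nmD _ _) _; rewrite (_ : e = e / 2 + e / 2); last by rewrite -splitr.
by apply: lerD; [apply: h0|apply: h1] => // x xs; apply: ss; rewrite mem_cat xs ?orbT.
Qed.

Lemma sums_toZ c f l : sums_to f l -> sums_to (fun x => c * f x) (c * l).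
Proof.
move=> h e e0; have c0 : 0 < nm c + 1 by rewrite ltr_wpDl ?nm_ge0.
have [s0 h0] := h _ (divr_gt0 e0 c0); exists s0 => s us ss.
rewrite -mulr_sumr -mulrBr nmM; have := h0 _ us ss; rewrite ler_pdivlMr// => le.
have := nm_ge0 (\sum_(x <- s) f x - l); have := nm_ge0 c; nra.
Qed.

Lemma sums_to_conj f l : sums_to f l -> sums_to (fun x => (f x)^*) (l^*).
Proof.
move=> h e /h [s0 h0]; exists s0 => s us ss.
by rewrite -rmorph_sum -rmorphB nm_conj; exact: h0.
Qed.

Lemma le_sum_subseq (g : X -> R) (s0 s : seq X) : (forall x, 0 <= g x) -> uniq s0 ->
  uniq s -> {subset s0 <= s} -> \sum_(x <- s0) g x <= \sum_(x <- s) g x.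
Proof.
move=> g0 us0 us ss; rewrite [leRHS](bigID (mem s0))/=.
have -> : \sum_(x <- s | x \in s0) g x = \sum_(x <- s0) g x.
  rewrite -big_filter; apply: perm_big; apply: uniq_perm => //.
    exact: filter_uniq.
  by move=> x; rewrite mem_filter; case: (boolP (x \in s0)) => // /ss ->.
by rewrite lerDl; apply: sumr_ge0.
Qed.

Definition square_sums f : set R :=
  [set t | exists2 s, uniq s & t = \sum_(x <- s) nm (f x) ^+ 2].

Definition square_summable f := has_ubound (square_sums f).

Definition l2sq f : R := sup (square_sums f).

Lemma square_sums_nonempty f : square_sums f !=set0.
Proof. by exists 0, [::] => //; rewrite big_nil. Qed.

Lemma l2sq_ub f s : square_summable f -> uniq s ->
  \sum_(x <- s) nm (f x) ^+ 2 <= l2sq f.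
Proof. by move=> hf us; apply: ub_le_sup => //; exists s. Qed.

Lemma l2sq_le f (M : R) : (forall s, uniq s -> \sum_(x <- s) nm (f x) ^+ 2 <= M) ->
  square_summable f /\ l2sq f <= M.
Proof.
move=> h; have ub : ubound (square_sums f) M by move=> _ [s us ->]; exact: h.
by split; [exists M|apply: ge_sup => //; exact: square_sums_nonempty].
Qed.

Lemma l2sq_ge0 f : square_summable f -> 0 <= l2sq f.
Proof. by move=> hf; have := l2sq_ub (s := [::]) hf isT; rewrite big_nil. Qed.

Lemma nm_le_l2sq f x : square_summable f -> nm (f x) ^+ 2 <= l2sq f.
Proof. by move=> hf; have := l2sq_ub (s := [:: x]) hf isT; rewrite big_seq1. Qed.

Lemma sums_to_square f : square_summable f ->
  sums_to (fun x => f x * (f x)^*) (l2sq f)%:C%C.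
Proof.
move=> hf e e0.
have [_ [s0 us0 ->] lt] := sup_adherent e0 (conj (square_sums_nonempty f) hf).
exists s0 => s us ss.
have -> : \sum_(x <- s) f x * (f x)^* = (\sum_(x <- s) nm (f x) ^+ 2)%:C%C.
  rewrite rmorph_sum; apply: eq_bigr => x _ /=.
  by rewrite -normCK nmE -rmorphXn.
rewrite -rmorphB nm_real distrC ger0_norm ?subr_ge0; last exact: l2sq_ub.
have := le_sum_subseq (g := fun x => nm (f x) ^+ 2) (fun x => exprn_ge0 _ (nm_ge0 _)) us0 us ss.
rewrite -/(l2sq f) in lt; lra.
Qed.

Lemma nm_sqrD (a b : R[i]) : nm (a + b) ^+ 2 <= 2 * nm a ^+ 2 + 2 * nm b ^+ 2.
Proof.
apply: le_trans (_ : (nm a + nm b) ^+ 2 <= _).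
  by rewrite ler_pXn2r ?nnegrE ?addr_ge0 ?nm_ge0// nmD.
by have := sqr_ge0 (nm a - nm b); nra.
Qed.

Lemma l2sqD f g : square_summable f -> square_summable g ->
  square_summable (fun x => f x + g x) /\
  l2sq (fun x => f x + g x) <= 2 * l2sq f + 2 * l2sq g.
Proof.
move=> hf hg; apply: l2sq_le => s us.
apply: le_trans (_ : \sum_(x <- s) (2 * nm (f x) ^+ 2 + 2 * nm (g x) ^+ 2) <= _).
  by apply: ler_sum => x _; exact: nm_sqrD.
by rewrite big_split /= -!mulr_sumr lerD// ler_pM2l// l2sq_ub.
Qed.

Lemma l2sqZ c f : square_summable f -> square_summable (fun x => c * f x).
Proof.
move=> hf; suff /l2sq_le[] : forall s, uniq s ->
  \sum_(x <- s) nm (c * f x) ^+ 2 <= nm c ^+ 2 * l2sq f by [].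
move=> s us.
under eq_bigr do rewrite nmM exprMn.
by rewrite -mulr_sumr; apply: ler_wpM2l; [exact: exprn_ge0 (nm_ge0 _)|exact: l2sq_ub].
Qed.

(* Polarization expresses f g^* through four square-summable functions. *)
Lemma sums_to_inner f g : square_summable f -> square_summable g ->
  exists l, sums_to (fun x => f x * (g x)^*) l.
Proof.
move=> hf hg.
have S c : exists l, sums_to (fun x => (f x + c * g x) * (f x + c * g x)^*) l.
  have hc := l2sqZ c hg; have [h _] := l2sqD hf hc.
  by eexists; exact: sums_to_square h.
have [l1 h1] := S 1; have [l2 h2] := S (-1).
have [l3 h3] := S 'i; have [l4 h4] := S (- 'i).
have := sums_toD (sums_toD (sums_toZ 4^-1 h1) (sums_toZ (- 4^-1) h2))
  (sums_toD (sums_toZ ('i / 4) h3) (sums_toZ (- ('i / 4)) h4)).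
set l := _ + _.
rewrite [X in sums_to X l -> _](_ : _ = (fun x => f x * (g x)^*)) => [h|]; first by exists l.
apply/funext => x /=.
have E c : (f x + c * g x)^* = (f x)^* + c^* * (g x)^* by rewrite rmorphD rmorphM.
have c1 : (1 : R[i])^* = 1 by exact: conjC1.
have cN1 : (- 1 : R[i])^* = - 1 by exact: rmorphN1.
have ci : ('i : R[i])^* = - 'i by exact: conjCi.
have cNi : (- 'i : R[i])^* = 'i by rewrite -ci conjCK.
rewrite !E c1 cN1 ci cNi.
set a := f x; set b := g x; set a' := a^*; set b' := b^*.
have i2 : 'i * 'i = -1 :> R[i] by rewrite -expr2 sqrCi.
transitivity (2^-1 * (a * b' + b * a') - 2^-1 * ('i * 'i) * (a * b' - b * a')).
  by field.
by rewrite i2; field.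
Qed.

End UnorderedSums.

(** * The Hilbert space l^2(X) *)

Record l2 (R : realType) (X : choiceType) := L2 {
  l2fun :> X -> R[i];
  l2P : `[<square_summable l2fun>] }.

Section L2.
Context {R : realType} {X : choiceType}.

HB.instance Definition _ := [isSub for @l2fun R X].
HB.instance Definition _ := [Choice of l2 R X by <:].

Lemma l2_submod_closed :
  submod_closed (fun f : X -> R[i] => `[<square_summable f>] : bool).
Proof.
split=> [|c f g]; rewrite !unfold_in.
  apply/asboolP; suff /l2sq_le[] : forall s : seq X, uniq s ->
    \sum_(x <- s) nm ((0 : X -> R[i]) x) ^+ 2 <= 0 by [].
  by move=> s _; rewrite big1// => x _; rewrite nm0 expr0n.
move=> /asboolP hf /asboolP hg; apply/asboolP.
by case: (l2sqD (l2sqZ c hf) hg).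
Qed.

HB.instance Definition _ := GRing.SubChoice_isSubLmodule.Build R[i] (X -> R[i])
  (fun f : X -> R[i] => `[<square_summable f>]) (l2 R X) l2_submod_closed.

Implicit Types (f g h : l2 R X) (c : R[i]).

Lemma l2_summable f : square_summable f.
Proof. by case: f => f /= /asboolP. Qed.

Lemma l2_ext f g : (forall x, f x = g x) -> f = g.
Proof. by move=> fg; apply/val_inj/funext. Qed.

Lemma l2DE f g x : (f + g) x = f x + g x. Proof. by []. Qed.
Lemma l2NE f x : (- f) x = - f x. Proof. by []. Qed.
Lemma l2ZE c f x : (c *: f) x = c * f x. Proof. by []. Qed.
Lemma l20E x : (0 : l2 R X) x = 0. Proof. by []. Qed.

(** The product is linear in the first argument. The default of [xget] is never reached, since
    polarization shows that the sum exists. *)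
Definition inner f g : R[i] := xget 0 [set l | sums_to (fun x => f x * (g x)^*) l].

Lemma innerP f g : sums_to (fun x => f x * (g x)^*) (inner f g).
Proof.
have [l hl] := sums_to_inner (l2_summable f) (l2_summable g).
exact: (xgetPex 0 (ex_intro _ l hl)).
Qed.

Lemma inner_eq f g l : sums_to (fun x => f x * (g x)^*) l -> inner f g = l.
Proof. exact: sums_to_unique (innerP f g). Qed.

Lemma innerDl f g h : inner (f + g) h = inner f h + inner g h.
Proof.
apply: inner_eq; have := sums_toD (innerP f h) (innerP g h).
by rewrite [X in sums_to X _ -> _](_ : _ = (fun x => (f + g) x * (h x)^*))//;
  apply/funext => x; rewrite l2DE mulrDl.
Qed.

Lemma innerZl c f g : inner (c *: f) g = c * inner f g.
Proof.
apply: inner_eq; have := sums_toZ c (innerP f g).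
by rewrite [X in sums_to X _ -> _](_ : _ = (fun x => (c *: f) x * (g x)^*))//;
  apply/funext => x; rewrite l2ZE mulrA.
Qed.

Lemma inner_conj f g : inner g f = (inner f g)^*.
Proof.
apply: inner_eq; have := sums_to_conj (innerP f g).
by rewrite [X in sums_to X _ -> _](_ : _ = (fun x => g x * (f x)^*))//;
  apply/funext => x; rewrite rmorphM/= conjCK mulrC.
Qed.

Lemma innerDr f g h : inner f (g + h) = inner f g + inner f h.
Proof. by rewrite inner_conj innerDl rmorphD/= -!inner_conj. Qed.

Lemma innerZr c f g : inner f (c *: g) = c^* * inner f g.
Proof. by rewrite inner_conj innerZl rmorphM/= -inner_conj. Qed.

Definition n2 f : R := l2sq f.

Lemma inner_self f : inner f f = (n2 f)%:C%C.
Proof. by apply: inner_eq; exact: sums_to_square (l2_summable f). Qed.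

Lemma n2_ge0 f : 0 <= n2 f. Proof. exact: l2sq_ge0 (l2_summable f). Qed.

Lemma nm_coord f x : nm (f x) ^+ 2 <= n2 f.
Proof. exact: nm_le_l2sq (l2_summable f). Qed.

Lemma n2_eq0 f : n2 f = 0 -> f = 0.
Proof.
move=> f0; apply: l2_ext => x; rewrite l20E; apply: nm_eq0.
have := nm_coord f x; rewrite f0 => h; apply/eqP; rewrite -sqrf_eq0 eq_le h.
by rewrite exprn_ge0 ?nm_ge0.
Qed.

Lemma n2_0 : n2 0 = 0.
Proof.
apply: complexI; rewrite -inner_self -(scale0r (0 : l2 R X)) innerZl mul0r.
by rewrite rmorph0.
Qed.

Lemma n2Z c f : n2 (c *: f) = nm c ^+ 2 * n2 f.
Proof.
apply: complexI; rewrite -inner_self innerZl innerZr inner_self mulrA -normCK.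
by rewrite nmE -rmorphXn -rmorphM.
Qed.

Lemma cauchy_schwarz f g : nm (inner f g) ^+ 2 <= n2 f * n2 g.
Proof.
have [g0|g0] := eqVneq (n2 g) 0.
  rewrite (n2_eq0 g0) -(scale0r (0 : l2 R X)) innerZr conjC0 mul0r nm0 expr0n/=.
  by rewrite mulr_ge0 ?n2_ge0.
have gp : 0 < n2 g by rewrite lt_def g0 n2_ge0.
pose c := inner f g / (n2 g)%:C%C.
have cc : c^* = (inner f g)^* / (n2 g)%:C%C.
  rewrite /c rmorphM/= fmorphV/=; congr (_ / _).
  by rewrite -[LHS]/(conjc _) conjc_real.
have gC0 : (n2 g)%:C%C != 0 by rewrite -(rmorph0 (real_complex R)) (inj_eq (@complexI R)).
have : 0 <= n2 (f - c *: g) by exact: n2_ge0.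
rewrite -ler0c -inner_self -scaleNr innerDl !innerDr !innerZl !innerZr !inner_self.
rewrite rmorphN /= cc (inner_conj f g).
have -> : (n2 f)%:C%C + - ((inner f g)^* / (n2 g)%:C%C) * inner f g +
   (- c * (inner f g)^* + - c * (- ((inner f g)^* / (n2 g)%:C%C) * (n2 g)%:C%C)) =
   (n2 f)%:C%C - (inner f g * (inner f g)^*) / (n2 g)%:C%C.
  by rewrite /c; field.
rewrite -normCK nmE -rmorphXn -fmorphV -rmorphM -rmorphB ler0c subr_ge0.
by rewrite ler_pdivrMr.
Qed.

Definition nh f : R := Num.sqrt (n2 f).

Lemma nh_ge0 f : 0 <= nh f. Proof. exact: sqrtr_ge0. Qed.

Lemma nh_sqr f : nh f ^+ 2 = n2 f. Proof. by rewrite sqr_sqrtr ?n2_ge0. Qed.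

Lemma nm_inner f g : nm (inner f g) <= nh f * nh g.
Proof.
rewrite -(@ler_pXn2r _ 2) ?nnegrE ?mulr_ge0 ?nh_ge0 ?nm_ge0//.
by rewrite exprMn !nh_sqr cauchy_schwarz.
Qed.

Lemma nhZ c f : nh (c *: f) = nm c * nh f.
Proof. by rewrite /nh n2Z sqrtrM ?exprn_ge0 ?nm_ge0// sqrtr_sqr ger0_norm ?nm_ge0. Qed.

Lemma nh_eq0 f : nh f = 0 -> f = 0.
Proof. by move=> h; apply: n2_eq0; rewrite -nh_sqr h expr0n. Qed.

Lemma nh0 : nh 0 = 0. Proof. by rewrite /nh n2_0 sqrtr0. Qed.

Lemma nhD f g : nh (f + g) <= nh f + nh g.
Proof.
rewrite -(@ler_pXn2r _ 2) ?nnegrE ?addr_ge0 ?nh_ge0// nh_sqr.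
have E : (n2 (f + g))%:C%C = (n2 f + n2 g)%:C%C + (inner f g + inner g f).
  rewrite -inner_self innerDl !innerDr !inner_self rmorphD/=.
  by rewrite -!addrA; congr (_ + _); rewrite addrC -addrA addrC addrA.
have : nm (n2 (f + g))%:C%C <= n2 f + n2 g + 2 * (nh f * nh g).
  rewrite E; apply: le_trans (nmD _ _) _.
  rewrite nm_real ger0_norm ?addr_ge0 ?n2_ge0// lerD2l.
  apply: le_trans (nmD _ _) _.
  by have := nm_inner f g; have := nm_inner g f; rewrite (mulrC (nh g)); lra.
by rewrite nm_real ger0_norm ?n2_ge0// sqrrD !nh_sqr -mulr_natl; lra.
Qed.

Lemma nm_coord_nh f x : nm (f x) <= nh f.
Proof.
by rewrite -(@ler_pXn2r _ 2) ?nnegrE ?nh_ge0 ?nm_ge0// nh_sqr nm_coord.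
Qed.

Lemma real_cauchy (u : nat -> R) :
  (forall e : R, 0 < e -> exists N, forall m n, (N <= m)%N -> (N <= n)%N ->
    `|u m - u n| <= e) ->
  exists l : R, forall e : R, 0 < e -> exists N, forall n, (N <= n)%N ->
    `|l - u n| <= e.
Proof.
move=> h.
have : cauchy (u @ \oo).
  apply/cauchy_ballP => e e0.
  have [|N hN] := h (e / 2); first by rewrite divr_gt0.
  exists (u @` [set n | (N <= n)%N], u @` [set n | (N <= n)%N]).
    by split; exists N => // n /= Nn; exists n.
  move=> [_ _] [[m Nm <-] [n Nn <-]] /=.
  by rewrite -ball_normE /ball_/=; apply: le_lt_trans (hN _ _ Nm Nn) _; lra.
move=> /cauchy_cvg /cvg_ex [l ul]; exists l => e e0.
by have /cvgrPdist_le /(_ _ e0) [N _ hN] := ul; exists N.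
Qed.

Lemma nm_Re_le (z : R[i]) : `|complex.Re z| <= nm z.
Proof. by have := normc_ge_Re z; rewrite nmE lecR. Qed.

Lemma nm_Im_le (z : R[i]) : `|complex.Im z| <= nm z.
Proof.
by have := nm_Re_le (z * 'i%C); rewrite ReiNIm normrN nmM complexiE nmi mulr1.
Qed.

Lemma nm_le_ReIm (z : R[i]) : nm z <= `|complex.Re z| + `|complex.Im z|.
Proof.
rewrite {1}(complexE z); apply: le_trans (nmD _ _) _.
by rewrite nmM complexiE nmi mul1r !nm_real.
Qed.

Lemma complex_cauchy (u : nat -> R[i]) :
  (forall e : R, 0 < e -> exists N, forall m n, (N <= m)%N -> (N <= n)%N ->
    nm (u m - u n) <= e) ->
  exists l : R[i], forall e : R, 0 < e -> exists N, forall n, (N <= n)%N ->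
    nm (l - u n) <= e.
Proof.
move=> h.
have ReB (a b : R[i]) : complex.Re a - complex.Re b = complex.Re (a - b) by case: a b => ? ? [].
have ImB (a b : R[i]) : complex.Im a - complex.Im b = complex.Im (a - b) by case: a b => ? ? [].
have [|a ha] := @real_cauchy (fun n => complex.Re (u n)).
  move=> e /h [N hN]; exists N => m n Nm Nn; rewrite ReB.
  exact: le_trans (nm_Re_le _) (hN _ _ Nm Nn).
have [|b hb] := @real_cauchy (fun n => complex.Im (u n)).
  move=> e /h [N hN]; exists N => m n Nm Nn; rewrite ImB.
  exact: le_trans (nm_Im_le _) (hN _ _ Nm Nn).
exists (Complex a b) => e e0; have e2 : 0 < e / 2 by rewrite divr_gt0.
have [N1 h1] := ha _ e2; have [N2 h2] := hb _ e2.
exists (maxn N1 N2) => n; rewrite geq_max => /andP[n1 n2_].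
apply: le_trans (nm_le_ReIm _) _; rewrite -ReB -ImB /=.
by have := h1 _ n1; have := h2 _ n2_; lra.
Qed.

(** The limit is formed coordinatewise. The Cauchy estimate is then passed to the limit on one
    finite set of coordinates at a time, where convergence is uniform. *)
Lemma l2_complete (u : nat -> l2 R X) :
  (forall e : R, 0 < e -> exists N, forall m n, (N <= m)%N -> (N <= n)%N ->
    nh (u m - u n) <= e) ->
  exists l : l2 R X, forall e : R, 0 < e -> exists N, forall n, (N <= n)%N ->
    nh (l - u n) <= e.
Proof.
move=> h.
have hx x : exists l : R[i], forall e : R, 0 < e -> exists N, forall n, (N <= n)%N ->
    nm (l - u n x) <= e.
  apply: complex_cauchy => e /h [N hN]; exists N => m n Nm Nn.
  exact: le_trans (nm_coord_nh (u m - u n) x) (hN _ _ Nm Nn).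
have [f hf] := choice hx.
have bnd (e : R) : 0 < e -> exists N, forall n, (N <= n)%N -> forall s, uniq s ->
    \sum_(x <- s) nm (f x - u n x) ^+ 2 <= e ^+ 2.
  move=> e0; have e2 : 0 < e / 2 by rewrite divr_gt0.
  have [N hN] := h _ e2; exists N => n Nn s us.
  apply/ler_addgt0Pr => d d0.
  pose k : R := 2 * (size s).+1%:R; have k0 : 0 < k by rewrite mulr_gt0.
  (* Here t is the error allowed in each coordinate of s; with the factor 2 from [nm_sqrD] it costs
     at most d altogether. *)
  have [t t0 tk] : exists2 t : R, 0 < t & t ^+ 2 * k <= d.
    exists (Num.sqrt (d / k)); first by rewrite sqrtr_gt0 divr_gt0.
    by rewrite sqr_sqrtr ?divr_ge0 ?(ltW d0) ?(ltW k0)// -mulrA mulVf ?mulr1 ?gt_eqF.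
  have [m Nm mx] : exists2 m, (N <= m)%N &
      forall n, (m <= n)%N -> forall x, x \in s -> nm (f x - u n x) <= t.
    elim: (s) => [|x s' [m Nm IH]]; first by exists N.
    have [N' hN'] := hf x t t0; exists (maxn m N').
      by rewrite leq_max Nm.
    move=> n'; rewrite geq_max => /andP[mn' Nn'] y.
    by rewrite inE => /orP[/eqP ->|]; [exact: hN'|exact: IH].
  apply: le_trans (_ : \sum_(x <- s) (2 * t ^+ 2 + 2 * nm ((u m - u n) x) ^+ 2) <= _).
    rewrite !big_seq; apply: ler_sum => x xs.
    have -> : f x - u n x = (f x - u m x) + (u m - u n) x.
      by rewrite l2DE l2NE addrA subrK.
    apply: le_trans (nm_sqrD _ _) _; rewrite lerD2r ler_pM2l//.
    by rewrite ler_pXn2r ?nnegrE ?nm_ge0 ?(ltW t0)//; exact: mx.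
  rewrite big_split /= -mulr_sumr big_const_seq count_predT iter_addr_0.
  have le1 : 2 * (t ^+ 2 *+ size s) <= d.
    apply: le_trans tk; rewrite -(mulr_natr (t ^+ 2)) /k [leRHS]mulrCA ler_pM2l//.
    by apply: ler_wpM2l; rewrite ?mulr_ge0 ?exprn_ge0 ?(ltW t0)// ler_nat.
  have le2 : \sum_(x <- s) nm ((u m - u n) x) ^+ 2 <= (e / 2) ^+ 2.
    apply: le_trans (l2sq_ub (l2_summable (u m - u n)) us) _.
    rewrite -/(n2 _) -nh_sqr ler_pXn2r ?nnegrE ?nh_ge0 ?(ltW e2)//.
    exact: hN.
  have e4 : (e / 2) ^+ 2 = e ^+ 2 / 4 by field.
  rewrite -mulr_sumr; apply: le_trans (lerD le1 (ler_wpM2l _ le2)) _ => //.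
  by rewrite e4; have := exprn_ge0 2 (ltW e0); lra.
have [N0 h0] := bnd 1 ltr01.
have hg : square_summable (fun x => f x - u N0 x).
  suff /l2sq_le[] : forall s : seq X, uniq s ->
    \sum_(x <- s) nm (f x - u N0 x) ^+ 2 <= 1 ^+ 2 by [].
  exact: h0.
(* The bound makes f - u N0 square-summable; adding u N0 back inside l^2 recovers f. *)
pose F := L2 (asboolT hg) + u N0.
have FE x : F x = f x by rewrite /F l2DE /= subrK.
exists F => e /[dup] e0 /bnd [N hN]; exists N => n Nn.
rewrite -(@ler_pXn2r _ 2) ?nnegrE ?nh_ge0 ?(ltW e0)// nh_sqr.
suff /l2sq_le[] : forall s : seq X, uniq s ->
  \sum_(x <- s) nm ((F - u n) x) ^+ 2 <= e ^+ 2 by [].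
move=> s us; under eq_bigr do rewrite l2DE l2NE FE.
exact: hN.
Qed.

End L2.

(** Asking for an adjoint map outright avoids the Riesz theorem, and linearity follows from the
    adjoint identity ([bopD], [bopZ]). *)
Definition adjointable {R : realType} {X : choiceType} (T : l2 R X -> l2 R X) :=
  (exists T' : l2 R X -> l2 R X, forall f g, inner (T f) g = inner f (T' g)) /\
  (exists M : R, forall f, nh (T f) <= M * nh f).

Record bop (R : realType) (X : choiceType) := Bop {
  bfun :> l2 R X -> l2 R X;
  bopP : `[<adjointable bfun>] }.

(** * The C*-algebra structure on the bounded operators *)

Section BoundedOperators.
Context {R : realType} {X : choiceType}.

HB.instance Definition _ := [isSub for @bfun R X].
HB.instance Definition _ := [Choice of bop R X by <:].

Lemma inner0l (g : l2 R X) : inner 0 g = 0.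
Proof. by rewrite -(scale0r (0 : l2 R X)) innerZl mul0r. Qed.

Lemma inner0r (g : l2 R X) : inner g 0 = 0.
Proof. by rewrite -(scale0r (0 : l2 R X)) innerZr conjC0 mul0r. Qed.

Lemma innerBl (f g h : l2 R X) : inner (f - g) h = inner f h - inner g h.
Proof. by rewrite innerDl -scaleN1r innerZl mulN1r. Qed.

Lemma innerBr (f g h : l2 R X) : inner f (g - h) = inner f g - inner f h.
Proof. by rewrite inner_conj innerBl rmorphB/= -!inner_conj. Qed.

Lemma bop_submod_closed :
  submod_closed (fun T : l2 R X -> l2 R X => `[<adjointable T>] : bool).
Proof.
split=> [|c S T]; rewrite !unfold_in.
  apply/asboolP; split; first by exists (fun=> 0) => f g; rewrite inner0l inner0r.
  by exists 0 => f; rewrite nh0 mul0r.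
move=> /asboolP[[S' hS] [M hM]] /asboolP[[T' hT] [N hN]]; apply/asboolP; split.
  exists (fun g => c^* *: S' g + T' g) => f g.
  by rewrite innerDl innerZl hS hT innerDr innerZr conjCK.
exists (nm c * M + N) => f; apply: le_trans (nhD _ _) _; rewrite nhZ mulrDl lerD//.
by rewrite -mulrA ler_wpM2l ?nm_ge0.
Qed.

HB.instance Definition _ := GRing.SubChoice_isSubLmodule.Build R[i]
  (l2 R X -> l2 R X) (fun T : l2 R X -> l2 R X => `[<adjointable T>]) (bop R X)
  bop_submod_closed.

Implicit Types (S T : bop R X) (f g h : l2 R X) (c : R[i]).

Lemma bopDE S T f : (S + T) f = S f + T f. Proof. by []. Qed.
Lemma bopNE T f : (- T) f = - T f. Proof. by []. Qed.
Lemma bopZE c T f : (c *: T) f = c *: T f. Proof. by []. Qed.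

Lemma bop_ext S T : (forall f, S f = T f) -> S = T.
Proof. by move=> ST; apply/val_inj/funext. Qed.

Lemma inner_inj f g : (forall h, inner h f = inner h g) -> f = g.
Proof.
move=> hfg; apply/eqP; rewrite -subr_eq0; apply/eqP/n2_eq0/complexI.
have := hfg (f - g); move=> /eqP; rewrite -subr_eq0 => /eqP.
by rewrite -inner_self innerBr.
Qed.

Lemma inner_injl f g : (forall h, inner f h = inner g h) -> f = g.
Proof. by move=> hfg; apply: inner_inj => h; rewrite inner_conj hfg -inner_conj. Qed.

Lemma bop_bounded T : exists2 M : R, 0 <= M & forall f, nh (T f) <= M * nh f.
Proof.
case: T => T /= /asboolP[_ [M hM]]; exists `|M| => // f.
by apply: le_trans (hM f) _; rewrite ler_wpM2r ?nh_ge0// ler_norm.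
Qed.

Lemma adj_exists T : exists T', forall f g, inner (T f) g = inner f (bfun T' g).
Proof.
have [M M0 hM] := bop_bounded T; have /asboolP[[T' hT'] _] := bopP T.
have adjT' : adjointable T'.
  split; first by exists T => f g; rewrite inner_conj -hT' -inner_conj.
  exists M => g.
  have [->|n0] := eqVneq (nh (T' g)) 0; first by rewrite mulr_ge0 ?nh_ge0.
  have np : 0 < nh (T' g) by rewrite lt_def n0 nh_ge0.
  rewrite -(ler_pM2l np) -expr2 nh_sqr.
  have : nm (inner (T' g) (T' g)) = n2 (T' g).
    by rewrite inner_self nm_real ger0_norm ?n2_ge0.
  rewrite -hT' => <-; apply: le_trans (nm_inner _ _) _.
  by rewrite mulrA (mulrC _ M) ler_wpM2r ?nh_ge0.
by exists (Bop (asboolT adjT')) => f g.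
Qed.

Definition adj T : bop R X := projT1 (cid (adj_exists T)).

Lemma adjP T f g : inner (T f) g = inner f (adj T g).
Proof. exact: (projT2 (cid (adj_exists T))). Qed.

Lemma adjPr T f g : inner f (T g) = inner (adj T f) g.
Proof. by rewrite inner_conj adjP -inner_conj. Qed.

Lemma adj_unique T S : (forall f g, inner (T f) g = inner f (S g)) -> adj T = S.
Proof. by move=> h; apply: bop_ext => g; apply: inner_inj => f; rewrite -adjP h. Qed.

Lemma bopD T f g : T (f + g) = T f + T g.
Proof. by apply: inner_injl => h; rewrite innerDl !adjP innerDl. Qed.

Lemma bopZ T c f : T (c *: f) = c *: T f.
Proof. by apply: inner_injl => h; rewrite innerZl !adjP innerZl. Qed.

Definition bounds T : set R := [set M | 0 <= M /\ forall f, nh (T f) <= M * nh f].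

Definition opn T : R := inf (bounds T).

Lemma bounds_lb T : has_lbound (bounds T).
Proof. by exists 0 => M []. Qed.

Lemma bounds_neq0 T : bounds T !=set0.
Proof. by have [M M0 hM] := bop_bounded T; exists M. Qed.

Lemma opn_ge0 T : 0 <= opn T.
Proof. by apply: lb_le_inf; [exact: bounds_neq0|move=> M []]. Qed.

Lemma opn_le T (M : R) : 0 <= M -> (forall f, nh (T f) <= M * nh f) -> opn T <= M.
Proof. by move=> M0 hM; apply: ge_inf; [exact: bounds_lb|]. Qed.

Lemma nh_opn T f : nh (T f) <= opn T * nh f.
Proof.
have [f0|f0] := eqVneq (nh f) 0.
  by rewrite f0 mulr0; have [M _ /(_ f)] := bop_bounded T; rewrite f0 mulr0.
have fp : 0 < nh f by rewrite lt_def f0 nh_ge0.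
rewrite -ler_pdivrMr//; apply: lb_le_inf; first exact: bounds_neq0.
by move=> M [_ /(_ f)]; rewrite ler_pdivrMr.
Qed.

Lemma opnD S T : opn (S + T) <= opn S + opn T.
Proof.
apply: opn_le; first by rewrite addr_ge0 ?opn_ge0.
move=> f; rewrite bopDE mulrDl; apply: le_trans (nhD _ _) _.
by rewrite lerD ?nh_opn.
Qed.

Lemma opnZ c T : opn (c *: T) = nm c * opn T.
Proof.
have le d S : opn (d *: S) <= nm d * opn S.
  apply: opn_le; first by rewrite mulr_ge0 ?nm_ge0 ?opn_ge0.
  by move=> f; rewrite bopZE nhZ -mulrA ler_wpM2l ?nm_ge0 ?nh_opn.
apply/eqP; rewrite eq_le le/=; have [->|c0] := eqVneq c 0.
  by rewrite nm0 mul0r opn_ge0.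
have cp : 0 < nm c by rewrite lt_def nm_ge0 andbT; apply: contra c0 => /eqP/nm_eq0->.
rewrite -ler_pdivlMl//; have := le c^-1 (c *: T).
rewrite scalerA mulVf// scale1r.
have -> // : nm c^-1 = (nm c)^-1.
by apply: (mulfI (lt0r_neq0 cp)); rewrite -nmM mulfV// nm1 mulfV// lt0r_neq0.
Qed.

Lemma opnN T : opn (- T) = opn T.
Proof. by rewrite -scaleN1r opnZ nmN nm1 mul1r. Qed.

Lemma opn_eq0 T : opn T = 0 -> T = 0.
Proof.
move=> T0; apply: bop_ext => f; apply: nh_eq0; apply/eqP.
by rewrite eq_le nh_ge0 andbT; have := nh_opn T f; rewrite T0 mul0r.
Qed.

Let cnorm T : R[i] := (opn T)%:C%C.

Let cnormD S T : cnorm (S + T) <= cnorm S + cnorm T.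
Proof. by rewrite /cnorm -rmorphD lecR opnD. Qed.

Let cnormZ c T : cnorm (c *: T) = `|c| * cnorm T.
Proof. by rewrite /cnorm opnZ nmE -rmorphM. Qed.

Let cnorm_eq0 T : cnorm T = 0 -> T = 0.
Proof. by move=> /complexI/opn_eq0. Qed.

HB.instance Definition _ := Lmodule_isNormed.Build R[i] (bop R X)
  cnormD cnormZ cnorm_eq0.

Lemma adjD S T : adj (S + T) = adj S + adj T.
Proof. by apply: adj_unique => f g; rewrite !bopDE innerDl innerDr !adjP. Qed.

Lemma adjZ c T : adj (c *: T) = c^* *: adj T.
Proof. by apply: adj_unique => f g; rewrite !bopZE innerZl innerZr conjCK adjP. Qed.

Lemma adjB S T : adj (S - T) = adj S - adj T.
Proof. by rewrite -scaleN1r adjD adjZ rmorphN1 scaleN1r. Qed.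

Lemma adjK : involutive adj.
Proof. by move=> T; apply: adj_unique => f g; rewrite -adjPr. Qed.

Lemma opn_adj T : opn (adj T) = opn T.
Proof.
have le S : opn (adj S) <= opn S.
  apply: opn_le; first exact: opn_ge0.
  move=> g; have [->|n0] := eqVneq (nh (adj S g)) 0.
    by rewrite mulr_ge0 ?opn_ge0 ?nh_ge0.
  have np : 0 < nh (adj S g) by rewrite lt_def n0 nh_ge0.
  rewrite -(ler_pM2l np) -expr2 nh_sqr.
  have : nm (inner (adj S g) (adj S g)) = n2 (adj S g).
    by rewrite inner_self nm_real ger0_norm ?n2_ge0.
  rewrite -adjP => <-; apply: le_trans (nm_inner _ _) _.
  by rewrite mulrA (mulrC _ (opn S)) ler_wpM2r ?nh_ge0 ?nh_opn.
by apply/eqP; rewrite eq_le le /= -{1}(adjK T) le.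
Qed.

Lemma comp_adjointable S T : adjointable (fun f => S (T f)).
Proof.
split; first by exists (fun g => adj T (adj S g)) => f g; rewrite !adjP.
exists (opn S * opn T) => f; apply: le_trans (nh_opn _ _) _.
by rewrite -mulrA ler_wpM2l ?opn_ge0 ?nh_opn.
Qed.

Definition comp S T : bop R X := Bop (asboolT (comp_adjointable S T)).

Lemma compE S T f : comp S T f = S (T f). Proof. by []. Qed.

Lemma opn_comp S T : opn (comp S T) <= opn S * opn T.
Proof.
apply: opn_le; first by rewrite mulr_ge0 ?opn_ge0.
move=> f; apply: le_trans (nh_opn S (T f)) _.
by rewrite -mulrA ler_wpM2l ?opn_ge0 ?nh_opn.
Qed.

Lemma opn_adj_comp T : opn (comp (adj T) T) = opn T ^+ 2.
Proof.
apply/eqP; rewrite eq_le; apply/andP; split.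
  by apply: le_trans (opn_comp _ _) _; rewrite opn_adj.
set M := opn (comp _ _); have M0 : 0 <= M by exact: opn_ge0.
suff le : opn T <= Num.sqrt M.
  by rewrite -(sqr_sqrtr M0) ler_pXn2r ?nnegrE ?opn_ge0 ?sqrtr_ge0.
apply: opn_le; first exact: sqrtr_ge0.
move=> f; rewrite -(@ler_pXn2r _ 2) ?nnegrE ?mulr_ge0 ?nh_ge0 ?sqrtr_ge0//.
rewrite nh_sqr exprMn (sqr_sqrtr M0).
have <- : nm (inner (T f) (T f)) = n2 (T f).
  by rewrite inner_self nm_real ger0_norm ?n2_ge0.
rewrite adjP; apply: le_trans (nm_inner _ _) _; rewrite expr2 mulrCA ler_wpM2l ?nh_ge0//.
exact: (nh_opn (comp (adj T) T)).
Qed.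

Lemma bop_cauchy_seq (u : nat -> bop R X) :
  (forall e : R, 0 < e -> exists N, forall m n, (N <= m)%N -> (N <= n)%N ->
    opn (u m - u n) <= e) ->
  exists l : bop R X, forall e : R, 0 < e -> exists N, forall n, (N <= n)%N ->
    opn (l - u n) <= e.
Proof.
move=> hu.
have limits (v : nat -> bop R X) : (forall e : R, 0 < e -> exists N, forall m n,
    (N <= m)%N -> (N <= n)%N -> opn (v m - v n) <= e) ->
  exists T : l2 R X -> l2 R X, forall e : R, 0 < e -> exists N, forall n, (N <= n)%N ->
    forall f, nh (T f - v n f) <= e * nh f.
  move=> hv.
  have hf f : exists g, forall e : R, 0 < e -> exists N, forall n, (N <= n)%N ->
      nh (g - v n f) <= e.
    apply: l2_complete => e e0; have f0 : 0 < nh f + 1 by rewrite ltr_wpDl ?nh_ge0.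
    have [N hN] := hv _ (divr_gt0 e0 f0); exists N => m n Nm Nn.
    have := hN m n Nm Nn; rewrite ler_pdivlMr// => le.
    have := nh_opn (v m - v n) f; have := opn_ge0 (v m - v n).
    by have := nh_ge0 f; rewrite bopDE bopNE; nra.
  have [T hT] := choice hf; exists T => e /hv [N hN]; exists N => n Nn f.
  apply/ler_addgt0Pr => d d0; have [N' hN'] := hT f d d0.
  have := hN' (maxn N N') (leq_maxr _ _).
  have := hN (maxn N N') n (leq_maxl _ _) Nn.
  have := nh_opn (v (maxn N N') - v n) f; rewrite bopDE bopNE => l1 l2_ l3.
  have -> : T f - v n f = (T f - v (maxn N N') f) + (v (maxn N N') f - v n f).
    by rewrite addrA subrK.
  apply: le_trans (nhD _ _) _.
  have := ler_wpM2r (nh_ge0 f) l2_; lra.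
have [T hT] := limits u hu.
(* Taking adjoints is isometric, so the adjoints converge as well, and their limit is an adjoint of
   T. *)
have [|T' hT'] := limits (fun n => adj (u n)).
  move=> e /hu [N hN]; exists N => m n Nm Nn.
  by rewrite -adjB opn_adj; exact: hN.
have aT : adjointable T.
  split.
    exists T' => f g; apply/eqP; rewrite -subr_eq0; apply/eqP/nm_eq0/small_eq0.
      exact: nm_ge0.
    move=> e e0; pose k := 2 * (nh f * nh g) + 1.
    have k0 : 0 < k by rewrite ltr_wpDl// mulr_ge0// mulr_ge0 ?nh_ge0.
    have [N1 h1] := hT _ (divr_gt0 e0 k0); have [N2 h2] := hT' _ (divr_gt0 e0 k0).
    pose n := maxn N1 N2.
    have := h1 n (leq_maxl _ _) f; have := h2 n (leq_maxr _ _) g => b1 b2.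
    have -> : inner (T f) g - inner f (T' g) =
        inner (T f - u n f) g - inner f (T' g - adj (u n) g).
      by rewrite innerBl innerBr -adjP opprB addrA subrK.
    apply: le_trans (nmD _ _) _; rewrite nmN.
    have := nm_inner (T f - u n f) g; have := nm_inner f (T' g - adj (u n) g).
    have := ler_wpM2r (nh_ge0 g) b2; have := ler_wpM2l (nh_ge0 f) b1.
    have ek : e / k * k = e by rewrite divfK// gt_eqF.
    have ek0 : 0 <= e / k by rewrite divr_ge0 ?ltW.
    move: ek ek0; rewrite {2}/k; set d := e / k; move: (d) => {}d; lra.
  have [N /(_ N (leqnn _)) hN] := hT 1 ltr01; exists (1 + opn (u N)) => f.
  have -> : T f = (T f - u N f) + u N f by rewrite subrK.
  by apply: le_trans (nhD _ _) _; rewrite mulrDl lerD ?nh_opn.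
exists (Bop (asboolT aT)) => e /[dup] e0 /hT [N hN]; exists N => n Nn.
by apply: opn_le; [exact: ltW|move=> f; exact: hN].
Qed.

(** The filter contains a ball of radius 2^-n for every n. The centres form a Cauchy sequence, whose
    limit is also the limit of the filter. *)
Lemma bop_complete (F : set_system (bop R X)) : ProperFilter F -> cauchy F -> cvg F.
Proof.
move=> FF /cauchyP Fc.
have cn n : exists T : bop R X, F (ball T ((2^-1) ^+ n)%:C%C).
  by apply: Fc; rewrite ltcR exprn_gt0// invr_gt0.
have [u hu] := choice cn.
have half e : 0 < e -> exists N, (2^-1 : R) ^+ N <= e.
  by apply: expr_small; [rewrite invr_ge0|rewrite invf_lt1// ltr1n].
have anti m n : (m <= n)%N -> (2^-1 : R) ^+ n <= (2^-1) ^+ m.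
  by move=> mn; apply: ler_wiXn2l => //; rewrite ?invr_ge0 ?invf_le1// ler1n.
have uu m n : opn (u m - u n) <= (2^-1) ^+ m + (2^-1) ^+ n.
  have [T [/ball_nmP h1 /ball_nmP h2]] := filter_ex (filterI (hu m) (hu n)).
  have -> : u m - u n = (u m - T) - (u n - T) by rewrite opprB addrA subrK.
  apply: le_trans (opnD _ _) _; rewrite opnN.
  by apply: lerD; exact: ltW.
have [|l hl] := @bop_cauchy_seq u.
  move=> e e0; have [N hN] := half _ (divr_gt0 e0 (ltr0n R 2)).
  exists N => m n Nm Nn; apply: le_trans (uu m n) _.
  by have := anti _ _ Nm; have := anti _ _ Nn; lra.
apply/cvg_ex; exists l; apply/cvg_ballP => e e0.
have eE : e = (complex.Re e)%:C%C by rewrite RRe_real ?gtr0_real.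
have e'0 : 0 < complex.Re e by move: e0; rewrite ltcE => /andP[].
have e3 : 0 < complex.Re e / 3 by rewrite divr_gt0.
have [N1 h1] := half _ e3; have [N2 h2] := hl _ e3.
pose n := maxn N1 N2; have := hu n; apply: filterS => T /ball_nmP uT.
rewrite eE; apply/ball_nmP.
have -> : l - T = (l - u n) + (u n - T) by rewrite addrA subrK.
apply: le_lt_trans (opnD _ _) _.
have := h2 n (leq_maxr _ _); have := anti _ _ (leq_maxl N1 N2 : (N1 <= n)%N); lra.
Qed.

HB.instance Definition _ := Uniform_isComplete.Build (bop R X) bop_complete.

Let compA : associative comp. Proof. by move=> S T U; exact: bop_ext. Qed.
Let compDl : left_distributive comp +%R. Proof. by move=> S T U; exact: bop_ext. Qed.
Let compDr : right_distributive comp +%R.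
Proof. by move=> S T U; apply: bop_ext => f; rewrite !(compE, bopDE) bopD. Qed.
Let compZl c S T : comp (c *: S) T = c *: comp S T. Proof. exact: bop_ext. Qed.
Let compZr c S T : comp S (c *: T) = c *: comp S T.
Proof. by apply: bop_ext => f; rewrite !(compE, bopZE) bopZ. Qed.
Let adj_comp S T : adj (comp S T) = comp (adj T) (adj S).
Proof. by apply: adj_unique => f g; rewrite !compE !adjP. Qed.
Let norm_comp S T : `|comp S T| <= `|S| * `|T|.
Proof. by rewrite !nmE -rmorphM lecR; exact: opn_comp. Qed.
Let norm_adj_comp T : `|comp (adj T) T| = `|T| ^+ 2.
Proof. by rewrite !nmE -rmorphXn; congr (_%:C%C); exact: opn_adj_comp. Qed.

HB.instance Definition _ := isCStarAlgebra.Build R (bop R X)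
  compA compDl compDr compZl compZr adjK adjD adjZ adj_comp norm_comp norm_adj_comp.

End BoundedOperators.

(** * A representation with nonzero vertex projections *)

Section PartialBijections.
Context {R : realType} {X : choiceType}.
Implicit Types (s t : seq X) (f g : l2 R X).

Definition partial_bijection (psi phi : X -> option X) :=
  forall x y, psi y = Some x <-> phi x = Some y.

Lemma partial_bijectionC psi phi : partial_bijection psi phi -> partial_bijection phi psi.
Proof. by move=> h x y; split=> /h. Qed.

Lemma pmap_partial_uniq psi phi t : partial_bijection psi phi -> uniq t -> uniq (pmap psi t).
Proof.
move=> h; elim: t => [//|y t IH] /= /andP[yt ut].
case E : (psi y) => [x|] /=; last exact: IH.
rewrite IH// andbT mem_pmap; apply: contra yt => /mapP[y' y't /esym /h E'].
by move/h: E; rewrite E' => -[<-].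
Qed.

(** Composition with a partial bijection, extended by zero, is a partial isometry of l^2 whose
    adjoint is composition with the inverse. *)
Definition pull (psi : X -> option X) (f : X -> R[i]) (y : X) : R[i] := oapp f 0 (psi y).

Lemma pull_sums_to psi phi (f : X -> R[i]) l : partial_bijection psi phi ->
  (forall x, phi x = None -> f x = 0) -> sums_to f l -> sums_to (pull psi f) l.
Proof.
move=> h f0 fl e /fl [s0 hs0]; exists (pmap phi s0) => t ut st.
(* The added points of s0 lie outside the domain of phi, where f vanishes; they make s contain
   s0. *)
pose s := pmap psi t ++ [seq x <- undup s0 | x \notin pmap psi t].
have -> : \sum_(y <- t) pull psi f y = \sum_(x <- s) f x.
  rewrite big_cat /= big_pmap [X in _ + X]big1_seq ?addr0// => x /= xs.
  move: xs; rewrite mem_filter mem_undup => /andP[xt xs0]; apply: f0.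
  case E : (phi x) => [y|//]; case/negP: xt.
  rewrite mem_pmap; apply/mapP; exists y; last by apply/esym/h.
  by apply: st; rewrite mem_pmap; apply/mapP; exists x.
apply: hs0.
  rewrite cat_uniq (pmap_partial_uniq h ut) filter_uniq ?undup_uniq// andbT.
  by apply/hasPn => x; rewrite mem_filter => /andP[].
move=> x xs0; rewrite mem_cat mem_filter mem_undup xs0 andbT.
by case: (x \in pmap psi t).
Qed.

Lemma pull_square_summable psi phi f : partial_bijection psi phi ->
  square_summable (pull psi f) /\ l2sq (pull psi f) <= n2 f.
Proof.
move=> h; apply: l2sq_le => t ut.
apply: le_trans (l2sq_ub (l2_summable f) (pmap_partial_uniq h ut)).
rewrite big_pmap; apply: ler_sum => y _; rewrite /pull; case: (psi y) => //=.
by rewrite nm0 expr0n.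
Qed.

Definition pullL2 psi phi (h : partial_bijection psi phi) f : l2 R X :=
  L2 (asboolT (pull_square_summable f h).1).

Lemma pull_inner psi phi (h : partial_bijection psi phi) (h' : partial_bijection phi psi) f g :
  inner (pullL2 h f) g = inner f (pullL2 h' g).
Proof.
apply: inner_eq.
have -> : (fun y => pullL2 h f y * (g y)^*) =
    pull psi (fun x => f x * (pullL2 h' g x)^*).
  apply/funext => y; rewrite /= /pull; case E : (psi y) => [x|] /=; last by rewrite mul0r.
  by move/h: E => ->.
apply: pull_sums_to h _ (innerP f (pullL2 h' g)) => x /= E.
by rewrite /pull E conjC0 mulr0.
Qed.

Lemma pull_adjointable psi phi (h : partial_bijection psi phi) : adjointable (pullL2 h).
Proof.
split; first by exists (pullL2 (partial_bijectionC h)); exact: pull_inner.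
exists 1 => f; rewrite mul1r -(@ler_pXn2r _ 2) ?nnegrE ?nh_ge0// !nh_sqr.
by have [] := pull_square_summable f h.
Qed.

Definition pull_op psi phi (h : partial_bijection psi phi) : bop R X :=
  Bop (asboolT (pull_adjointable h)).

Lemma pull_opE psi phi (h : partial_bijection psi phi) f x :
  pull_op h f x = oapp f 0 (psi x).
Proof. by []. Qed.

Lemma pull_op_star psi phi (h : partial_bijection psi phi) :
  cstar (pull_op h) = pull_op (partial_bijectionC h).
Proof. by apply: adj_unique => f g; exact: pull_inner. Qed.

Lemma bop_sum_apply I (r : seq I) (F : I -> bop R X) f x :
  (\sum_(i <- r) F i) f x = \sum_(i <- r) F i f x.
Proof. by elim/big_rec2: _ => // i y T _ <-. Qed.

Lemma delta_summable (x0 : X) : square_summable (fun x => (x == x0)%:R : R[i]).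
Proof.
suff /l2sq_le[] : forall s, uniq s ->
  \sum_(x <- s) nm ((x == x0)%:R : R[i]) ^+ 2 <= 1 by [].
move=> s us; have [x0s|x0s] := boolP (x0 \in s).
  rewrite (bigD1_seq x0)//= eqxx nm1 expr1n big1 ?addr0// => x /negbTE ->.
  by rewrite nm0 expr0n.
rewrite big1_seq// => x /= xs; have [xx0|_] := eqVneq x x0; last by rewrite nm0 expr0n.
by rewrite -xx0 xs in x0s.
Qed.

Definition delta (x0 : X) : l2 R X := L2 (asboolT (delta_summable x0)).

End PartialBijections.

(* Each vertex space is l^2(nat), and the one at v is split along residues
   modulo the number of edges into v. *)
Section Representation.
Variables (R : realType) (E : digraph).
Hypothesis rowfin : row_finite E.

Let X : choiceType := (vertex E * nat)%type.
Let N (v : vertex E) := size (inedges v).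
Let idx (e : edge E) := index e (inedges (rng e)).

Let idx_lt e : (idx e < N (rng e))%N.
Proof. by rewrite /N index_mem (mem_inedges rowfin). Qed.

(** The resulting operator moves the basis vector at (src e, m) to the one at (rng e, m N + idx e),
    so its range is one residue class at [rng e]. *)
Let psi e (x : X) : option X :=
  if (x.1 == rng e) && (x.2 %% N (rng e) == idx e)%N
  then Some (src e, (x.2 %/ N (rng e))%N) else None.

Let phi e (x : X) : option X :=
  if x.1 == src e then Some (rng e, (x.2 * N (rng e) + idx e)%N) else None.

Let psi_phi e : partial_bijection (psi e) (phi e).
Proof.
move=> [u m] [v n]; rewrite /psi /phi /=; split.
  case: eqP => //= ->; case: eqP => // nm_ [<- <-]; rewrite eqxx.
  by rewrite -nm_ -divn_eq.
case: eqP => // -> [<- <-]; have lt := idx_lt e.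
have N0 : (0 < N (rng e))%N by exact: leq_ltn_trans lt.
by rewrite eqxx modnMDl modn_small// eqxx/= divnMDl// divn_small// addn0.
Qed.

Let at_vertex (v : vertex E) (x : X) : option X := if x.1 == v then Some x else None.

Let at_vertexP v : partial_bijection (at_vertex v) (at_vertex v).
Proof.
by move=> x y; rewrite /at_vertex; split; case: ifP => // h [<-]; rewrite h.
Qed.

Definition rep_edge e : bop R X := pull_op (psi_phi e).
Definition rep_vertex v : bop R X := pull_op (at_vertexP v).

Lemma rep_CK : is_CK_family rep_edge rep_vertex.
Proof.
have starE e : cstar (rep_edge e) = pull_op (partial_bijectionC (psi_phi e)).
  exact: pull_op_star.
have star_edge e : cstar (rep_edge e) ** rep_edge e = rep_vertex (src e).
  rewrite starE; apply: bop_ext => f; apply: l2_ext => -[u m].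
  rewrite compE !pull_opE /phi /at_vertex /=; case: eqP => //= ->.
  rewrite /pull; have -> // : psi e (rng e, (m * N (rng e) + idx e)%N) = Some (src e, m).
  by apply/psi_phi; rewrite /phi /= eqxx.
have edge_star e f x : (rep_edge e ** cstar (rep_edge e)) f x =
    if (x.1 == rng e) && (x.2 %% N (rng e) == idx e)%N then f x else 0.
  rewrite starE compE pull_opE; case E1 : (psi e x) => [y|] /=.
    have /psi_phi E2 := E1; rewrite /pull E2 /=.
    by move: E1; rewrite /psi; case: ifP.
  by move: E1; rewrite /psi; case: ifP.
split.
- move=> v; split.
    rewrite /rep_vertex pull_op_star.
    by apply: bop_ext => f; apply: l2_ext => x.
  apply: bop_ext => f; apply: l2_ext => x; rewrite compE !pull_opE /at_vertex.
  by case: ifP => //= h; rewrite /pull /at_vertex h.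
- move=> v w vw; apply: bop_ext => f; apply: l2_ext => x.
  rewrite compE !pull_opE /at_vertex; case: eqP => //= xv.
  by rewrite /pull /at_vertex xv; case: eqP.
- move=> e; rewrite /is_partial_isometry -cmulA star_edge.
  apply: bop_ext => f; apply: l2_ext => x; rewrite compE !pull_opE /psi.
  by case: ifP => //= _; rewrite /pull /at_vertex /= eqxx.
- exact: star_edge.
- move=> v [e0 e0v]; rewrite fsbig_finite; last exact: rowfin.
  apply: bop_ext => f; apply: l2_ext => x.
  rewrite bop_sum_apply; under eq_bigr do rewrite edge_star.
  rewrite pull_opE /at_vertex -/(inedges v).
  have re e : e \in inedges v -> rng e = v by rewrite (mem_inedges rowfin) => /eqP.
  case: eqP => [xv|xv] /=; last first.
    rewrite big1_seq// => e /= /re ->; by case: eqP.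
  have Nv : (0 < N v)%N by rewrite -e0v; exact: leq_ltn_trans (idx_lt e0).
  have lt : (x.2 %% N v < N v)%N by rewrite ltn_mod.
  (* The residue of x.2 singles out the one edge whose range projection keeps the coordinate x. *)
  pose e := nth e0 (inedges v) (x.2 %% N v).
  have ev : e \in inedges v by exact: mem_nth.
  have ie : idx e = (x.2 %% N v)%N.
    by rewrite /idx re// index_uniq//; exact: inedges_uniq.
  rewrite (bigD1_seq e)//=; last exact: inedges_uniq.
  rewrite re// xv eqxx ie eqxx /= big1_seq ?addr0// => e' /= /andP[e'e e'v].
  rewrite re// eqxx /=; case: eqP => // h; case/eqP: e'e.
  by rewrite /e h /idx re// nth_index.
Qed.

Lemma rep_vertex_neq0 v : rep_vertex v <> 0.
Proof.
move=> h; have : rep_vertex v (delta (v, 0%N)) (v, 0%N) = 0 by rewrite h.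
rewrite pull_opE /at_vertex /= eqxx /= eqxx => /eqP.
by rewrite oner_eq0.
Qed.

End Representation.

Lemma graph_algebra_vertex_neq0 (R : realType) (E : digraph) (A : cstarAlgType R)
    (s : edge E -> A) (p : vertex E -> A) :
  row_finite E -> is_graph_algebra s p -> forall v, p v <> 0.
Proof.
move=> rowfin [_ _ univ] v pv0.
have [phi [hom _ phip]] := univ _ _ _ (rep_CK R rowfin).
by apply: (@rep_vertex_neq0 R E v); rewrite -phip pv0 (star_hom0 hom).
Qed.

(** * Annihilators of gauge-invariant ideals *)

Section Annihilator.
Context {R : realType} {E : digraph} {A : cstarAlgType R}.
Variables (s : edge E -> A) (p : vertex E -> A) (gamma : R[i] -> A -> A).
Hypothesis rowfin : row_finite E.
Hypothesis CK : is_CK_family s p.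
Hypothesis gen : smallest (@is_cstar_subalgebra R A) (range s `|` range p) = setT.
Hypothesis gauge : is_gauge_action s p gamma.
Hypothesis p_neq0 : forall v, p v <> 0.
Implicit Types (J K : set A) (v w : vertex E).

Local Notation comb := (comb s p).

(** The inverse law is checked on the generators. The fixed points of a composite of star
    homomorphisms form a C*-subalgebra, closed because star homomorphisms are contractive. *)
Lemma gauge_conj z : `|z| = 1 -> forall x, gamma z (gamma z^* x) = x.
Proof.
move=> z1; have z1' : `|z^*| = 1 by rewrite norm_conjC.
have [hom gs gp] := gauge z1; have [hom' gs' gp'] := gauge z1'.
have [_ gM gS] := hom; have [_ gM' gS'] := hom'.
apply: (generated_induction gen) => /=.
- split; first split => /=.
  + by rewrite (star_hom0 hom') (star_hom0 hom).
  + by move=> x y hx hy; rewrite (star_homD hom') (star_homD hom) hx hy.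
  + by move=> c x hx; rewrite (star_homZ hom') (star_homZ hom) hx.
  + by move=> x y /= hx hy; rewrite gM' gM hx hy.
  + by move=> x /= hx; rewrite gS' gS hx.
  + apply: (@closed_eq _ _ _ id 1).
    * by move=> c x y; rewrite (star_homD hom') (star_homD hom) (star_homZ hom') (star_homZ hom).
    * by [].
    * move=> x; rewrite mul1r; apply: le_trans (star_hom_nm hom _) _.
      exact: star_hom_nm hom' _.
    * by move=> x; rewrite mul1r.
- move=> e; rewrite gs' (star_homZ hom) gs scalerA mulrC -normCK z1 expr1n.
  by rewrite scale1r.
- by move=> v; rewrite gp' gp.
Qed.

Lemma annihilator_ideal J : is_ideal J -> is_ideal (annihilator J).
Proof.
move=> [_ Jl Jr _]; split.
- split.
  + by move=> x _; rewrite cmul0l cmul0r.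
  + move=> x y hx hy u Ju; have [h1 h2] := hx u Ju; have [h3 h4] := hy u Ju.
    by rewrite cmulDl cmulDr h1 h2 h3 h4 addr0.
  + move=> c x hx u Ju; have [h1 h2] := hx u Ju.
    by rewrite cmulZl cmulZr h1 h2 scaler0.
- move=> a x hx u Ju; have [h1 _] := hx u Ju; have [_ h2] := hx _ (Jr a _ Ju).
  by rewrite -cmulA h1 cmul0r cmulA.
- move=> a x hx u Ju; have [_ h1] := hx u Ju; have [h2 _] := hx _ (Jl a _ Ju).
  by rewrite -cmulA h2 cmulA h1 cmul0l.
- have -> : annihilator J = \bigcap_(u in J) ([set x | x ** u = 0] `&` [set x | u ** x = 0]).
    by apply/seteqP; split=> x /= h u Ju; exact: h.
  apply: closed_bigI => u _; apply: closedI.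
    apply: (@closed_eq0 _ _ _ _ (nm u)) => x y.
    by rewrite -cmulBl mulrC; exact: nm_cmul.
  by apply: (@closed_eq0 _ _ _ _ (nm u)) => x y; rewrite -cmulBr; exact: nm_cmul.
Qed.

Definition gauge_stable K := forall z x, `|z| = 1 -> K x -> K (gamma z x).

Lemma gauge_stable_annihilator J : gauge_stable J -> gauge_stable (annihilator J).
Proof.
move=> Js z x z1 hx u Ju; have [[_ gM _] _ _] := gauge z1.
have z1' : `|z^*| = 1 by rewrite norm_conjC.
have [h1 h2] := hx _ (Js _ _ z1' Ju).
rewrite -(gauge_conj z1 u) -!gM h1 h2.
by have [hom _ _] := gauge z1; rewrite (star_hom0 hom).
Qed.

Lemma ideal_vertices_barP K w : ideal_vertices_bar p K w <-> exists2 v, tree w v & K (p v).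
Proof.
split=> [[a Ka aw]|[v [a aw av] Kv]].
  by exists (path_src a) => //; exists a.
by exists a => //; rewrite /ideal_vertices /= av.
Qed.

(** If a path a has range v and source w with p_w in J, then s_a = s_a p_w is in J and p_v s_a =
    s_a; annihilation would make p_w = s_a^* s_a vanish. Conversely, if no such path exists, p_v A
    p_w = 0 for all p_w in J, and these p_w generate J. *)
Lemma annihilator_vertex J v : is_ideal J -> gauge_stable J ->
  annihilator J (p v) <-> ~ ideal_vertices_bar p J v.
Proof.
move=> iJ Js; have [_ Jl Jr _] := iJ; split.
  move=> hv /ideal_vertices_barP [w /treeP [l wl lw] Jw].
  have Jsp : J (spath s p v l).
    by rewrite -(spath_p CK) lw; exact: Jl.
  apply: (p_neq0 (v := w)); rewrite -lw -(spath_star rowfin CK wl).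
  by rewrite -[X in _ ** X](p_spath rowfin CK wl) (hv _ Jsp).1 cmul0r.
(* The arbitrary factor a makes L a two-sided ideal, whereas p_v x = 0 alone defines only a right
   ideal. *)
move=> nv; pose L : set A := [set x | forall a, p v ** a ** x = 0 /\ x ** a ** p v = 0].
have iL : is_ideal L.
  split; first split.
  - by move=> a; rewrite !cmul0l cmul0r.
  - move=> x y hx hy a; have [h1 h2] := hx a; have [h3 h4] := hy a.
    by rewrite cmulDr !cmulDl h1 h2 h3 h4 addr0.
  - move=> c x hx a; have [h1 h2] := hx a.
    by rewrite cmulZr !cmulZl h1 h2 scaler0.
  - move=> b x hx a; have [_ h2] := hx a; have [h1 _] := hx (a ** b).
    by split; [rewrite cmulA -(cmulA (p v))|rewrite -!cmulA (cmulA x) h2 cmul0r].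
  - move=> b x hx a; have [h1 _] := hx a; have [_ h2] := hx (b ** a).
    by split; [rewrite cmulA h1 cmul0l|rewrite -(cmulA x)].
  - have -> : L = \bigcap_(a in setT)
        ([set x | p v ** a ** x = 0] `&` [set x | x ** (a ** p v) = 0]).
      apply/seteqP; split=> x h a => [_|]; first by have [h1 h2] := h a; split=> //=; rewrite cmulA.
      by have [/= h1 h2] := h a I; split=> //; rewrite -cmulA.
    apply: closed_bigI => a _; apply: closedI.
      by apply: (@closed_eq0 _ _ _ _ (nm (p v ** a))) => x y; rewrite -cmulBr; exact: nm_cmul.
    apply: (@closed_eq0 _ _ _ _ (nm (a ** p v))) => x y.
    by rewrite -cmulBl mulrC; exact: nm_cmul.
have zero w a : J (p w) -> p v ** a ** p w = 0.
  move=> Jw; have zcomb r : valid r -> p v ** comb r ** p w = 0.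
    move=> vr; rewrite /comb cmul_sumr cmul_suml big1_seq// => -[c [[v1 l1] [v2 l2]]] /= tr.
    have /and3P[w1 w2 /eqP tE] := allP vr _ tr; rewrite /gwf /gtgt /= in w1 w2 tE.
    rewrite cmulZr cmulZl /monomial /sp /=.
    rewrite -(p_spath rowfin CK w1) -(p_spath rowfin CK w2) cstarM (p_star CK).
    rewrite !cmulA.
    have [vv1|vv1] := eqVneq v v1; last by rewrite (p_orth CK vv1) !cmul0l scaler0.
    have [vv2|vv2] := eqVneq v2 w; last by rewrite -cmulA (p_orth CK vv2) cmul0r scaler0.
    (* In the remaining case r(a) = v and r(b) = w. The common source u has p_u = s_b^* p_w s_b in
       J, which puts v in the excluded set. *)
    case: nv; apply/ideal_vertices_barP; exists (tgt v1 l1).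
      by apply/treeP; exists l1; rewrite ?vv1.
    rewrite tE -(spath_star rowfin CK w2) -[X in _ ** X](p_spath rowfin CK w2) vv2.
    by apply: Jl; apply: Jr.
  have : span_closure s p a by exact: span_dense.
  move=> ha; apply: nm_eq0; apply: small_eq0; first exact: nm_ge0.
  move=> e e0; have [r vr ar] := ha e e0.
  have -> : p v ** a ** p w = p v ** (a - comb r) ** p w.
    by rewrite cmulBr cmulBl (zcomb r vr) subr0.
  apply: le_trans ar; have := nm_cmul (p v ** (a - comb r)) (p w).
  have := nm_cmul (p v) (a - comb r); have := nm_projection (p_proj CK v).
  have := nm_projection (p_proj CK w); have := nm_ge0 (p v); have := nm_ge0 (p w).
  have := nm_ge0 (a - comb r); have := nm_ge0 (p v ** (a - comb r)); nra.
move=> x Jx; have : L x.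
  move: Jx; rewrite (gauge_invariant_ideal rowfin CK gauge gen iJ Js).
  apply: vertex_ideal_sub => // w Jw a; split; first exact: zero.
  (* The second condition is the adjoint of the first one taken at a^*; J itself is not
     conjugated. *)
  have E1 : cstar (p w ** a ** p v) = p v ** cstar a ** p w.
    by rewrite !cstarM !(p_star CK) cmulA.
  by rewrite -[LHS]cstarK E1 zero// cstar0.
by move=> /(_ (p v)); rewrite -(cmulA x) !(p_idem CK).
Qed.

Lemma annihilatorE J : is_ideal J -> gauge_stable J ->
  annihilator J = vertex_ideal p (~` ideal_vertices_bar p J).
Proof.
move=> iJ Js.
rewrite [LHS](gauge_invariant_ideal rowfin CK gauge gen (annihilator_ideal iJ)
  (gauge_stable_annihilator Js)); congr vertex_ideal.
by apply/seteqP; split=> v /annihilator_vertex; apply.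
Qed.

(** The projection p_v lies in the annihilator exactly when v is outside the bar set of J. So w
    avoids the bar set of the annihilator exactly when no v in T(w) lies outside that of J. *)
Lemma bar_annihilator J : is_ideal J -> gauge_stable J ->
  ~` ideal_vertices_bar p (annihilator J) = [set w | tree w `<=` ideal_vertices_bar p J].
Proof.
move=> iJ Js; apply/seteqP; split=> w /= h.
  move=> v wv; apply: contrapT => /(annihilator_vertex v iJ Js) av.
  by apply: h; apply/ideal_vertices_barP; exists v.
by move=> /ideal_vertices_barP [v /h Jv /(annihilator_vertex v iJ Js)].
Qed.

End Annihilator.

Theorem proposition3p4 (R : realType) (E : digraph) (A : cstarAlgType R)
    (s : edge E -> A) (p : vertex E -> A) (gamma : R[i] -> A -> A)
    (J : set A)
    (rowfinE : row_finite E)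
    (graphA : is_graph_algebra s p)
    (gaugeA : is_gauge_action s p gamma)
    (idealJ : is_ideal J)
    (invJ : gauge_invariant gamma J) :
  [/\ annihilator J = vertex_ideal p (~` ideal_vertices_bar p J),
      annihilator (annihilator J)
        = vertex_ideal p [set w | tree w `<=` ideal_vertices_bar p J] &
      is_regular J <->
        ideal_vertices p J = [set w | tree w `<=` ideal_vertices_bar p J]].
Proof.
have [CK gen _] := graphA; have pn0 := graph_algebra_vertex_neq0 rowfinE graphA.
have Js : gauge_stable gamma J.
  by move=> z x z1 Jx; rewrite -(invJ z z1); exists x.
have iK := annihilator_ideal idealJ.
have Ks := gauge_stable_annihilator gen gaugeA Js.
have barK := bar_annihilator rowfinE CK gen gaugeA pn0 idealJ Js.
have eq2 : annihilator (annihilator J) =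
    vertex_ideal p [set w | tree w `<=` ideal_vertices_bar p J].
  by rewrite (annihilatorE rowfinE CK gen gaugeA pn0 iK Ks) barK.
split=> //; first by rewrite (annihilatorE rowfinE CK gen gaugeA pn0 idealJ Js).
split=> [regJ|HJ].
  (* Regularity turns H(J) into the vertex set of the second annihilator, which [annihilator_vertex]
     describes when applied to the first one. *)
  rewrite -barK {1}regJ; apply/seteqP.
  by split=> v /(annihilator_vertex rowfinE CK gen gaugeA pn0 v iK Ks).
by rewrite /is_regular eq2 -HJ; exact: (gauge_invariant_ideal rowfinE CK gaugeA gen idealJ Js).
Qed.
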